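(* For each $n$, let $\sigma_{n+1}$ be a uniformly random permutation of $\mathfrak{S}_{n+1}$. Then the random continuous functions $t\mapsto \frac{1}{\sqrt n}f_{\sigma_{n+1}}(nt)$, $t\in[0,1]$, converge in distribution (in $\mathcal{C}([0,1],\mathbb{R})$ with the uniform norm) to $\frac{1}{\sqrt3}\mathcal{B}$, where $\mathcal{B}$ is a standard Brownian motion on $[0,1]$.
   Context: For $\sigma\in\mathfrak{S}_{n+1}$ (written as a word $\sigma(1)\cdots\sigma(n+1)$), $i\in\{1,\dots,n\}$ is a descent of $\sigma$ if $\sigma(i+1)<\sigma(i)$. $f_\sigma:[0,n]\to\mathbb{R}$ is the piecewise linear function with $f_\sigma(0)=0$, linear on each $[i-1,i]$, and $f_\sigma(i)-f_\sigma(i-1)=-1$ if $i$ is a descent of $\sigma$ and $+1$ otherwise. *)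

(* Defs.v *)
From HB Require Import structures.
From mathcomp Require Import all_boot all_order all_algebra all_fingroup.
From mathcomp Require Import all_classical all_reals all_analysis.
Set Implicit Arguments. Unset Strict Implicit. Unset Printing Implicit Defensive.
Import numFieldNormedType.Exports.
Import Order.TTheory GRing.Theory Num.Theory.
Local Open Scope ring_scope.
Local Open Scope classical_set_scope.

Section Defs.
Context {R : realType}.

(* sigma : 'S_(n.+1) is a permutation of {0,..,n}; the paper's word
   sigma(1) ... sigma(n+1) is sigma(0) ... sigma(n) here (0-based).
   Position i in {1,..,n} is a descent iff sigma(i+1) < sigma(i) (1-based),
   i.e. iff sigma(i) < sigma(i-1) with 0-based indices. *)
Definition is_descent (n : nat) (s : 'S_(n.+1)) (i : nat) : bool :=
  (nat_of_ord (s (inord i)) < nat_of_ord (s (inord i.-1)))%N.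

Definition fstep (n : nat) (s : 'S_(n.+1)) (i : nat) : R :=
  if is_descent s i then -1 else 1.

Definition fval (n : nat) (s : 'S_(n.+1)) (k : nat) : R :=
  \sum_(1 <= i < k.+1) fstep s i.

(* f_sigma : [0,n] -> R, piecewise linear interpolation; extended by
   constants outside [0,n] (irrelevant for the statement). *)
Definition fsigma (n : nat) (s : 'S_(n.+1)) (x : R) : R :=
  if x <= 0 then 0
  else if n%:R <= x then fval s n
  else let k := `|Num.floor x|%N in fval s k + (x - k%:R) * fstep s k.+1.

Definition rescaled_path (n : nat) (s : 'S_(n.+1)) (t : R) : R :=
  (Num.sqrt n%:R)^-1 * fsigma s (n%:R * t).

Definition uniform_perm_expect (n : nat) (F : (R -> R) -> R) : R :=
  (#|{perm 'I_(n.+1)}|%:R)^-1 * \sum_(s : 'S_(n.+1)) F (rescaled_path s).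

(* F is a bounded continuous functional on C([0,1],R) with the uniform norm;
   elements of C([0,1],R) are represented by functions R -> R continuous on
   [0,1] (values outside [0,1] are ignored, which continuity of F forces). *)
Definition bounded_continuous_functional (F : (R -> R) -> R) : Prop :=
  (exists M : R, forall g : R -> R, {within `[0, 1], continuous g} -> `|F g| <= M) /\
  (forall g : R -> R, {within `[0, 1], continuous g} ->
     forall e : R, 0 < e -> exists2 d : R, 0 < d &
       forall h : R -> R, {within `[0, 1], continuous h} ->
         (forall t, t \in `[0, 1] -> `|g t - h t| <= d) ->
         `|F g - F h| < e).

(* B is a standard Brownian motion on [0,1] on the probability space (T,P):
   B_0 = 0, continuous paths, and for every 0 = t_0 < t_1 < ... < t_k <= 1 the
   increments B_{t_i} - B_{t_{i-1}} are independent with law N(0, t_i - t_{i-1})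
   (normal_prob m s has mean m and standard deviation s). *)
Definition standard_brownian_motion (d : measure_display) (T : measurableType d)
    (P : probability T R) (B : R -> T -> R) : Prop :=
  [/\ forall w, B 0 w = 0,
      forall w, {within `[0, 1], continuous (fun t => B t w)},
      forall t, t \in `[0, 1] -> measurable_fun setT (B t) &
      forall (k : nat) (ts : 'I_k.+1 -> R) (A : 'I_k -> set R),
        ts ord0 = 0 ->
        (forall i : 'I_k, ts (widen_ord (leqnSn k) i) < ts (lift ord0 i)) ->
        ts ord_max <= 1 ->
        (forall i, measurable (A i)) ->
        P [set w | forall i : 'I_k,
                    A i (B (ts (lift ord0 i)) w - B (ts (widen_ord (leqnSn k) i)) w)]
        = (\big[*%E/1%E]_(i < k)
             normal_prob 0 (Num.sqrt (ts (lift ord0 i) - ts (widen_ord (leqnSn k) i)))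
               (A i))%E].

End Defs.

(* Main.v *)
Require Import Defs.
From HB Require Import structures.
From mathcomp Require Import all_boot all_order all_algebra all_fingroup.
From mathcomp Require Import all_classical all_reals all_analysis.
From mathcomp Require Import measurable_realfun.
From mathcomp Require Import ring lra zify.
Import numFieldNormedType.Exports.
Import Order.TTheory GRing.Theory Num.Theory.
Set Implicit Arguments. Unset Strict Implicit. Unset Printing Implicit Defensive.
Local Open Scope ring_scope.
Local Open Scope classical_set_scope.

(** A uniform permutation is the standardisation of a word [a] of [n + 1] independent
    uniform letters of [Z/NZ], up to the event (negligible for [N] large) that two letters
    coincide.  The increments [b_i = a_i - a_(i-1) mod N] are again independent and uniform,
    and the descent step equals [(N - 1 - 2 b_i) / N + 1 / N + 2 (a_i - a_(i-1)) / N]; the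
    last terms sum to a bounded quantity, so the path is within O(1) of a random walk whose
    steps are uniform on [-1, 1], hence of variance 1/3.  Donsker's theorem for this walk is
    obtained by Lindeberg's replacement of its blocks by increments of the given Brownian
    motion, where expectations of a Lipschitz function of finitely many block sums are
    compared one coordinate at a time, together with a fourth moment maximal inequality.
    Bounded continuous functionals are reached from below by their Lipschitz
    inf-convolutions. *)

(** * Iterated expectations *)

(** The functional [F] is merely continuous on paths, so the integrands met inside iterated
    expectations carry no measurability. Every law that is iterated is therefore finitely supported:
    letters of Z/NZ on one side, Brownian increments rounded to finitely many values on the other.
    The rounding mesh tends to 0 only once all blocks have been exchanged.

    A block sum is not matched with a normal variable in one go. Its K steps are exchanged one by
    one for the increments of the Brownian motion over a subdivision of [0, 1/m] into K cells, and
    the sum of these telescopes to the increment over [0, 1/m]: the path itself supplies the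
    additivity of normal laws.

    The parameters are fixed in the order m (number of blocks), h (smoothing scale), n. The alphabet
    has N = (n + 1)^3 letters, so that two of the n + 1 letters coincide with probability at most
    1/(n + 1). *)

Section Means.
Context {R : realType}.

(** An expectation reduced to its algebra: linear, monotone, normalised, and defined on all
    functions. Finitely supported laws have this form, and the class is closed under sums of
    independent variables and under scaling. *)
Record mean := Mean {
  mean_fun :> (R -> R) -> R;
  mean_linear : forall (a : R) f g,
    mean_fun (fun x => a * f x + g x) = a * mean_fun f + mean_fun g;
  mean_le : forall f g, (forall x, f x <= g x) -> mean_fun f <= mean_fun g;
  mean1 : mean_fun (fun=> 1) = 1 }.

Lemma eq_mean (E : mean) f g : f =1 g -> E f = E g.
Proof. by move=> /funext ->. Qed.

Lemma mean0 (E : mean) : E (fun=> 0) = 0.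
Proof.
have := mean_linear E 1 (fun=> 0) (fun=> 0).
rewrite (_ : (fun x => _) = (fun=> 0)); last by apply/funext => x; rewrite mulr0 addr0.
by move/(congr1 (fun z => z - E (fun=> 0))); rewrite subrr mul1r addrK.
Qed.

Lemma meanZ (E : mean) a f : E (fun x => a * f x) = a * E f.
Proof.
rewrite -[RHS]addr0 -(mean0 E) -mean_linear.
by apply: eq_mean => x; rewrite addr0.
Qed.

Lemma meanD (E : mean) f g : E (fun x => f x + g x) = E f + E g.
Proof.
rewrite -[X in X + _]mul1r -mean_linear.
by apply: eq_mean => x; rewrite mul1r.
Qed.

Lemma meanB (E : mean) f g : E (fun x => f x - g x) = E f - E g.
Proof. by rewrite -mulN1r -meanZ -meanD; apply: eq_mean => x; rewrite mulN1r. Qed.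

Lemma mean_cst (E : mean) c : E (fun=> c) = c.
Proof.
by rewrite -[RHS]mulr1 -(mean1 E) -meanZ; apply: eq_mean => x; rewrite mulr1.
Qed.

Lemma mean_dist (E : mean) f g e : (forall x, `|f x - g x| <= e) ->
  `|E f - E g| <= e.
Proof.
move=> fg; rewrite -meanB ler_norml -(mean_cst E e) -mulN1r -meanZ.
by apply/andP; split; apply: mean_le => x; have := fg x; rewrite ler_norml ?mulN1r => /andP[].
Qed.

Lemma mean_norm (E : mean) f : `|E f| <= E (fun x => `|f x|).
Proof.
rewrite ler_norml -mulN1r -meanZ.
by apply/andP; split; apply: mean_le => x; rewrite ?mulN1r; have := lexx `|f x|; rewrite {1}ler_norml => /andP[].
Qed.

(* Expectation of [Phi] at a sequence of independent variables with laws [Es]. *)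
Fixpoint itE (Es : seq mean) (Phi : seq R -> R) : R :=
  if Es is E :: Es' then E (fun x => itE Es' (fun s => Phi (x :: s)))
  else Phi [::].

Lemma eq_itE Es Phi Psi : (forall s, size s = size Es -> Phi s = Psi s) ->
  itE Es Phi = itE Es Psi.
Proof.
elim: Es Phi Psi => [|E Es IH] Phi Psi PP /=; first exact: PP.
by apply: eq_mean => x; apply: IH => s ss; apply: PP; rewrite /= ss.
Qed.

Lemma itE_linear Es (a : R) Phi Psi :
  itE Es (fun s => a * Phi s + Psi s) = a * itE Es Phi + itE Es Psi.
Proof.
elim: Es Phi Psi => [//|E Es IH] Phi Psi /=.
by rewrite -mean_linear; apply: eq_mean => x; rewrite IH.
Qed.

Lemma itE_le Es Phi Psi : (forall s, size s = size Es -> Phi s <= Psi s) ->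
  itE Es Phi <= itE Es Psi.
Proof.
elim: Es Phi Psi => [|E Es IH] Phi Psi PP /=; first exact: PP.
by apply: mean_le => x; apply: IH => s ss; apply: PP; rewrite /= ss.
Qed.

Lemma itE_cst Es c : itE Es (fun=> c) = c.
Proof. by elim: Es => //= E Es ->; rewrite mean_cst. Qed.

Lemma itE_cat Es Fs Phi :
  itE (Es ++ Fs) Phi = itE Es (fun s => itE Fs (fun t => Phi (s ++ t))).
Proof. by elim: Es Phi => [//|E Es IH] Phi /=; apply: eq_mean => x; exact: IH. Qed.

Lemma itED Es Phi Psi : itE Es (fun s => Phi s + Psi s) = itE Es Phi + itE Es Psi.
Proof.
by rewrite -[X in X + _]mul1r -itE_linear; apply: eq_itE => s _; rewrite mul1r.
Qed.

Lemma itE_sum Es (I : Type) (r : seq I) (Phi : I -> seq R -> R) :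
  itE Es (fun s => \sum_(i <- r) Phi i s) = \sum_(i <- r) itE Es (Phi i).
Proof.
elim: r => [|i r IH]; first by rewrite big_nil -[RHS](itE_cst Es);
  apply: eq_itE => s _; rewrite big_nil.
by rewrite big_cons -IH -itED; apply: eq_itE => s _; rewrite big_cons.
Qed.

Lemma itEZ Es a Phi : itE Es (fun s => a * Phi s) = a * itE Es Phi.
Proof.
rewrite -[RHS]addr0 -(itE_cst Es 0) -itE_linear.
by apply: eq_itE => s _; rewrite addr0.
Qed.

Lemma itEB Es Phi Psi : itE Es (fun s => Phi s - Psi s) = itE Es Phi - itE Es Psi.
Proof.
by rewrite -mulN1r addrC -itE_linear; apply: eq_itE => s _; rewrite mulN1r addrC.
Qed.

Lemma itE_dist_le Es Phi Psi (G : seq R -> R) :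
  (forall s, size s = size Es -> `|Phi s - Psi s| <= G s) ->
  `|itE Es Phi - itE Es Psi| <= itE Es G.
Proof.
move=> PP; rewrite -itEB ler_norml -mulN1r -itEZ.
by apply/andP; split; apply: itE_le => s /PP; rewrite ler_norml ?mulN1r => /andP[].
Qed.

Lemma itE_dist Es Phi Psi e : (forall s, size s = size Es -> `|Phi s - Psi s| <= e) ->
  `|itE Es Phi - itE Es Psi| <= e.
Proof. by move=> PP; rewrite -(itE_cst Es e); exact: itE_dist_le. Qed.

Lemma itE_norm Es Phi M : (forall s, `|Phi s| <= M) -> `|itE Es Phi| <= M.
Proof.
move=> PM; rewrite -[itE Es Phi]subr0 -(itE_cst Es 0).
by apply: itE_dist => s _; rewrite subr0.
Qed.

Definition sum_mean (Es : seq mean) : mean.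
Proof.
apply: (@Mean (fun f => itE Es (fun s => f (\sum_(x <- s) x)))).
- by move=> a f g; exact: itE_linear.
- by move=> f g fg; apply: itE_le => s _; exact: fg.
- exact: itE_cst.
Defined.

(** When one coordinate is exchanged, the later ones are already integrated out; a class stable
    under such averages still contains the resulting function of that coordinate. *)
Definition mixture_stable (C : (R -> R) -> Prop) :=
  forall Es (Phi : seq R -> R -> R), (forall s, C (Phi s)) ->
    C (fun x => itE Es (fun s => Phi s x)).

(* Lindeberg's replacement argument: the laws are exchanged one at a time. *)
Lemma itE_replace (I : Type) (l : seq I) (E F : I -> mean)
    (C : (R -> R) -> Prop) (e : I -> R) (Phi : seq R -> R) :
  mixture_stable C ->
  (forall i f, C f -> `|E i f - F i f| <= e i) ->
  (forall s t, C (fun x => Phi (s ++ x :: t))) ->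
  `|itE (map E l) Phi - itE (map F l) Phi| <= \sum_(i <- l) e i.
Proof.
move=> CC EF; elim: l Phi => [|i l IH] Phi CPhi /=.
  by rewrite big_nil subrr normr0.
rewrite big_cons.
(* The intermediate term has the head law exchanged and the tail laws not yet: stability of [C]
   treats the head, induction under [F i] the tail. *)
rewrite -(subrK (F i (fun x => itE (map E l) (fun s => Phi (x :: s))))
                (E i _)) -addrA.
apply: le_trans (ler_normD _ _) _; apply: lerD.
  by apply: EF; apply: CC => s; exact: (CPhi [::]).
apply: mean_dist => x; apply: IH => s t.
exact: (CPhi (x :: s)).
Qed.

Lemma lipschitz_mixture (L M : R) : mixture_stable
  (fun f => (forall x, `|f x| <= M) /\ (forall x y, `|f x - f y| <= L * `|x - y|)).
Proof.
move=> Es Phi CPhi; split=> [x|x y].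
  by apply: itE_norm => s; case: (CPhi s).
by apply: itE_dist => s _; case: (CPhi s).
Qed.

(** A second order expansion at 0 with uniform bounds, stated without derivatives: averaging the
    coefficients keeps a mixture in the class, with no differentiation under an expectation. *)
Definition taylor_class (A B C : R) (f : R -> R) := exists a b : R,
  [/\ `|a| <= A, `|b| <= B &
      forall y, `|f y - (f 0 + a * y + b * y ^+ 2)| <= C * `|y| ^+ 3].

Lemma taylor_mixture (A B C : R) : mixture_stable (taylor_class A B C).
Proof.
move=> Es Phi CPhi.
have [a Ha] := choice CPhi; have [b ab] := choice Ha => {CPhi Ha}.
exists (itE Es a), (itE Es b); split.
- by apply: itE_norm => s; case: (ab s).
- by apply: itE_norm => s; case: (ab s).
move=> y.
rewrite [X in _ - X](_ : _ = itE Es (fun s => y ^+ 2 * b s + (y * a s + Phi s 0))).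
  apply: itE_dist => s _; case: (ab s) => _ _ /(_ y).
  suff -> : y ^+ 2 * b s + (y * a s + Phi s 0) = Phi s 0 + a s * y + b s * y ^+ 2 by [].
  by ring.
by rewrite !itE_linear; ring.
Qed.

(** The quadratic part only sees the first two moments, and the remainder costs third absolute
    moments. The term in [F id] is there because rounding down biases a centred normal law. *)
Lemma taylor_mean_dist (E F : mean) (A B C : R) f : taylor_class A B C f ->
  E id = 0 -> 0 <= C ->
  `|E f - F f| <= A * `|F id| + B * `|E (fun x => x ^+ 2) - F (fun x => x ^+ 2)|
     + C * (E (fun x => `|x| ^+ 3) + F (fun x => `|x| ^+ 3)).
Proof.
move=> [a [b [aA bB fC]]] E0 C0.
pose g y := f 0 + a * y + b * y ^+ 2.
have gE (G : mean) : G g = f 0 + a * G id + b * G (fun x => x ^+ 2).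
  by rewrite /g meanD meanD mean_cst !meanZ.
have fg (G : mean) : `|G f - G g| <= C * G (fun x => `|x| ^+ 3).
  rewrite -meanB -meanZ; apply: le_trans (mean_norm _ _) _.
  by apply: mean_le => x; exact: fC.
have -> : E f - F f = (E g - F g) + ((E f - E g) - (F f - F g)) by ring.
apply: le_trans (ler_normD _ _) _; rewrite mulrDr; apply: lerD; last first.
  by apply: le_trans (ler_normB _ _) _; exact: lerD (fg _) (fg _).
have -> : E g - F g = - (a * F id) +
    b * (E (fun x => x ^+ 2) - F (fun x => x ^+ 2)).
  by rewrite !gE E0; ring.
apply: le_trans (ler_normD _ _) _; rewrite normrN !normrM.
by apply: lerD; apply: ler_wpM2r.
Qed.

End Means.

(** * Smoothing and Lindeberg's estimate *)

Section Smoothing.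
Context {R : realType}.
Notation mu := (@lebesgue_measure R).

Lemma continuous_integrable_segment (f : R -> R) (a b : R) : continuous f ->
  mu.-integrable `[a, b] (EFin \o f).
Proof.
move=> cf; apply: continuous_compact_integrable; first exact: segment_compact.
exact: continuous_subspaceT.
Qed.

(** The integral from 0 is written as a difference of two integrals from a common left end below
    both points, which covers both signs of [x]. Near a given point that left end can be frozen, and
    the fundamental theorem applies. *)
Lemma antiderivative (f : R -> R) : continuous f ->
  exists F : R -> R, forall x : R, is_derive x 1 F (f x).
Proof.
move=> cf; pose I (N x : R) := (\int[mu]_(t in `[- N, x]) f t)%R.
have IB (N N' x : R) : `|x| < N -> N <= N' ->
    I N' x = I N' (- N) + I N x.
  move=> xN NN'; rewrite /I.
  have Nx : - N < x by move: xN; rewrite ltr_norml => /andP[].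
  have -> : (\int[mu]_(t in `[- N, x]) f t)%R = (\int[mu]_(t in `]- N, x]) f t)%R.
    rewrite Rintegral_itv_obnd_cbnd//.
    by apply: integrableS (continuous_integrable_segment (- N) x cf) => //;
      apply: subset_itvr; rewrite bnd_simp.
  rewrite -(@Rintegral_itvB _ f (BLeft (- N')) (BRight x) (- N)) ?bnd_simp ?lerN2 ?(ltW Nx)//.
    by rewrite addrC subrK.
  exact: continuous_integrable_segment.
pose F x := I (`|x| + 1) x - I (`|x| + 1) 0.
have FE N x : `|x| + 1 <= N -> F x = I N x - I N 0.
  move=> xN; rewrite /F.
  rewrite (@IB (`|x| + 1) N x) ?(@IB (`|x| + 1) N 0)//; first ring.
    by rewrite normr0 ltr_pwDr.
  by rewrite ltrDl.
exists F => x; pose N := `|x| + 2.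
have xN : - N < x.
  by rewrite ltrNl (le_lt_trans (ler_norm _))// normrN ltrDl.
have [dI I'] : derivable (I N) x 1 /\ (I N)^`() x = f x.
  apply: (@continuous_FTC1_closed _ f (- N) x (x + 1)) => //.
  - by rewrite ltrDl.
  - exact: continuous_integrable_segment.
  - exact: cf.
have dIN : is_derive x 1 (fun y => I N y - I N 0) (f x).
  have : is_derive x 1 (I N) (f x).
    by split; [exact: dI|rewrite -derive1E; exact: I'].
  move=> ?; apply: is_derive_eq; exact: subr0.
apply: near_eq_is_derive dIN.
near=> y; apply/esym/FE; rewrite /N -[2]/(1 + 1) addrA lerD2r.
have : `|x - y| <= 1 by near: y; apply: (@cvgr_dist_le _ R^o) => //; exact: cvg_id.
by have := ler_dist_dist x y; rewrite ler_norml => /andP[? ?] ?; lra.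
Unshelve. all: by end_near. Qed.

Lemma is_derive_continuous (f df : R -> R) : (forall x : R, is_derive x 1 f (df x)) ->
  continuous f.
Proof.
by move=> fdf x; apply/differentiable_continuous/derivable1_diffP; case: (fdf x).
Qed.

Lemma mean_value (f df : R -> R) : (forall x : R, is_derive x 1 f (df x)) ->
  forall a b : R, exists2 c, `|c - a| <= `|b - a| & f b - f a = df c * (b - a).
Proof.
move=> fdf a b; have cf := is_derive_continuous fdf.
have [ab|ba] := leP a b.
  have [c] := @MVT_segment _ f df _ _ ab (fun x _ => fdf x) (continuous_subspaceT cf).
  rewrite in_itv /= => /andP[ac cb] fE; exists c => //.
  by rewrite !ger0_norm ?subr_ge0// lerD2r.
have [c] := @MVT_segment _ f df _ _ (ltW ba) (fun x _ => fdf x) (continuous_subspaceT cf).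
rewrite in_itv /= => /andP[bc ca] fE; exists c.
  rewrite !ler0_norm ?subr_le0 ?(ltW ba)// ; lra.
by rewrite -opprB fE -mulrN opprB.
Qed.

Lemma is_derive_shift (f df : R -> R) (a x : R) : (forall x : R, is_derive x 1 f (df x)) ->
  is_derive x 1 (fun y => f (y + a)) (df (x + a)).
Proof.
move=> fdf; have -> : df (x + a) = df (x + a) * 1 by rewrite mulr1.
apply: (@is_derive1_comp _ f (fun y => y + a)).
by apply: is_derive_eq; rewrite addr0.
Qed.

Lemma lipschitz_continuous (f : R -> R) (L : R) :
  (forall x y, `|f x - f y| <= L * `|x - y|) -> continuous f.
Proof.
move=> fL x; apply/cvgrPdist_le => /= e e0.
near=> y; rewrite (le_trans (fL _ _))//.
have L0 : 0 < `|L| + 1 by rewrite ltr_wpDl.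
apply: (@le_trans _ _ ((`|L| + 1) * `|x - y|)).
  by apply: ler_wpM2r => //; rewrite (le_trans (ler_norm _))// lerDl.
rewrite -ler_pdivlMl//; near: y.
by apply: (@cvgr_dist_le _ R^o); [exact: cvg_id|rewrite mulr_gt0// invr_gt0].
Unshelve. all: by end_near. Qed.

(* The mollifier is the second difference of a second antiderivative. *)
Lemma lipschitz_smoothing (f : R -> R) (L M h : R) : 0 < h ->
  (forall x, `|f x| <= M) -> (forall x y, `|f x - f y| <= L * `|x - y|) ->
  exists2 g : R -> R, (forall x, `|g x - f x| <= 2 * L * h) &
    forall x, taylor_class (2 * M / h) (2 * M / h ^+ 2) (4 * L / h ^+ 2)
      (fun y => g (x + y)).
Proof.
move=> h0 fM fL.
have L0 : 0 <= L.
  by have := fL 1 0; rewrite subr0 normr1 mulr1; exact: le_trans.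
have M0 : 0 <= M by apply: le_trans (fM 0).
have h2 : 0 < h ^+ 2 by rewrite exprn_gt0.
have hN0 : h != 0 by rewrite gt_eqF.
have [G G'] := antiderivative (lipschitz_continuous fL).
have [H H'] := antiderivative (is_derive_continuous G').
(* Since [H] has second derivative [f], this is the average of [f] over [x, x + 2h] against a
   triangular kernel; [g1] and [g2] are its first two derivatives. *)
pose g x := (H (x + 2 * h) - H (x + h) - (H (x + h) - H (x + 0))) / h ^+ 2.
pose g1 x := (G (x + 2 * h) - G (x + h) - (G (x + h) - G (x + 0))) / h ^+ 2.
pose g2 x := (f (x + 2 * h) - f (x + h) - (f (x + h) - f (x + 0))) / h ^+ 2.
have gg1 (x : R) : is_derive x 1 g (g1 x).
  have d1 := is_derive_shift (2 * h) x H'.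
  have d2 := is_derive_shift h x H'.
  have d3 := is_derive_shift 0 x H'.
  rewrite /g; apply: is_derive_eq.
  by rewrite /g1 scaler0 add0r /GRing.scale /= mulrC.
have g1g2 (x : R) : is_derive x 1 g1 (g2 x).
  have d1 := is_derive_shift (2 * h) x G'.
  have d2 := is_derive_shift h x G'.
  have d3 := is_derive_shift 0 x G'.
  rewrite /g1; apply: is_derive_eq.
  by rewrite /g2 scaler0 add0r /GRing.scale /= mulrC.
have g2L x y : `|g2 x - g2 y| <= 4 * L / h ^+ 2 * `|x - y|.
  have -> : g2 x - g2 y = ((f (x + 2 * h) - f (y + 2 * h)) - (f (x + h) - f (y + h))
     - ((f (x + h) - f (y + h)) - (f (x + 0) - f (y + 0)))) / h ^+ 2.
    by rewrite /g2; ring.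
  rewrite normrM [X in _ * X]ger0_norm ?invr_ge0 ?(ltW h2)//.
  rewrite mulrAC ler_pM2r ?invr_gt0//.
  have fa a : `|f (x + a) - f (y + a)| <= L * `|x - y|.
    by apply: le_trans (fL _ _) _; rewrite opprD addrACA subrr addr0.
  have -> : 4 * L * `|x - y| = (L * `|x - y| + L * `|x - y|) +
     (L * `|x - y| + L * `|x - y|) by ring.
  by do 2!(apply: le_trans (ler_normB _ _) _; apply: lerD => //);
    apply: le_trans (ler_normB _ _) _; apply: lerD.
exists g => [x|x].
  have [c ch cE] := mean_value (fun x => is_deriveB (is_derive_shift h x H') (H' x)) x (x + h).
  have [c' ch' cE'] := mean_value G' c (c + h).
  (* Two mean value steps, each of length at most [h], lead from [x] to [c']; hence the distance
     [2 * L * h]. *)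
  have -> : g x = f c'.
    rewrite /g addr0 -[x + 2 * h](_ : x + h + h = _); last by ring.
    rewrite [X in X / _](_ : _ = f c' * h ^+ 2) ?mulfK ?gt_eqF//.
    move: cE cE'; rewrite /= ![_ + h - _]addrAC !subrr !add0r.
    rewrite -[(_ - _) (x + h)]/(H (x + h + h) - H (x + h)).
    by rewrite -[(_ - _) x]/(H (x + h) - H x) => -> ->; ring.
  rewrite (le_trans (fL _ _))// [2 * L]mulrC -mulrA ler_wpM2l//.
  have -> : c' - x = (c' - c) + (c - x) by ring.
  rewrite (le_trans (ler_normD _ _))//.
  move: ch ch'; rewrite ![_ + h - _]addrAC !subrr !add0r (gtr0_norm h0).
  by move=> ? ?; lra.
exists (g1 x), (g2 x / 2); split.
- have [c _ cE] := mean_value G' (x + h) (x + 2 * h).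
  have [c' _ cE'] := mean_value G' (x + 0) (x + h).
  rewrite /g1 cE cE' [X in `|X|](_ : _ = (f c - f c') / h); last by field.
  rewrite normrM [X in _ * X]ger0_norm ?invr_ge0 ?(ltW h0)//.
  rewrite ler_pM2r ?invr_gt0// (le_trans (ler_normB _ _))// mulr2n mulrDl mul1r.
  exact: lerD.
- rewrite /g2 normrM [`|_^-1|]ger0_norm ?invr_ge0// normrM [`|_^-1|]ger0_norm ?invr_ge0 ?(ltW h2)//.
  rewrite mulrAC ler_pM2r ?invr_gt0// ler_pdivrMr//.
  have -> : 2 * M * 2 = (M + M) + (M + M) by ring.
  by apply: le_trans (ler_normB _ _) _; apply: lerD;
    apply: le_trans (ler_normB _ _) _; apply: lerD.
move=> y; rewrite addr0.
(* The Taylor remainder vanishes at 0 together with its derivative [r1], whose own derivative is an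
   increment of [g2]. Two mean value steps and the Lipschitz bound on [g2] give the cube of
   [|y|]. *)
pose r z := g (z + x) - g x - g1 x * z - g2 x / 2 * z ^+ 2.
pose r1 z := g1 (z + x) - g1 x - g2 x * z.
have rr1 (z : R) : is_derive z 1 r (r1 z).
  have d1 := is_derive_shift x z gg1.
  rewrite /r; apply: is_derive_eq; rewrite /r1 /=.
  by rewrite /GRing.scale/=; field.
have r1r2 (z : R) : is_derive z 1 r1 (g2 (z + x) - g2 x).
  have d1 := is_derive_shift x z g1g2.
  rewrite /r1; apply: is_derive_eq.
  by rewrite /GRing.scale/=; ring.
have [c cy cE] := mean_value rr1 0 y.
have [c' cy' cE'] := mean_value r1r2 0 c.
have r0 : r 0 = 0 by rewrite /r add0r; ring.
have r10 : r1 0 = 0 by rewrite /r1 add0r; ring.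
move: cE cE' cy cy'; rewrite r0 r10 !subr0 => cE cE' cy cy'.
have -> : g (x + y) - (g x + g1 x * y + g2 x / 2 * y ^+ 2) = r y.
  by rewrite /r [y + x]addrC; ring.
rewrite cE cE' !normrM [X in _ <= X](_ : _ = 4 * L / h ^+ 2 * `|y| * `|y| * `|y|); last by field.
rewrite ler_wpM2r//.
apply: ler_pM => //.
apply: le_trans (g2L _ _) _; rewrite addrK ler_wpM2l ?(le_trans cy')//.
by rewrite divr_ge0// ?mulr_ge0// ltW.
Qed.

(** Passing to the smoothed function costs [2 * L * h] on each side, and the smoothed function is
    exchanged law by law. The scale [h] stays free: a small [h] reduces the first cost and inflates
    the others. *)
Lemma lindeberg_dist (I : Type) (l : seq I) (E F : I -> mean)
    (f : R -> R) (L M h : R) : 0 < h ->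
  (forall x, `|f x| <= M) -> (forall x y, `|f x - f y| <= L * `|x - y|) ->
  (forall i, E i id = 0) ->
  `|sum_mean (map E l) f - sum_mean (map F l) f| <= 4 * L * h +
    \sum_(i <- l) (2 * M / h * `|F i id| + 2 * M / h ^+ 2 *
      `|E i (fun x => x ^+ 2) - F i (fun x => x ^+ 2)| +
      4 * L / h ^+ 2 * (E i (fun x => `|x| ^+ 3) + F i (fun x => `|x| ^+ 3))).
Proof.
move=> h0 fM fL E0.
have L0 : 0 <= L.
  by have := fL 1 0; rewrite subr0 normr1 mulr1; exact: le_trans.
have [g gf gT] := lipschitz_smoothing h0 fM fL.
have dist (G : mean) : `|G f - G g| <= 2 * L * h.
  by apply: mean_dist => x; rewrite distrC.
have -> : sum_mean (map E l) f - sum_mean (map F l) f =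
  (sum_mean (map E l) f - sum_mean (map E l) g - (sum_mean (map F l) f - sum_mean (map F l) g)) +
  (sum_mean (map E l) g - sum_mean (map F l) g) by ring.
apply: le_trans (ler_normD _ _) _; apply: lerD.
  apply: le_trans (ler_normB _ _) _.
  by rewrite (_ : 4 * L * h = 2 * L * h + 2 * L * h); [exact: lerD|ring].
have := @itE_replace R I l E F (taylor_class (2 * M / h) (2 * M / h ^+ 2) (4 * L / h ^+ 2))
  (fun i => 2 * M / h * `|F i id| + 2 * M / h ^+ 2 *
      `|E i (fun x => x ^+ 2) - F i (fun x => x ^+ 2)| +
      4 * L / h ^+ 2 * (E i (fun x => `|x| ^+ 3) + F i (fun x => `|x| ^+ 3)))
  (fun s => g (\sum_(x <- s) x)); apply.
- exact: taylor_mixture.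
- move=> i k Tk; apply: taylor_mean_dist => //.
  by apply: divr_ge0; [rewrite mulr_ge0|rewrite exprn_ge0// ltW].
- move=> s t.
  rewrite (_ : (fun x => _) = (fun x => g ((\sum_(y <- s) y + \sum_(y <- t) y) + x))).
    exact: gT.
  by apply/funext => x; congr g; rewrite big_cat big_cons /=; ring.
Qed.
End Smoothing.

(** * Quantised independent variables *)

Section Quantisation.
Context {R : realType}.

(* Rounding to finitely many values makes expectations finite sums, hence means of
   arbitrary functions: no measurability has to be tracked in iterated expectations. *)
Record quantiser := Quantiser {
  quant_fun :> R -> R;
  quant_values : seq R;
  quant_uniq : uniq quant_values;
  quant_mem : forall x, quant_fun x \in quant_values;
  quant_measurable : measurable_fun setT quant_fun }.

Lemma integral_quant_partition d (T : measurableType d)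
    (mu : {measure set T -> \bar R}) (q : quantiser) (X : T -> R) (C : set T) (f : T -> R) :
  measurable_fun setT X -> measurable C -> measurable_fun C f ->
  (\int[mu]_(w in C) (f w)%:E =
   \sum_(v <- quant_values q) \int[mu]_(w in C `&` [set w | q (X w) = v]) (f w)%:E)%E.
Proof.
move=> mX mC mf.
have CE : C = \big[setU/set0]_(v <- quant_values q) (C `&` [set w | q (X w) = v]).
  apply/seteqP; split => w.
    by move=> Cw; rewrite -bigcup_seq; exists (q (X w)) => //=; exact: quant_mem.
  by rewrite -bigcup_seq => -[v _ []].
rewrite {1}CE; apply: integral_bigsetU_EFin.
- move=> v; apply: measurableI => //.
  rewrite (_ : [set w | _] = setT `&` (q \o X) @^-1` [set v]) ?setTI//.
  by rewrite -[X in measurable X]setTI; apply: measurableT_comp => //; exact: quant_measurable.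
- exact: quant_uniq.
- by apply/trivIsetP => u v _ _ uv; rewrite -subset0 => w [[_ /= uE] [_ /= vE]];
    move: uv; rewrite -uE -vE eqxx.
- by rewrite -CE; exact/measurable_EFinP.
Qed.

Lemma quant_preimage_measurable (q : quantiser) v : measurable [set x | q x = v].
Proof.
rewrite (_ : [set x | _] = setT `&` q @^-1` [set v]) ?setTI//.
by rewrite -[X in measurable X]setTI; exact: quant_measurable.
Qed.

Lemma bounded_integrable d (T : measurableType d) (P : probability T R) (C : set T)
    (f : T -> R) (M : R) :
  measurable C -> measurable_fun setT f -> (forall w, `|f w| <= M) ->
  P.-integrable C (EFin \o f).
Proof.
move=> mC mf fM; apply: measurable_bounded_integrable => //.
- by rewrite (le_lt_trans (probability_le1 _ mC))// ltry.
- exact: measurable_funTS.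
- by exists M; split=> [|x Mx w _]; [exact: num_real|apply: le_trans (fM w) (ltW Mx)].
Qed.

Definition quant_mean (mu : probability (measurableTypeR R) R) (q : quantiser) : mean (R := R).
Proof.
apply: (@Mean R (fun f => \sum_(v <- quant_values q) fine (mu [set x | q x = v]) * f v)).
- move=> a f g; rewrite mulr_sumr -big_split /=; apply: eq_bigr => v _; ring.
- move=> f g fg; apply: ler_sum => v _; apply: ler_wpM2l => //.
  by rewrite fine_ge0.
- have mid : measurable_fun [set: R] id by exact: measurable_id.
  have m1 : measurable_fun [set: R] (fun=> 1 : R) by exact: measurable_cst.
  have := integral_quant_partition mu q mid measurableT m1.
  rewrite integral_cst//.
  rewrite [X in (_ * X)%E](_ : _ = 1%E); last exact: probability_setT.
  rewrite mule1 => /(congr1 fine)/= e1; rewrite [RHS]e1.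
  rewrite [in RHS](eq_bigr (fun v => (fine (mu [set x | q x = v]))%:E)); last first.
    move=> v _; have mv := quant_preimage_measurable q v.
    by rewrite setTI integral_cst// mul1e fineK// fin_num_measure.
  by rewrite sumEFin /=; apply: eq_bigr => v _; rewrite mulr1.
Defined.

(** * Iterated expectations of rounded independent variables *)

Section Independence.
Context d (T : measurableType d) (P : probability T R).
Variables (k : nat) (X : nat -> T -> R) (mu : nat -> probability (measurableTypeR R) R).
Hypothesis mX : forall i, (i < k)%N -> measurable_fun setT (X i).
Hypothesis indepX : forall A : nat -> set R, (forall i, measurable (A i)) ->
  P [set w | forall i, (i < k)%N -> A i (X i w)] =
  (\big[*%E/1%E]_(i < k) mu i (A i))%E.

Let cyl (A : nat -> set R) j := [set w | forall i, (i < j)%N -> A i (X i w)].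

Let cyl_measurable A j : (j <= k)%N -> (forall i, measurable (A i)) ->
  measurable (cyl A j).
Proof.
move=> jk mA; rewrite (_ : cyl A j = \bigcap_(i in `I_j) (X i @^-1` A i)); last first.
  by apply/seteqP; split => w /=; exact.
apply: fin_bigcap_measurable; first exact: finite_II.
move=> i /= ij; rewrite -[X in measurable X]setTI.
by apply: mX => //; exact: leq_trans jk.
Qed.

Let fin_mu i A : measurable A -> mu i A = (fine (mu i A))%:E.
Proof. by move=> mA; rewrite fineK// fin_num_measure. Qed.

Let P_cyl A j : (j <= k)%N -> (forall i, measurable (A i)) ->
  P (cyl A j) = (\prod_(i < j) fine (mu i (A i)))%:E.
Proof.
(* The constraints from index [j] on are made vacuous, so that the product formula of length [k]
   applies to a shorter cylinder. *)
move=> jk mA; pose A' i := if (i < j)%N then A i else setT.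
have mA' i : measurable (A' i) by rewrite /A'; case: ifP.
have -> : cyl A j = [set w | forall i, (i < k)%N -> A' i (X i w)].
  apply/seteqP; split => w /= wA i; rewrite /A'.
    by case: ifP => // ij _; exact: wA.
  by move=> ij; have := wA i (leq_trans ij jk); rewrite /A' ij.
rewrite indepX// (eq_bigr (fun i : 'I_k => (fine (mu i (A' i)))%:E)); last first.
  by move=> i _; apply: fin_mu; exact: mA'.
rewrite prodEFin; congr EFin.
rewrite [RHS](big_ord_widen k (fun i => fine (mu i (A i)))) // [RHS]big_mkcond /=.
by apply: eq_bigr => i _; rewrite /A'; case: ifP => // _; rewrite (probability_setT (mu i)).
Qed.

(** An arbitrary [Phi] of rounded variables is a finite combination of indicators of measurable
    sets, hence both measurable and bounded. *)
Lemma quant_seq_measurable (q : quantiser) (l : seq nat) (Phi : seq R -> R) :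
  {in l, forall i, (i < k)%N} ->
  measurable_fun setT (fun w => Phi [seq q (X i w) | i <- l]) /\
  exists M, forall w, `|Phi [seq q (X i w) | i <- l]| <= M.
Proof.
elim: l Phi => [|i l IH] Phi lk.
  by split=> /=; [exact: measurable_cst|exists `|Phi [::]| => w].
have lk' : {in l, forall i, (i < k)%N} by move=> j jl; apply: lk; rewrite inE jl orbT.
have ik : (i < k)%N by apply: lk; rewrite inE eqxx.
have H v := IH (fun s => Phi (v :: s)) lk'.
have [M HM] := choice (fun v => (H v).2).
split; last first.
  exists (\sum_(v <- quant_values q) M v) => w /=.
  rewrite (bigD1_seq (q (X i w))) ?quant_mem ?quant_uniq //=.
  apply: ler_wpDr (HM _ w).
  by apply: sumr_ge0 => v _; exact: le_trans (normr_ge0 _) (HM v w).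
rewrite (_ : (fun w => _) = fun w => \sum_(v <- quant_values q)
   (\1_[set w | q (X i w) = v] w * Phi (v :: [seq q (X j w) | j <- l]))).
  apply: measurable_sum => v; apply: measurable_funM; last exact: (H v).1.
  apply: measurable_indic.
  rewrite -[X in measurable X]setTI.
  exact: (mX ik measurableT (quant_preimage_measurable q v)).
apply/funext => w /=; rewrite (bigD1_seq (q (X i w))) ?quant_mem ?quant_uniq //=.
rewrite indicE mem_set// mul1r big1 ?addr0// => v vq.
by rewrite indicE memNset ?mul0r//= => /esym/eqP; exact/negP.
Qed.

Lemma quant_seq_expectation (q : quantiser) (Phi : seq R -> R) :
  (\int[P]_w Phi [seq q (X i w) | i <- iota 0 k])%R =
  itE [seq quant_mean (mu i) q | i <- iota 0 k] Phi.
Proof.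
(* The first [j] variables are confined to a cylinder and only the other [r] are averaged. Splitting
   according to the rounded value of the next variable turns a cylinder of length [j] into cylinders
   of length [j.+1]. *)
suff H r j A : (j + r = k)%N -> (forall i, measurable (A i)) -> forall Psi,
    (\int[P]_(w in cyl A j) (Psi [seq q (X i w) | i <- iota j r])%:E)%E =
    ((\prod_(i < j) fine (mu i (A i))) *
     itE [seq quant_mean (mu i) q | i <- iota j r] Psi)%:E.
  have := H k 0%N (fun=> setT) (add0n k) (fun=> measurableT) Phi.
  rewrite big_ord0 mul1r (_ : cyl _ _ = setT); last by apply/seteqP; split.
  by rewrite /Rintegral => ->.
elim: r j A => [|r IH] j A jk mA Psi.
  have jk0 : (j <= k)%N by rewrite -jk addn0.
  rewrite /= integral_cst; last exact: cyl_measurable.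
  by rewrite /= P_cyl// -EFinM mulrC.
have jk' : (j < k)%N by rewrite -jk; lia.
have mC : measurable (cyl A j) by apply: cyl_measurable => //; exact: ltnW.
rewrite (integral_quant_partition P q (mX jk') mC); last first.
  apply: measurable_funTS.
  by apply: (quant_seq_measurable _ _ _).1 => i; rewrite mem_iota => /andP[_]; lia.
rewrite [RHS](_ : _ = (\sum_(v <- quant_values q) ((\prod_(i < j) fine (mu i (A i))) *
   (fine (mu j [set x | q x = v]) * itE [seq quant_mean (mu i) q | i <- iota j.+1 r]
      (fun s => Psi (v :: s))))%:E)%E); last first.
  by rewrite sumEFin -mulr_sumr.
apply: eq_bigr => v _.
pose A' i := if i == j then [set x | q x = v] else A i.
have mA' i : measurable (A' i).
  by rewrite /A'; case: ifP => // _; exact: quant_preimage_measurable.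
have -> : cyl A j `&` [set w | q (X j w) = v] = cyl A' j.+1.
  apply/seteqP; split => w /=.
    move=> [wA wv] i; rewrite ltnS leq_eqVlt /A'; case: eqP => [->//|_ /=]; exact: wA.
  move=> wA; split=> [i ij|].
    by have := wA i (ltnW ij); rewrite /A' ltn_eqF.
  by have := wA j (ltnSn j); rewrite /A' eqxx.
have jrk : (j.+1 + r = k)%N by rewrite -jk addnS.
rewrite mulrA; have := IH j.+1 A' jrk mA' (fun s => Psi (v :: s)).
have Aj : A' j = [set x | q x = v] by rewrite /A' eqxx.
rewrite big_ord_recr /= Aj (eq_bigr (fun i : 'I_j => fine (mu i (A i)))); last first.
  by move=> i _; rewrite /A' ltn_eqF.
move=> <-; apply: eq_integral => w; rewrite inE => wA.
by have /= := wA j (ltnSn j); rewrite /A' eqxx => ->.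
Qed.
End Independence.
End Quantisation.

(** * Moments of the normal law *)

Section GaussianMoments.
Context {R : realType}.
Notation mu := (@lebesgue_measure R).

Lemma Rdominated_convergence d (T : measurableType d) (m : {measure set T -> \bar R})
    (f_ : nat -> T -> R) (f g : T -> R) :
  (forall n, measurable_fun setT (f_ n)) ->
  (forall x, f_ n x @[n --> \oo] --> f x) ->
  m.-integrable setT (EFin \o g) -> (forall n x, `|f_ n x| <= g x) ->
  m.-integrable setT (EFin \o f) /\
  (\int[m]_x f_ n x)%R @[n --> \oo] --> (\int[m]_x f x)%R.
Proof.
move=> mf_ f_f ig fg.
have mf : measurable_fun setT f by apply: measurable_fun_cvg mf_ _ => x _; exact: f_f.
have [|||||if_ _ If] := @dominated_convergence _ _ _ m setT measurableT
  (fun n x => (f_ n x)%:E) (EFin \o f) (EFin \o g).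
- by move=> n; exact/measurable_EFinP.
- exact/measurable_EFinP.
- by apply: aeW => x _; apply: cvg_EFin; [exact: nearW|exact: f_f].
- exact: ig.
- by apply: aeW => x n _; rewrite /= lee_fin.
split => //; rewrite /Rintegral; apply: fine_cvg; rewrite fineK //.
exact: integrable_fin_num.
Qed.

(** The fundamental theorem on the segments [-n, n]; integrability of [f] lets dominated convergence
    pass from these to the whole line. *)
Lemma Rintegral_derivative_eq0 (F f : R -> R) : continuous f ->
  mu.-integrable setT (EFin \o f) -> (forall x : R, is_derive x 1 F (f x)) ->
  F n%:R - F (- n%:R) @[n --> \oo] --> (0 : R) -> (\int[mu]_x f x)%R = 0.
Proof.
move=> cf intf F' F0.
have mf : measurable_fun setT f by apply: continuous_measurable_fun.
have [||||_ cv] := @Rdominated_convergence _ _ mu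
  (fun n => f \_ `[- n%:R, n%:R]) f (fun x => `|f x|).
- move=> n; apply/(measurable_restrictT _ _).1 => //; exact: measurable_funTS.
- move=> x; apply: cvg_near_cst; near=> n.
  rewrite patchE mem_set//= in_itv /= -ler_norml; near: n.
  exact: nbhs_infty_ger.
- exact: (integrable_norm intf).
- move=> n x; rewrite patchE; case: ifP => // _; by rewrite normr0.
pose I n := (\int[mu]_x (f \_ `[- n%:R, n%:R]) x)%R.
apply: (@cvg_unique _ (@norm_hausdorff _ _) (I n @[n --> \oo])) => //.
(* The shift excludes the degenerate segment at [n = 0]. *)
suff : I n.+1 @[n --> \oo] --> (0 : R) by rewrite (cvg_shiftS I).
rewrite /I.
have : F n.+1%:R - F (- n.+1%:R) @[n --> \oo] --> (0 : R).
  by rewrite (cvg_shiftS (fun n => F n%:R - F (- n%:R))).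
apply: cvg_trans; apply: near_eq_cvg; near=> n.
rewrite -Rintegral_mkcond /Rintegral.
have cF := is_derive_continuous F'.
rewrite (@continuous_FTC2 _ f F) //.
- by rewrite (@lt_trans _ _ 0) ?oppr_lt0 ?ltr0n.
- exact: continuous_subspaceT.
- split.
  + by move=> x _; case: (F' x).
  + by apply: cvg_at_right_filter; exact: cF.
  + by apply: cvg_at_left_filter; exact: cF.
- by move=> x _; rewrite derive1E; case: (F' x).
Unshelve. all: by end_near. Qed.

Variable s : R.
Hypothesis s0 : 0 < s.
Let sN0 : s != 0. Proof. by rewrite gt_eqF. Qed.
Let s20 : 0 < s ^+ 2. Proof. by rewrite exprn_gt0. Qed.
Let p := normal_pdf 0 s.
Let pk := normal_peak s.

Let pE x : p x = pk * expR (- (x ^+ 2) / (s ^+ 2 *+ 2)).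
Proof. by rewrite /p normal_pdfE// /normal_fun subr0. Qed.

Let p_ge0 x : 0 <= p x. Proof. exact: normal_pdf_ge0. Qed.

Let cp : continuous p. Proof. exact: continuous_normal_pdf. Qed.

Let p' (x : R) : is_derive x 1 p (- x / s ^+ 2 * p x).
Proof.
have -> : p = fun x => pk * expR (- (x ^+ 2) / (s ^+ 2 *+ 2)) by apply/funext.
have d1 : is_derive x 1 (fun x : R => - (x ^+ 2) / (s ^+ 2 *+ 2)) (- x / s ^+ 2).
  apply: is_derive_eq; rewrite /GRing.scale /=.
  by field; rewrite sN0.
have d2 := @is_derive1_comp _ expR (fun x : R => - (x ^+ 2) / (s ^+ 2 *+ 2)) x _ _
  (is_derive_expR _) d1.
have d3 : is_derive x 1 (fun x0 => pk * (expR \o (fun x : R => - (x ^+ 2) / (s ^+ 2 *+ 2))) x0)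
   (- x / s ^+ 2 * (pk * expR (- x ^+ 2 / (s ^+ 2 *+ 2)))).
  by apply: is_derive_eq; rewrite /GRing.scale /=; ring.
exact: d3.
Qed.

(** Half of the exponent absorbs the polynomial, and the other half is the exponent of a normal
    density of doubled variance. *)
Let x4pE x : x ^+ 4 * p x <=
  64 * s ^+ 4 * pk / normal_peak (Num.sqrt 2 * s) * normal_pdf 0 (Num.sqrt 2 * s) x.
Proof.
have t0 : Num.sqrt 2 * s != 0 by rewrite mulf_neq0// gt_eqF// sqrtr_gt0.
rewrite pE normal_pdfE// /normal_fun subr0 [X in _ <= X]mulrA divfK; last first.
  by rewrite gt_eqF// normal_peak_gt0.
rewrite exprMn sqr_sqrtr//; set u := x ^+ 2 / (4 * s ^+ 2).
have -> : - x ^+ 2 / (s ^+ 2 *+ 2) = - u - u by rewrite /u; field; rewrite sN0.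
have -> : - x ^+ 2 / ((2 * s ^+ 2) *+ 2) = - u by rewrite /u; field; rewrite sN0.
rewrite expRD [X in X <= _](_ : _ = x ^+ 4 * expR (- u) * (pk * expR (- u))); last by ring.
rewrite -[X in _ <= X]mulrA ler_wpM2r//.
  by rewrite mulr_ge0 ?expR_ge0 ?normal_peak_ge0.
have xu : x ^+ 4 = 16 * s ^+ 4 * u ^+ 2 by rewrite /u; field; rewrite sN0.
have u0 : 0 <= u by rewrite /u divr_ge0 ?sqr_ge0// mulr_ge0// ltW.
(* Square the inequality [1 + u / 2 <= expR (u / 2)]. With [x ^+ 4 = 16 * s ^+ 4 * u ^+ 2] this
   produces the constant 64. *)
have hu : u ^+ 2 <= 4 * expR u.
  have -> : expR u = expR (u / 2) ^+ 2 by rewrite -expRM_natl; congr expR; field.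
  have /= := expR_ge1Dx (u / 2) => h.
  have : 0 <= u / 2 by rewrite divr_ge0.
  by nra.
have := ler_pM (sqr_ge0 u) (expR_ge0 (- u)) hu (lexx _).
rewrite -(mulrA 4) -expRD subrr expR0 mulr1 => hu'.
rewrite xu -mulrA (_ : 64 * s ^+ 4 = 16 * s ^+ 4 * 4); last by ring.
by rewrite ler_wpM2l// mulr_ge0// exprn_ge0// ltW.
Qed.

Let x4p_ub : exists2 C, 0 <= C & forall x, x ^+ 4 * p x <= C.
Proof.
have t0 : Num.sqrt 2 * s != 0 by rewrite mulf_neq0// gt_eqF// sqrtr_gt0.
have K0 : 0 <= 64 * s ^+ 4 * pk / normal_peak (Num.sqrt 2 * s).
  rewrite divr_ge0 ?normal_peak_ge0// mulr_ge0 ?normal_peak_ge0//.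
  by rewrite mulr_ge0// exprn_ge0// ltW.
eexists; last first.
  move=> x; apply: le_trans (x4pE x) _; apply: ler_wpM2l => //.
  exact: normal_pdf_ub.
by rewrite mulr_ge0// normal_peak_ge0.
Qed.

Let int_x4p : mu.-integrable setT (EFin \o (fun x => x ^+ 4 * p x)).
Proof.
have i2 := integrableZl measurableT (64 * s ^+ 4 * pk / normal_peak (Num.sqrt 2 * s))
  (integrable_normal_pdf 0 (Num.sqrt 2 * s)).
apply: le_integrable i2 => //.
  apply/measurable_EFinP; apply: measurable_funM; last exact: measurable_normal_pdf.
  exact: exprn_measurable.
move=> x _ /=; rewrite lee_fin ger0_norm; last first.
  by rewrite mulr_ge0// exprn_even_ge0.
apply: le_trans (x4pE x) _; exact: ler_norm.
Qed.

Let int_bound (a b : R) : mu.-integrable setT (EFin \o (fun x => (a * x ^+ 4 + b) * p x)).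
Proof.
have i1 := integrableZl measurableT a int_x4p.
have i2 := integrableZl measurableT b (integrable_normal_pdf 0 s).
have := integrableD measurableT i1 i2; apply: eq_integrable => // x _.
by rewrite /= -!EFinM -EFinD; congr EFin; rewrite /p; ring.
Qed.

Lemma integrable_poly4_normal (f : R -> R) (a b : R) : measurable_fun setT f ->
  (forall x, `|f x| <= a * x ^+ 4 + b) ->
  mu.-integrable setT (EFin \o (fun x => f x * normal_pdf 0 s x)).
Proof.
move=> mf fab; apply: le_integrable (int_bound a b) => //.
  apply/measurable_EFinP; apply: measurable_funM => //; exact: measurable_normal_pdf.
move=> x _ /=; rewrite lee_fin !normrM ler_wpM2r// (le_trans (fab x))//.
exact: ler_norm.
Qed.

Lemma integrable_id_normal :
  mu.-integrable setT (EFin \o (fun x => x * normal_pdf 0 s x)).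
Proof.
apply: (@integrable_poly4_normal id 1 1) => [|x]; first exact: measurable_id.
rewrite mul1r; have := sqr_ge0 (x ^+ 2 - 1); have := sqr_ge0 (`|x| - 1).
have := real_normK (num_real x); set y := `|x| => yE.
have -> : x ^+ 4 = (y ^+ 2) ^+ 2 by rewrite yE -exprM.
by rewrite -yE; nra.
Qed.

Lemma integrable_sqr_normal :
  mu.-integrable setT (EFin \o (fun x => x ^+ 2 * normal_pdf 0 s x)).
Proof.
apply: (@integrable_poly4_normal _ 1 1) => [|x]; first exact: exprn_measurable.
rewrite ger0_norm ?sqr_ge0// mul1r -[4%N]/(2 * 2)%N exprM.
by have := sqr_ge0 (x ^+ 2 - 1); nra.
Qed.

Let decay k : (k <= 3)%N -> n%:R ^+ k * p n%:R @[n --> \oo] --> (0 : R).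
Proof.
move=> k3; have [C C0 HC] := x4p_ub.
apply/cvgrPdist_le => /= e e0; near=> n.
have n0 : (0 < n)%N by near: n; exact: nbhs_infty_gt.
rewrite sub0r normrN ger0_norm; last by rewrite mulr_ge0// exprn_ge0.
apply: (@le_trans _ _ (C / n%:R)).
  rewrite ler_pdivlMr ?ltr0n//; apply: le_trans (HC n%:R).
  rewrite mulrAC -exprSr ler_wpM2r// ler_weXn2l// ler1n//.
rewrite ler_pdivrMr ?ltr0n// mulrC -ler_pdivrMr//; near: n.
exact: nbhs_infty_ger.
Unshelve. all: by end_near. Qed.

Let pN x : p (- x) = p x. Proof. by rewrite !pE sqrrN. Qed.

Lemma normal_moment1 : (\int[mu]_x (x * normal_pdf 0 s x))%R = 0.
Proof.
apply: (@Rintegral_derivative_eq0 (fun x => - s ^+ 2 * p x)).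
- by move=> x; apply: cvgM; [exact: cvg_id|exact: cp].
- exact: integrable_id_normal.
- move=> x; have d := p' x; apply: is_derive_eq.
  by rewrite /GRing.scale /= /p; field.
- by rewrite (_ : (fun n => _) = fun=> 0); [exact: cvg_cst|apply/funext => n; rewrite pN subrr].
Qed.

(** Integration by parts: [- s ^+ 2 * (x * p x)] vanishes at infinity and has derivative
    [x ^+ 2 * p x - s ^+ 2 * p x]. The fourth moment comes in the same way from [x ^+ 3 * p x]. *)
Lemma normal_moment2 : (\int[mu]_x (x ^+ 2 * normal_pdf 0 s x))%R = s ^+ 2.
Proof.
have i2 := integrable_sqr_normal.
have i0 := integrable_normal_pdf 0 s.
have i0' : mu.-integrable setT (EFin \o (fun x => s ^+ 2 * normal_pdf 0 s x)).
  by have := integrableZl measurableT (s ^+ 2) i0; apply: eq_integrable => // x _.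
have /eqP : (\int[mu]_x (x ^+ 2 * normal_pdf 0 s x - s ^+ 2 * normal_pdf 0 s x))%R = 0.
  apply: (@Rintegral_derivative_eq0 (fun x => - s ^+ 2 * (x * p x))).
  - move=> x; apply: cvgB; last by apply: cvgM; [exact: cvg_cst|exact: cp].
    by apply: cvgM; [exact: exprn_continuous|exact: cp].
  - by have := integrableB measurableT i2 i0'; apply: eq_integrable.
  - move=> x; have d := p' x; apply: is_derive_eq.
    by rewrite /GRing.scale /= /p; field.
  - rewrite (_ : (fun n => _) = fun n => - s ^+ 2 * 2 * (n%:R ^+ 1 * p n%:R)).
      by rewrite -(mulr0 (- s ^+ 2 * 2)); apply: cvgM; [exact: cvg_cst|exact: decay].
    by apply/funext => n; rewrite pN; ring.
rewrite RintegralB// RintegralZl// subr_eq0 => /eqP ->.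
by rewrite /Rintegral integral_normal_pdf mulr1.
Qed.

Lemma normal_moment4 : (\int[mu]_x (x ^+ 4 * normal_pdf 0 s x))%R = 3 * s ^+ 4.
Proof.
have i2 := integrable_sqr_normal.
have i2' : mu.-integrable setT (EFin \o (fun x => 3 * s ^+ 2 * (x ^+ 2 * normal_pdf 0 s x))).
  by have := integrableZl measurableT (3 * s ^+ 2) i2; apply: eq_integrable => // x _.
have /eqP : (\int[mu]_x (x ^+ 4 * normal_pdf 0 s x - 3 * s ^+ 2 * (x ^+ 2 * normal_pdf 0 s x)))%R = 0.
  apply: (@Rintegral_derivative_eq0 (fun x => - s ^+ 2 * (x ^+ 3 * p x))).
  - move=> x; apply: cvgB; first by apply: cvgM; [exact: exprn_continuous|exact: cp].
    apply: cvgM; first exact: cvg_cst.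
    by apply: cvgM; [exact: exprn_continuous|exact: cp].
  - by have := integrableB measurableT int_x4p i2'; apply: eq_integrable.
  - move=> x; have d := p' x; apply: is_derive_eq.
    by rewrite /GRing.scale /= /p; field.
  - rewrite (_ : (fun n => _) = fun n => - s ^+ 2 * 2 * (n%:R ^+ 3 * p n%:R)).
      by rewrite -(mulr0 (- s ^+ 2 * 2)); apply: cvgM; [exact: cvg_cst|exact: decay].
    by apply/funext => n; rewrite pN; ring.
rewrite RintegralB// RintegralZl// normal_moment2 subr_eq0 => /eqP ->.
by ring.
Qed.
End GaussianMoments.

(** * Rounded normal laws and their convergence *)

Section QuantisedNormal.
Context {R : realType}.
Notation mu := (@lebesgue_measure R).

Lemma quant_normal_mean (s : R) (q : quantiser (R := R)) (f : R -> R) :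
  quant_mean (normal_prob 0 s) q f = (\int[mu]_x (f (q x) * normal_pdf 0 s x))%R.
Proof.
have mid : measurable_fun [set: R] id by exact: measurable_id.
have mfq : measurable_fun setT (fun x => f (q x)).
  rewrite (_ : (fun x => _) = fun x => \sum_(v <- quant_values q)
     (\1_[set x | q x = v] x * f v)).
    apply: measurable_sum => v; apply: measurable_funM => //.
    by apply: measurable_indic; exact: quant_preimage_measurable.
  apply/funext => w /=; rewrite (bigD1_seq (q w)) ?quant_mem ?quant_uniq //=.
  rewrite indicE mem_set// mul1r big1 ?addr0// => v vq.
  by rewrite indicE memNset ?mul0r//= => /esym/eqP; exact/negP.
have mf : measurable_fun setT (fun x => f (q x) * normal_pdf 0 s x).
  by apply: measurable_funM => //; exact: measurable_normal_pdf.
rewrite /Rintegral (integral_quant_partition mu q mid measurableT mf).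
rewrite (eq_bigr (fun v => (fine (normal_prob 0 s [set x | q x = v]) * f v)%:E)).
  by rewrite sumEFin.
move=> v _; have mv := quant_preimage_measurable q v.
rewrite setTI mulrC EFinM fineK; last by rewrite fin_num_measure.
rewrite /normal_prob -integralZl//; last first.
  by apply: integrableS (integrable_normal_pdf 0 s).
by apply: eq_integral => x; rewrite inE /= => ->.
Qed.

(** The cut-off at [j] keeps the range finite and the mesh [j.+1%:R^-1] gives pointwise convergence;
    the default value 0 respects the uniform bound [|x| + 1]. *)
Definition quant_real (j : nat) (x : R) : R :=
  if `|x| <= j%:R then (Num.floor (x * j.+1%:R))%:~R / j.+1%:R else 0.

Lemma quant_real_bound j x : `|quant_real j x| <= `|x| + 1.
Proof.
rewrite /quant_real; case: ifP => [_|_]; last by rewrite normr0 addr_ge0.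
rewrite normrM [X in _ * X]ger0_norm// ler_pdivrMr ?ltr0n//.
have /andP[h1] := floor_itv (x * j.+1%:R); rewrite intrD => h2.
have j1 : 1 <= j.+1%:R :> R by rewrite ler1n.
have xj : `|x * j.+1%:R| = `|x| * j.+1%:R by rewrite normrM (ger0_norm (ler0n _ _)).
have := ler_norm (x * j.+1%:R); have := ler_norm (- (x * j.+1%:R)); rewrite normrN xj.
by move=> ? ?; rewrite ler_norml; apply/andP; split; nra.
Qed.

Lemma quant_real_cvg x : quant_real j x @[j --> \oo] --> x.
Proof.
apply/cvgrPdist_le => /= e e0; near=> j.
have xj : `|x| <= j%:R by near: j; exact: nbhs_infty_ger.
rewrite /quant_real xj.
have /andP[h1] := floor_itv (x * j.+1%:R); rewrite intrD => h2.
have j0 : 0 < j.+1%:R :> R by rewrite ltr0n.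
have -> : x - (Num.floor (x * j.+1%:R))%:~R / j.+1%:R =
  (x * j.+1%:R - (Num.floor (x * j.+1%:R))%:~R) / j.+1%:R.
  by rewrite mulrBl mulfK// gt_eqF.
rewrite ger0_norm; last by rewrite divr_ge0 ?subr_ge0.
rewrite ler_pdivrMr//; apply: (@le_trans _ _ 1); first lra.
rewrite -ler_pdivrMl// mulr1; apply: (@le_trans _ _ j%:R); last by rewrite ler_nat.
by near: j; exact: nbhs_infty_ger.
Unshelve. all: by end_near. Qed.

Definition quantc (c : R) (j : nat) : quantiser (R := R).
Proof.
(* The values are the multiples of [j.+1%:R^-1] from [-j] to [j], numbered from 0 after a shift by
   [j * j.+1]. *)
apply: (@Quantiser _ (fun x => quant_real j (c * x))
  [seq (i%:R - (j * j.+1)%:R) / j.+1%:R | i <- iota 0 (2 * (j * j.+1)).+1]).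
- rewrite map_inj_uniq ?iota_uniq// => a b.
  move=> /(mulIf (invr_neq0 (lt0r_neq0 (ltr0Sn _ j)))) /addIr/eqP.
  by rewrite eqr_nat => /eqP.
- move=> x; apply/mapP; rewrite /quant_real.
  case: ifP => [xj|_]; last first.
    exists (j * j.+1)%N; first by rewrite mem_iota add0n; lia.
    by rewrite subrr mul0r.
  set y := c * x in xj *; set z := Num.floor _.
  have zl : (- (j * j.+1)%:Z <= z)%R.
    rewrite floor_ge_int intrN -[X in X%:~R]/((j * j.+1)%:Z) -pmulrn natrM -mulNr.
    by rewrite ler_wpM2r//; move: xj; rewrite ler_norml => /andP[].
  have zu : (z <= (j * j.+1)%:Z)%R.
    rewrite -(ler_int R) (le_trans (floor_le _))// -pmulrn natrM.
    by rewrite ler_wpM2r//; move: xj; rewrite ler_norml => /andP[].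
  exists (absz (z + (j * j.+1)%:Z)%R).
    by rewrite mem_iota add0n; lia.
  congr (_ / _); rewrite pmulrn gez0_abs; last by lia.
  by rewrite intrD -pmulrn addrK.
- apply: (@measurableT_comp _ _ _ _ _ _ (quant_real j)); last first.
    exact: measurable_funM.
  apply: measurable_fun_ifT => //.
    by apply: measurable_fun_ler => //; exact: measurableT_comp.
  apply: measurable_funM => //.
  apply: nondecreasing_measurable => // a b ab.
  by rewrite ler_int le_floor// ler_wpM2r.
Defined.

Lemma quantcE c j x : quantc c j x = quant_real j (c * x). Proof. by []. Qed.

Lemma quantc_cvg c x : quantc c j x @[j --> \oo] --> c * x.
Proof. exact: quant_real_cvg. Qed.

Lemma quant_normal_cvg (s c : R) (f : R -> R) : 0 < s -> continuous f ->
  (forall x, `|f x| <= (`|x| + 1) ^+ 3) ->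
  quant_mean (normal_prob 0 s) (quantc c j) f @[j --> \oo] -->
    (\int[mu]_x (f (c * x) * normal_pdf 0 s x))%R.
Proof.
move=> s0 cf f3.
under eq_fun do rewrite quant_normal_mean.
have mf : measurable_fun setT f by exact: continuous_measurable_fun.
(* The growth bound on [f] and the bound on rounding give [(z + 2) ^+ 3] with [z = |c * x|], and
   this is at most [8 * z ^+ 4 + 128]. *)
have [||||//] := @Rdominated_convergence _ _ _ mu
  (fun j x => f (quantc c j x) * normal_pdf 0 s x)
  (fun x => f (c * x) * normal_pdf 0 s x)
  (fun x => (8 * c ^+ 4 * x ^+ 4 + 128) * normal_pdf 0 s x).
- move=> j; apply: measurable_funM; last exact: measurable_normal_pdf.
  by apply: measurableT_comp => //; exact: quant_measurable.
- move=> x; apply: cvgM; last exact: cvg_cst.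
  by apply: continuous_cvg; [exact: cf|exact: quantc_cvg].
- apply: (@integrable_poly4_normal _ _ s0 _ (8 * c ^+ 4) 128) => [|x].
    by apply: measurable_funD => //; apply: measurable_funM.
  have c4 : 0 <= c ^+ 4 by rewrite exprn_even_ge0.
  have x4 : 0 <= x ^+ 4 by rewrite exprn_even_ge0.
  by rewrite ger0_norm// addr_ge0// mulr_ge0// mulr_ge0.
- move=> j x; rewrite normrM [X in _ * X]ger0_norm ?normal_pdf_ge0//.
  rewrite ler_wpM2r ?normal_pdf_ge0//; apply: le_trans (f3 _) _.
  have -> : 8 * c ^+ 4 * x ^+ 4 = 8 * `|c * x| ^+ 4.
    by rewrite -mulrA -exprMn -[4%N]/(2 * 2)%N !exprM real_normK ?num_real.
  have := quant_real_bound j (c * x); have := normr_ge0 (c * x).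
  have := normr_ge0 (quant_real j (c * x)); rewrite quantcE.
  move: `|c * x| `|quant_real j (c * x)| => z y y0 z0 yz.
  have yz' : y + 1 <= z + 2 by lra.
  apply: (@le_trans _ _ ((z + 2) ^+ 3)).
    by apply: lerXn2r => //; rewrite nnegrE; lra.
  have h1 := sqr_ge0 (z ^+ 2 - z); have h2 := sqr_ge0 (z - 1).
  have h3 := sqr_ge0 (z ^+ 2 - 2).
  have e1 : (z ^+ 2 - z) ^+ 2 = z ^+ 4 - 2 * z ^+ 3 + z ^+ 2 by ring.
  have e2 : (z - 1) ^+ 2 = z ^+ 2 - 2 * z + 1 by ring.
  have e3 : (z ^+ 2 - 2) ^+ 2 = z ^+ 4 - 4 * z ^+ 2 + 4 by ring.
  have -> : (z + 2) ^+ 3 = z ^+ 3 + 6 * z ^+ 2 + 12 * z + 8 by ring.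
  rewrite e1 in h1; rewrite e2 in h2; rewrite e3 in h3; lra.
Qed.
End QuantisedNormal.

(** * Third absolute moment of the normal law *)

Section NormalThirdMoment.
Context {R : realType}.
Notation mu := (@lebesgue_measure R).

(** The inequality [|x|^3 <= (s x^2 + x^4 / s) / 2] reduces the odd absolute moment to even ones:
    [s^3 / 2 + 3 s^3 / 2 = 2 s^3]. *)
Lemma normal_abs_moment3 (s c : R) : 0 < s ->
  (\int[mu]_x (`|c * x| ^+ 3 * normal_pdf 0 s x))%R <= 2 * `|c| ^+ 3 * s ^+ 3.
Proof.
move=> s0; have sN0 : s != 0 by rewrite gt_eqF.
have i2 := integrable_sqr_normal s0.
have i4 : mu.-integrable setT (EFin \o (fun x => x ^+ 4 * normal_pdf 0 s x)).
  apply: (@integrable_poly4_normal _ _ s0 _ 1 0) => [|x]; first exact: exprn_measurable.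
  by rewrite ger0_norm ?exprn_even_ge0// mul1r addr0.
have i2' : mu.-integrable setT (EFin \o (fun x => (`|c| ^+ 3 * s / 2) * (x ^+ 2 * normal_pdf 0 s x))).
  by have := integrableZl measurableT (`|c| ^+ 3 * s / 2) i2; apply: eq_integrable.
have i4' : mu.-integrable setT (EFin \o (fun x => (`|c| ^+ 3 / s / 2) * (x ^+ 4 * normal_pdf 0 s x))).
  by have := integrableZl measurableT (`|c| ^+ 3 / s / 2) i4; apply: eq_integrable.
have amgm x : `|c * x| ^+ 3 <= `|c| ^+ 3 * s / 2 * x ^+ 2 + `|c| ^+ 3 / s / 2 * x ^+ 4.
  rewrite normrM exprMn.
  have -> : `|c| ^+ 3 * s / 2 * x ^+ 2 + `|c| ^+ 3 / s / 2 * x ^+ 4 =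
    `|c| ^+ 3 * (s / 2 * x ^+ 2 + x ^+ 4 / s / 2) by ring.
  rewrite ler_wpM2l ?exprn_ge0//.
  have := real_normK (num_real x); set y := `|x| => yE.
  have -> : x ^+ 4 = (y ^+ 2) ^+ 2 by rewrite yE -exprM.
  rewrite -yE -subr_ge0.
  have -> : s / 2 * y ^+ 2 + (y ^+ 2) ^+ 2 / s / 2 - y ^+ 3 =
    y ^+ 2 * (y - s) ^+ 2 / (2 * s) by field.
  by rewrite divr_ge0// mulr_ge0 ?sqr_ge0// ltW.
have amgmp x : `|c * x| ^+ 3 * normal_pdf 0 s x <=
    (`|c| ^+ 3 * s / 2) * (x ^+ 2 * normal_pdf 0 s x) +
    (`|c| ^+ 3 / s / 2) * (x ^+ 4 * normal_pdf 0 s x).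
  have -> : (`|c| ^+ 3 * s / 2) * (x ^+ 2 * normal_pdf 0 s x) +
    (`|c| ^+ 3 / s / 2) * (x ^+ 4 * normal_pdf 0 s x) =
    (`|c| ^+ 3 * s / 2 * x ^+ 2 + `|c| ^+ 3 / s / 2 * x ^+ 4) * normal_pdf 0 s x by ring.
  by rewrite ler_wpM2r ?normal_pdf_ge0.
have i3 : mu.-integrable setT (EFin \o (fun x => `|c * x| ^+ 3 * normal_pdf 0 s x)).
  have := integrableD measurableT i2' i4'; apply: le_integrable => //.
    apply/measurable_EFinP; apply: measurable_funM; last exact: measurable_normal_pdf.
    by apply: measurable_funX; apply: measurableT_comp.
  move=> x _ /=; rewrite lee_fin normrM ger0_norm ?exprn_ge0//.
  rewrite (ger0_norm (normal_pdf_ge0 _ _ _)); apply: le_trans (ler_norm _).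
  exact: amgmp.
apply: (@le_trans _ _ (\int[mu]_x ((`|c| ^+ 3 * s / 2) * (x ^+ 2 * normal_pdf 0 s x) +
   (`|c| ^+ 3 / s / 2) * (x ^+ 4 * normal_pdf 0 s x)))%R).
  apply: le_Rintegral => //.
    by have := integrableD measurableT i2' i4'; apply: eq_integrable.
rewrite RintegralD// RintegralZl// RintegralZl// normal_moment2// normal_moment4//.
by rewrite le_eqVlt; apply/orP; left; apply/eqP; field.
Qed.
End NormalThirdMoment.

Lemma map_cst (A B C : Type) (f : A -> C) (c : C) (l : seq A) (l' : seq B) :
  (forall i, f i = c) -> size l = size l' -> map f l = [seq c | _ <- l'].
Proof.
by move=> fc; elim: l l' => [|x l IH] [|y l']//= [/IH ->]; rewrite fc.
Qed.

Lemma cvg_sumr (R : realType) (I : Type) (l : seq I) (f : I -> nat -> R) (a : I -> R) :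
  (forall i, True -> f i n @[n --> \oo] --> a i) ->
  \sum_(i <- l) f i n @[n --> \oo] --> \sum_(i <- l) a i.
Proof.
move=> fa; elim: l => [|i l IH].
  by under eq_fun do rewrite big_nil; rewrite big_nil; exact: cvg_cst.
by under eq_fun do rewrite big_cons; rewrite big_cons; apply: cvgD => //; exact: fa.
Qed.

(** * Comparison with Brownian increments *)

Section BrownianIncrements.
Context {R : realType} d (T : measurableType d) (P : probability T R) (B : R -> T -> R).
Hypothesis hB : standard_brownian_motion P B.
Notation mu := (@lebesgue_measure R).

Definition increment (u : nat -> R) (i : nat) (w : T) := B (u i.+1) w - B (u i) w.

(** The last point may lie before 1: besides the grid [i / m] of the whole interval, subdivisions of
    the single cell [0, 1/m] are used. *)
Definition grid (k : nat) (u : nat -> R) :=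
  [/\ u 0%N = 0, forall i, (i < k)%N -> u i < u i.+1 & u k <= 1].

Lemma grid01 k u i : grid k u -> (i <= k)%N -> u i \in `[0, 1].
Proof.
move=> [u0 ui uk] ik.
have mono a b : (a <= b)%N -> (b <= k)%N -> u a <= u b.
  elim: b => [|b IH]; first by rewrite leqn0 => /eqP ->.
  rewrite leq_eqVlt => /predU1P[->//|ab bk].
  by apply: le_trans (IH ab (ltnW bk)) (ltW (ui _ bk)).
by rewrite inE /= in_itv /= -{1}u0 mono//= (le_trans _ uk)// mono.
Qed.

Lemma increment_measurable k u i : grid k u -> (i < k)%N ->
  measurable_fun setT (increment u i).
Proof.
move=> gu ik; case: hB => _ _ mB _.
by apply: measurable_funB; apply: mB; apply: (grid01 gu) => //; exact: ltnW.
Qed.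

Lemma increment_indep k u (A : nat -> set R) : grid k u ->
  (forall i, measurable (A i)) ->
  P [set w | forall i, (i < k)%N -> A i (increment u i w)] =
  (\big[*%E/1%E]_(i < k) normal_prob 0 (Num.sqrt (u i.+1 - u i)) (A i))%E.
Proof.
move=> [u0 ui uk] mA; case: hB => _ _ _ /(_ k (fun i => u i) (fun i => A i)) H.
have := H u0 (fun i => ui i (ltn_ord i)) uk (fun i => mA i).
move=> {}H; rewrite -[RHS]H; congr (P _); apply/seteqP; split => w /= wA i.
  exact: wA.
by move=> ik; exact: (wA (Ordinal ik)).
Qed.

Lemma quant_increment_expectation k u (q : quantiser (R := R)) (Phi : seq R -> R) : grid k u ->
  (\int[P]_w Phi [seq q (increment u i w) | i <- iota 0 k])%R =
  itE [seq quant_mean (normal_prob 0 (Num.sqrt (u i.+1 - u i))) q | i <- iota 0 k] Phi.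
Proof.
move=> gu; apply: (quant_seq_expectation (k := k) (X := increment u)
  (mu := fun i => normal_prob 0 (Num.sqrt (u i.+1 - u i)))).
- by move=> i; exact: increment_measurable.
- by move=> A; exact: increment_indep.
Qed.

Variables (c L M h v t : R) (m : nat) (E : mean (R := R)).
Hypothesis h0 : 0 < h.
Hypothesis L0 : 0 <= L.
Hypothesis M0 : 0 <= M.
Hypothesis m0 : (0 < m)%N.
Hypothesis E1 : E id = 0.
Hypothesis E2 : E (fun x => x ^+ 2) = v.
Hypothesis E3 : E (fun x => `|x| ^+ 3) = t.

Let lip (f : R -> R) :=
  (forall x, `|f x| <= M) /\ (forall x y, `|f x - f y| <= L * `|x - y|).

Let fine_grid K i : R := i%:R / (m * K)%:R.

Let fine_gridP K : (0 < K)%N -> grid K (fine_grid K).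
Proof.
move=> K0; have mK : 0 < (m * K)%:R :> R by rewrite ltr0n muln_gt0 m0.
split; first by rewrite /fine_grid mul0r.
  by move=> i _; rewrite /fine_grid ltr_pM2r ?invr_gt0// ltr_nat.
by rewrite /fine_grid ler_pdivrMr// mul1r ler_nat leq_pmull.
Qed.

Let fine_gridB K i : fine_grid K i.+1 - fine_grid K i = (m * K)%:R^-1.
Proof. by rewrite /fine_grid -mulrBl -natrB// subSnn mul1r. Qed.

Let sigma K : R := Num.sqrt ((m * K)%:R^-1).

(** The cost of exchanging a block of [K] steps once the rounding mesh has vanished: smoothing,
    mismatch of the block variances [K%:R * v] and [c ^+ 2 / m%:R], third absolute moments. *)
Let block_err K :=
  4 * L * h + (2 * M / h ^+ 2 * `|K%:R * v - c ^+ 2 / m%:R| +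
    4 * L / h ^+ 2 * (K%:R * t + 2 * `|c| ^+ 3 * K%:R * sigma K ^+ 3)).

(** The cost of exchanging one step for a rounded Brownian increment over a cell of length
    [1 / (m K)]. *)
Let step_err K j := let Q := quant_mean (normal_prob 0 (sigma K)) (quantc c j) in
  2 * M / h * `|Q id| + 2 * M / h ^+ 2 * `|v - Q (fun x => x ^+ 2)| +
      4 * L / h ^+ 2 * (t + Q (fun x => `|x| ^+ 3)).

(** Rounding does not commute with summation; this bounds the resulting change of a function in
    [lip]. The cap [2 * M] serves as the dominating constant when [j] grows. *)
Let rho K j w := Num.min (2 * M) (L * `|\sum_(i <- iota 0 K) quantc c j (increment (fine_grid K) i w)
  - quantc c j (increment (fine_grid 1) 0 w)|).

Let fine_means K q :
  [seq quant_mean (normal_prob 0 (Num.sqrt (fine_grid K i.+1 - fine_grid K i))) q | i <- iota 0 K]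
  = nseq K (quant_mean (normal_prob 0 (sigma K)) q).
Proof.
by rewrite -[K in nseq K](size_iota 0 K); elim: (iota 0 K) => //= i l ->; rewrite fine_gridB.
Qed.

Let rho_measurable K j : (0 < K)%N -> measurable_fun setT (rho K j).
Proof.
move=> K0; apply: measurable_minr; first exact: measurable_cst.
apply: measurable_funM => //; apply: measurableT_comp => //; apply: measurable_funB.
  have mK i : (i < K)%N -> measurable_fun setT (increment (fine_grid K) i).
    by move=> iK; exact: increment_measurable (fine_gridP K0) iK.
  have iota_lt : {in iota 0 K, forall i, (i < K)%N} by move=> i; rewrite mem_iota.
  have := (quant_seq_measurable mK (quantc c j) (fun s => \sum_(x <- s) x) iota_lt).1.
  by under eq_fun do rewrite big_map.
apply: measurableT_comp; first exact: quant_measurable.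
exact: increment_measurable (fine_gridP (ltn0Sn 0)) (ltn0Sn 0).
Qed.

Let rho_bound K j w : `|rho K j w| <= 2 * M.
Proof.
have r0 : 0 <= rho K j w by rewrite le_min !mulr_ge0.
by rewrite ger0_norm// ge_min lexx.
Qed.

(** The sum of [K] rounded fine increments is the bridge. Lindeberg's estimate leads to it from the
    steps of law [E]; from there on, both laws are realised on the same Brownian path, and [rho]
    bounds the difference pathwise. *)
Lemma block_dist K j f : (0 < K)%N -> lip f ->
  `|sum_mean (nseq K E) f - quant_mean (normal_prob 0 (sigma 1)) (quantc c j) f| <=
  4 * L * h + K%:R * step_err K j + (\int[P]_w rho K j w)%R.
Proof.
move=> K0 [fM fL]; pose q := quantc c j; pose Q := quant_mean (normal_prob 0 (sigma K)) q.
change (`|sum_mean (nseq K E) f - quant_mean (normal_prob 0 (sigma 1)) q f| <=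
  4 * L * h + K%:R * step_err K j + (\int[P]_w rho K j w)%R).
rewrite -(subrK (sum_mean (nseq K Q) f) (sum_mean (nseq K E) f)) -addrA.
apply: le_trans (ler_normD _ _) _; apply: lerD.
  have := lindeberg_dist (nseq K tt) (E := fun=> E) (fun=> Q) h0 fM fL (fun=> E1).
  rewrite !map_nseq big_nseq iter_addr_0 => /le_trans; apply.
  by rewrite lerD2l [X in _ <= X]mulr_natl E2 E3.
have -> : sum_mean (nseq K Q) f =
    (\int[P]_w f (\sum_(i <- iota 0 K) q (increment (fine_grid K) i w)))%R.
  rewrite -fine_means /= -quant_increment_expectation//; last exact: fine_gridP.
  by under eq_Rintegral do rewrite big_map.
have -> : quant_mean (normal_prob 0 (sigma 1)) q f =
    (\int[P]_w f (q (increment (fine_grid 1) 0 w)))%R.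
  have := quant_increment_expectation q (fun s => f (head 0 s)) (fine_gridP (ltn0Sn 0)).
  by rewrite fine_means /= => ->.
have iota_lt k : {in iota 0 k, forall i, (i < k)%N}.
  by move=> i; rewrite mem_iota.
have mK i : (i < K)%N -> measurable_fun setT (increment (fine_grid K) i).
  by move=> iK; exact: increment_measurable (fine_gridP K0) iK.
have m1 i : (i < 1)%N -> measurable_fun setT (increment (fine_grid 1) i).
  by move=> i1; exact: increment_measurable (fine_gridP (ltn0Sn 0)) i1.
have [ma [Ma Ha]] := quant_seq_measurable mK q (fun s => f (\sum_(x <- s) x)) (iota_lt K).
have [mb [Mb Hb]] := quant_seq_measurable m1 q (fun s => f (head 0 s)) (iota_lt 1%N).
have ia := bounded_integrable P measurableT ma Ha.
have ib := bounded_integrable P measurableT mb Hb.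
have ir := bounded_integrable P measurableT (rho_measurable j K0) (rho_bound K j).
under eq_Rintegral do rewrite -(big_map (fun i => q (increment (fine_grid K) i _)) predT id).
rewrite -RintegralB//; apply: le_trans (le_normr_Rintegral _ _) _ => //.
  exact: (integrableB measurableT ia ib).
apply: le_Rintegral => //.
  exact: (integrable_norm (integrableB measurableT ia ib)).
move=> w _; rewrite /= le_min; apply/andP; split.
  by apply: le_trans (ler_normB _ _) _; rewrite mulr2n mulrDl mul1r lerD.
by apply: le_trans (fL _ _) _; rewrite big_map.
Qed.

Let sigma_gt0 K : (0 < K)%N -> 0 < sigma K.
Proof. by move=> K0; rewrite sqrtr_gt0 invr_gt0 ltr0n muln_gt0 m0. Qed.

Let sigma_sqr K : sigma K ^+ 2 = (m * K)%:R^-1.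
Proof. by rewrite sqr_sqrtr// invr_ge0. Qed.

Let increment_sum K w : (0 < K)%N ->
  \sum_(i <- iota 0 K) increment (fine_grid K) i w = increment (fine_grid 1) 0 w.
Proof.
move=> K0; have := @telescope_sumr _ 0 K (fun i => B (fine_grid K i) w) (leq0n K).
rewrite /index_iota subn0 => ->; rewrite /increment /fine_grid !mul0r muln1.
congr (B _ w - _); rewrite natrM invfM mulrCA divff ?mulr1 ?mul1r//.
by rewrite pnatr_eq0 -lt0n.
Qed.

Let rho_cvg K : (0 < K)%N -> (\int[P]_w rho K j w)%R @[j --> \oo] --> (0 : R).
Proof.
move=> K0; have [||||_] := @Rdominated_convergence _ _ _ P (rho K) (fun=> 0) (fun=> 2 * M).
- by move=> j; exact: rho_measurable.
- move=> w.
  apply: (@squeeze_cvgr _ _ _ _ (fun=> 0) (fun j => L * `|\sum_(i <- iota 0 K)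
     quantc c j (increment (fine_grid K) i w) - quantc c j (increment (fine_grid 1) 0 w)|)).
  + apply: nearW => j; rewrite /rho ge_min lexx orbT andbT le_min !mulr_ge0//.
  + exact: cvg_cst.
  + rewrite -[X in _ --> X](mulr0 L); apply: cvgM; first exact: cvg_cst.
    rewrite -[X in _ --> X](normr0 R); apply: cvg_norm.
    rewrite -[X in _ --> X](subrr (c * increment (fine_grid 1) 0 w)).
    apply: cvgB; last exact: quantc_cvg.
    rewrite -(increment_sum w K0) mulr_sumr.
    by apply: cvg_sumr => i _; exact: quantc_cvg.
- by apply: (bounded_integrable P measurableT) => //= w; exact: lexx.
- by move=> j w; exact: rho_bound.
by rewrite Rintegral_cst// mul0r.
Qed.

(** All moments of the rounded law tend to those of the scaled normal law, and [rho] tends to 0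
    because the fine increments telescope. The limit is only bounded by [block_err K], as the third
    absolute moment is estimated and not computed. *)
Lemma block_err_cvg K : (0 < K)%N -> exists2 e : R,
  4 * L * h + K%:R * step_err K j + (\int[P]_w rho K j w)%R @[j --> \oo] --> e &
  e <= block_err K.
Proof.
move=> K0; have s0 := sigma_gt0 K0.
pose t3 := (\int[mu]_x (`|c * x| ^+ 3 * normal_pdf 0 (sigma K) x))%R.
exists (4 * L * h + K%:R * (2 * M / h * `|0 : R| +
   2 * M / h ^+ 2 * `|v - c ^+ 2 * (m * K)%:R^-1| + 4 * L / h ^+ 2 * (t + t3)) + 0).
  apply: cvgD; last exact: rho_cvg.
  apply: cvgD; first exact: cvg_cst.
  apply: cvgM; first exact: cvg_cst.
  have ge1 (x : R) : 1 <= `|x| + 1 by rewrite lerDr.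
  have le3 (k : nat) (x : R) : (k <= 3)%N -> `|x| ^+ k <= (`|x| + 1) ^+ 3.
    move=> k3; apply: (@le_trans _ _ ((`|x| + 1) ^+ k)).
      by apply: lerXn2r; rewrite ?nnegrE ?addr_ge0// lerDl.
    by rewrite ler_weXn2l.
  apply: cvgD; first apply: cvgD.
  - apply: cvgM; first exact: cvg_cst.
    apply: cvg_norm.
    have cid : continuous (@id R) by move=> x; exact: cvg_id.
    have := @quant_normal_cvg _ (sigma K) c id s0 cid (fun x => le3 1%N x isT).
    rewrite (_ : (\int[_]_x _)%R = 0)//.
    transitivity (c * \int[mu]_x (x * normal_pdf 0 (sigma K) x))%R; last first.
      by rewrite normal_moment1// mulr0.
    rewrite -RintegralZl//.
      by apply: eq_Rintegral => x _; rewrite mulrA.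
    exact: integrable_id_normal.
  - apply: cvgM; first exact: cvg_cst.
    apply: cvg_norm; apply: cvgB; first exact: cvg_cst.
    have := @quant_normal_cvg _ (sigma K) c (fun x => x ^+ 2) s0 (@exprn_continuous _ 2).
    rewrite (_ : (\int[_]_x _)%R = c ^+ 2 * (m * K)%:R^-1); last first.
      transitivity (c ^+ 2 * \int[mu]_x (x ^+ 2 * normal_pdf 0 (sigma K) x))%R; last first.
        by rewrite normal_moment2// sigma_sqr.
      rewrite -RintegralZl//.
        by apply: eq_Rintegral => x _; rewrite exprMn mulrA.
      exact: integrable_sqr_normal.
    by apply=> x; rewrite normrX; exact: le3.
  - apply: cvgM; first exact: cvg_cst.
    apply: cvgD; first exact: cvg_cst.
    apply: (@quant_normal_cvg _ (sigma K) c (fun x => `|x| ^+ 3) s0).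
      move=> x; apply: (@continuous_comp _ _ _ (fun y : R => `|y|) (fun y => y ^+ 3)).
        exact: norm_continuous.
      exact: exprn_continuous.
    by move=> x; rewrite normrX normr_id; exact: le3.
rewrite normr0 mulr0 add0r addr0 /block_err lerD2l mulrDr; apply: lerD.
  rewrite mulrCA ler_wpM2l//.
    by rewrite divr_ge0 ?mulr_ge0 ?exprn_ge0// ltW.
  rewrite -{1}[K%:R]ger0_norm// -normrM.
  suff -> : K%:R * (v - c ^+ 2 * (m * K)%:R^-1) = K%:R * v - c ^+ 2 / m%:R by [].
  by rewrite natrM; field; rewrite !pnatr_eq0 -!lt0n m0 K0.
rewrite mulrCA ler_wpM2l ?divr_ge0 ?mulr_ge0 ?exprn_ge0 ?(ltW h0)//.
rewrite mulrDr lerD2l [2 * _ * K%:R]mulrC -mulrA ler_wpM2l//.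
exact: normal_abs_moment3.
Qed.

Lemma coordinate_lipschitz (Phi : seq R -> R) (a b : nat -> R) l :
  (forall s u x y, `|Phi (s ++ x :: u) - Phi (s ++ y :: u)| <= L * `|x - y|) ->
  `|Phi (map a l) - Phi (map b l)| <= \sum_(i <- l) L * `|a i - b i|.
Proof.
elim: l Phi => [|i l IH] Phi PL; first by rewrite big_nil subrr normr0.
rewrite big_cons /= -(subrK (Phi (b i :: map a l)) (Phi (a i :: _))) -addrA.
apply: le_trans (ler_normD _ _) _; apply: lerD; first exact: (PL [::]).
by apply: (IH (fun s => Phi (b i :: s))) => s; exact: (PL (b i :: s)).
Qed.

(** With the other coordinates frozen, [Phi] is bounded and Lipschitz, so whole blocks can be
    exchanged in turn by [block_dist]. This is done at a fixed mesh [j], which then tends to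
    infinity on both sides of the inequality. *)
Lemma brownian_block_dist (Ks : seq nat) (Phi : seq R -> R) :
  size Ks = m -> {in Ks, forall K, (0 < K)%N} ->
  (forall s, `|Phi s| <= M) ->
  (forall s u x y, `|Phi (s ++ x :: u) - Phi (s ++ y :: u)| <= L * `|x - y|) ->
  `|itE [seq sum_mean (nseq K E) | K <- Ks] Phi -
    (\int[P]_w Phi [seq c * increment (fun i => i%:R / m%:R) i w | i <- iota 0 m])%R| <=
  \sum_(K <- Ks) block_err K.
Proof.
move=> sK K0 PM PL; pose u i : R := i%:R / m%:R.
have m0' : 0 < m%:R :> R by rewrite ltr0n.
have gu : grid m u.
  split; first by rewrite /u mul0r.
    by move=> i _; rewrite /u ltr_pM2r ?invr_gt0// ltr_nat.
  by rewrite /u divff// gt_eqF.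
have uB i : u i.+1 - u i = (m * 1)%:R^-1.
  by rewrite /u -mulrBl -natrB// subSnn mul1r muln1.
have mX i : (i < m)%N -> measurable_fun setT (increment u i).
  exact: increment_measurable.
have iota_lt : {in iota 0 m, forall i, (i < m)%N} by move=> i; rewrite mem_iota.
have cvI : (\int[P]_w Phi [seq quantc c j (increment u i w) | i <- iota 0 m])%R @[j --> \oo]
    --> (\int[P]_w Phi [seq c * increment u i w | i <- iota 0 m])%R.
  have [||||//] := @Rdominated_convergence _ _ _ P
    (fun j w => Phi [seq quantc c j (increment u i w) | i <- iota 0 m])
    (fun w => Phi [seq c * increment u i w | i <- iota 0 m]) (fun=> M).
  - by move=> j; exact: (quant_seq_measurable mX _ _ iota_lt).1.
  - move=> w; apply/cvgrPdist_le.
    suff H : \sum_(i <- iota 0 m) L * `|c * increment u i w - quantc c j (increment u i w)|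
        @[j --> \oo] --> (0 : R).
      move=> e e0; have /cvgrPdist_le/(_ e e0) := H; apply: filterS => j.
      rewrite sub0r normrN; apply: le_trans; apply: le_trans (ler_norm _).
      exact: coordinate_lipschitz.
    rewrite [X in _ --> X](_ : 0 = \sum_(i <- iota 0 m) L * `|c * increment u i w - c * increment u i w|).
      apply: cvg_sumr => i _; apply: cvgM; first exact: cvg_cst.
      by apply: cvg_norm; apply: cvgB; [exact: cvg_cst|exact: quantc_cvg].
    by rewrite big1// => i _; rewrite subrr normr0 mulr0.
  - by apply: (bounded_integrable P measurableT) => //= w; rewrite ger0_norm.
  - by move=> j w; exact: PM.
have main j : `|itE [seq sum_mean (nseq K E) | K <- Ks] Phi -
    (\int[P]_w Phi [seq quantc c j (increment u i w) | i <- iota 0 m])%R| <=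
   \sum_(K <- Ks) (4 * L * h + K%:R * step_err K j + (\int[P]_w rho K j w)%R).
  rewrite quant_increment_expectation//.
  have -> : [seq quant_mean (normal_prob 0 (Num.sqrt (u i.+1 - u i))) (quantc c j) | i <- iota 0 m] =
     [seq quant_mean (normal_prob 0 (sigma 1)) (quantc c j) | _ <- Ks].
    by apply: map_cst; [move=> i; rewrite uB|rewrite size_iota sK].
  have mapK (F G : nat -> mean (R := R)) : {in Ks, F =1 G} -> [seq F K | K <- Ks] = [seq G K | K <- Ks].
    elim: (Ks) => //= K Ks' IH FG; rewrite FG ?inE ?eqxx// IH// => x xK.
    by apply: FG; rewrite inE xK orbT.
  (* [itE_replace] asks for a bound at every index, also those outside [Ks]; forcing positivity
     provides it and changes nothing on [Ks]. *)
  pose pos K := maxn K 1.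
  have posE : {in Ks, forall K, pos K = K} by move=> K /K0 ?; apply/maxn_idPl.
  rewrite (mapK _ (fun K => sum_mean (nseq (pos K) E))); last by move=> K KK; rewrite posE.
  rewrite (eq_big_seq (fun K => 4 * L * h + (pos K)%:R * step_err (pos K) j + (\int[P]_w rho (pos K) j w)%R)); last first.
    by move=> K KK; rewrite posE.
  have := @itE_replace R nat Ks (fun K => sum_mean (nseq (pos K) E))
    (fun=> quant_mean (normal_prob 0 (sigma 1)) (quantc c j)) lip
    (fun K => 4 * L * h + (pos K)%:R * step_err (pos K) j + (\int[P]_w rho (pos K) j w)%R)
    Phi (@lipschitz_mixture R L M); apply.
  - by move=> K f lf; apply: block_dist => //; rewrite leq_max orbT.
  - by move=> s1 s2; split => [x|x y]; [exact: PM|exact: PL].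
have : exists2 e : R, \sum_(K <- Ks) (4 * L * h + K%:R * step_err K j + (\int[P]_w rho K j w)%R)
    @[j --> \oo] --> e & e <= \sum_(K <- Ks) block_err K.
  elim: (Ks) K0 => [_|K Ks' IH K0'].
    exists 0; last by rewrite big_nil.
    by under eq_fun do rewrite big_nil; exact: cvg_cst.
  have [e ce eb] := @block_err_cvg K (K0' K (mem_head _ _)).
  have K0s : {in Ks', forall K, (0 < K)%N} by move=> x xK; apply: K0'; rewrite inE xK orbT.
  have [e' ce' eb'] := IH K0s.
  exists (e + e'); last by rewrite big_cons lerD.
  by under eq_fun do rewrite big_cons; exact: cvgD.
move=> [e ce eb]; apply: le_trans eb.
apply: (ler_cvg_to _ ce); last by apply: nearW => j; exact: main.
by apply: cvg_norm; apply: cvgB; [exact: cvg_cst|exact: cvI].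
Qed.
End BrownianIncrements.

(** * A maximal inequality *)

Section MaximalInequality.
Context {R : realType}.

(** The event that a partial sum started at [x] has absolute value at least [lam], by a recursion on
    the first step that matches [itE]. *)
Fixpoint reaches (lam x : R) (s : seq R) : bool :=
  (lam <= `|x|) || (if s is y :: s' then reaches lam (x + y) s' else false).

Lemma reachesPn (lam : R) s x : ~~ reaches lam x s ->
  forall j, (j <= size s)%N -> `|x + \sum_(y <- take j s) y| < lam.
Proof.
elim: s x => [|y s IH] x /=; rewrite negb_or -ltNge => /andP[xl H] j.
  by move=> _; rewrite big_nil addr0.
case: j => [_|j js]; first by rewrite big_nil addr0.
by rewrite big_cons addrA; exact: IH.
Qed.

Variable E : mean (R := R).
Hypothesis E1 : E id = 0.
Hypothesis E3 : E (fun x => x ^+ 3) = 0.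
(** This says that the law is carried by [-1, 1]. *)
Hypothesis Eb : forall f g : R -> R, (forall x, `|x| <= 1 -> f x <= g x) -> E f <= E g.

Let E2_le : 0 <= E (fun x => x ^+ 2) <= 1.
Proof.
apply/andP; split.
  by rewrite -(mean_cst E 0); apply: mean_le => x; exact: sqr_ge0.
rewrite -(mean_cst E 1); apply: Eb => x x1.
by rewrite -(real_normK (num_real x)) expr_le1.
Qed.

Let E4_le : 0 <= E (fun x => x ^+ 4) <= 1.
Proof.
apply/andP; split.
  by rewrite -(mean_cst E 0); apply: mean_le => x; rewrite exprn_even_ge0.
rewrite -(mean_cst E 1); apply: Eb => x x1.
rewrite -[4%N]/(2 * 2)%N exprM -(real_normK (num_real x)) -exprM expr_le1//.
Qed.

Let E_pow4 x : E (fun y => (x + y) ^+ 4) =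
  x ^+ 4 + 6 * x ^+ 2 * E (fun y => y ^+ 2) + E (fun y => y ^+ 4).
Proof.
have -> : E (fun y => (x + y) ^+ 4) = E (fun y =>
   4 * x ^+ 3 * id y + (6 * x ^+ 2 * (y ^+ 2) + (4 * x * (y ^+ 3) + (1 * y ^+ 4 + x ^+ 4)))).
  by apply: eq_mean => y /=; ring.
by rewrite !mean_linear mean_cst E1 E3; ring.
Qed.

(** As the odd moments up to 3 vanish, each step adds to the fourth power the nonnegative terms
    [6 x^2 E2 + E4], where [E2, E4 <= 1]: this is the submartingale property and, by induction with
    [x] free, the upper bound. *)
Lemma fourth_moment_bound K x :
  x ^+ 4 <= itE (nseq K E) (fun s => (x + \sum_(y <- s) y) ^+ 4)
    <= x ^+ 4 + 6 * x ^+ 2 * K%:R + 3 * K%:R ^+ 2.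
Proof.
elim: K x => [|K IH] x /=.
  by rewrite big_nil addr0 mulr0 expr0n mulr0 !addr0 lexx.
have -> : E (fun z => itE (nseq K E) (fun s => (x + \sum_(y <- z :: s) y) ^+ 4)) =
   E (fun z => itE (nseq K E) (fun s => (x + z + \sum_(y <- s) y) ^+ 4)).
  by apply: eq_mean => z; apply: eq_itE => s _; rewrite big_cons addrA.
have /andP[a0 a1] := E2_le; have /andP[b0 b1] := E4_le.
apply/andP; split.
  apply: (@le_trans _ _ (E (fun z => (x + z) ^+ 4))).
    rewrite E_pow4 -addrA lerDl; apply: addr_ge0 => //; apply: mulr_ge0 => //.
    by apply: mulr_ge0 => //; exact: sqr_ge0.
  by apply: mean_le => z; case/andP: (IH (x + z)).
apply: (@le_trans _ _ (E (fun z => (x + z) ^+ 4 + (6 * (x + z) ^+ 2 * K%:R + 3 * K%:R ^+ 2)))).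
  by apply: mean_le => z; rewrite addrA; case/andP: (IH (x + z)).
rewrite meanD E_pow4.
have -> : E (fun z => 6 * (x + z) ^+ 2 * K%:R + 3 * K%:R ^+ 2) =
    E (fun z => 12 * x * K%:R * id z + (6 * K%:R * z ^+ 2 + (6 * x ^+ 2 * K%:R + 3 * K%:R ^+ 2))).
  by apply: eq_mean => z /=; ring.
rewrite !mean_linear !mean_cst E1.
move: (E (fun y => y ^+ 2)) (E (fun y => y ^+ 4)) a0 a1 b0 b1 => a b a0 a1 b0 b1.
have K0 : 0 <= K%:R :> R by [].
have h1 : 6 * x ^+ 2 * a <= 6 * x ^+ 2.
  by rewrite ler_piMr// mulr_ge0// sqr_ge0.
have h2 : 6 * K%:R * a <= 6 * K%:R by rewrite ler_piMr// mulr_ge0.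
have -> : K.+1%:R = K%:R + 1 :> R by rewrite natr1.
have -> : x ^+ 4 + 6 * x ^+ 2 * (K%:R + 1) + 3 * (K%:R + 1) ^+ 2 =
  x ^+ 4 + 6 * x ^+ 2 + 1 + (12 * x * K%:R * 0 + (6 * K%:R + (6 * x ^+ 2 * K%:R + 3 * K%:R ^+ 2)))
   + 2 by ring.
by rewrite mulr0; lra.
Qed.

(** Doob's inequality for the submartingale of fourth powers. If the start already reaches [lam],
    the lower bound on the fourth moment concludes; otherwise one step is taken and the induction
    goes on from there. *)
Lemma maximal_inequality K x (lam : R) : 0 <= lam ->
  lam ^+ 4 * itE (nseq K E) (fun s => (reaches lam x s)%:R) <=
  itE (nseq K E) (fun s => (x + \sum_(y <- s) y) ^+ 4).
Proof.
move=> l0; elim: K x => [|K IH] x.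
  rewrite /= orbF big_nil addr0.
  have [xl|_] := boolP (lam <= `|x|); last by rewrite mulr0 exprn_even_ge0.
  rewrite mulr1 -[4%N]/(2 * 2)%N !exprM -(real_normK (num_real x)).
  by rewrite !lerXn2r// ?nnegrE ?exprn_ge0// lerXn2r.
have [xl|xl] := boolP (lam <= `|x|).
  have /andP[h _] := fourth_moment_bound K.+1 x.
  apply: le_trans h; rewrite (_ : itE _ _ = 1); last first.
    rewrite -[RHS](itE_cst (nseq K.+1 E)); apply: eq_itE => -[|y s] _ /=; by rewrite xl.
  rewrite mulr1 -[4%N]/(2 * 2)%N !exprM -(real_normK (num_real x)).
  by rewrite !lerXn2r// ?nnegrE ?exprn_ge0// lerXn2r.
rewrite /= (negbTE xl) /= -meanZ; apply: mean_le => z.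
apply: le_trans (IH (x + z)) _; rewrite le_eqVlt; apply/orP; left; apply/eqP.
by apply: eq_itE => s _; rewrite big_cons addrA.
Qed.

Lemma reaches_prob K (lam : R) : 0 < lam ->
  itE (nseq K E) (fun s => (reaches lam 0 s)%:R) <= 3 * K%:R ^+ 2 / lam ^+ 4.
Proof.
move=> l0; rewrite ler_pdivlMr ?exprn_gt0// mulrC.
apply: le_trans (maximal_inequality K 0 (ltW l0)) _.
have /andP[_] := fourth_moment_bound K 0.
by rewrite !expr0n /= mulr0 mul0r !add0r.
Qed.
End MaximalInequality.

(** * Permutations and cyclic words *)

Section CyclicWords.
Context {R : realType}.
Variable N' : nat.

Definition uavg (f : 'I_N'.+1 -> R) : R := N'.+1%:R^-1 * \sum_b f b.

Lemma eq_uavg f g : f =1 g -> uavg f = uavg g.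
Proof. by move=> fg; rewrite /uavg (eq_bigr g). Qed.

Lemma uavg_cst c : uavg (fun=> c) = c.
Proof.
by rewrite /uavg sumr_const card_ord -[c *+ _]mulr_natl mulKf// pnatr_eq0.
Qed.

Lemma uavg_le f g : (forall b, f b <= g b) -> uavg f <= uavg g.
Proof.
by move=> fg; rewrite /uavg ler_wpM2l ?invr_ge0//; apply: ler_sum => b _.
Qed.

Lemma uavg_linear a f g : uavg (fun b => a * f b + g b) = a * uavg f + uavg g.
Proof. by rewrite /uavg big_split /= -mulr_sumr mulrDr mulrCA. Qed.

Lemma uavg_shift (a : 'I_N'.+1) f : uavg f = uavg (fun b => f (a + b)).
Proof. by rewrite /uavg (reindex_inj (addrI a)). Qed.

Lemma uavg_dist f g e : (forall b, `|f b - g b| <= e) -> `|uavg f - uavg g| <= e.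
Proof.
move=> fg; have -> : uavg f - uavg g = uavg (fun b => f b - g b).
  rewrite -mulN1r addrC -uavg_linear; apply: eq_uavg => b.
  by rewrite mulN1r addrC.
rewrite ler_norml -(uavg_cst e).
rewrite -[- uavg _]addr0 -[X in _ + X](uavg_cst 0) -mulN1r -uavg_linear.
apply/andP; split; apply: uavg_le => b; have := fg b; rewrite ler_norml => /andP[]//.
by rewrite mulN1r addr0.
Qed.

Fixpoint wavg (k : nat) (H : seq nat -> R) : R :=
  if k is k'.+1 then uavg (fun a => wavg k' (fun s => H (val a :: s))) else H [::].

Lemma wavg_dist k H G e :
  (forall s, size s = k -> all (fun a => a < N'.+1)%N s -> `|H s - G s| <= e) ->
  `|wavg k H - wavg k G| <= e.
Proof.
elim: k H G => [|k IH] H G HG /=; first exact: HG.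
apply: uavg_dist => a; apply: IH => s sk sN; apply: HG => /=; first by rewrite sk.
by rewrite ltn_ord.
Qed.

Lemma eq_wavg k H G : H =1 G -> wavg k H = wavg k G.
Proof. by move=> /funext ->. Qed.

Lemma wavg_tuple k H :
  wavg k H = (N'.+1%:R ^+ k)^-1 * \sum_(t : k.-tuple 'I_N'.+1) H (map val t).
Proof.
elim: k H => [|k IH] H /=.
  rewrite expr0 invr1 mul1r (big_pred1 [tuple])//.
  by move=> t; exact/esym/eqP/tuple0.
rewrite /uavg exprS invfM -mulrA; congr (_ * _).
rewrite (eq_bigr (fun a : 'I_N'.+1 => (N'.+1%:R ^+ k)^-1 *
  \sum_(t : k.-tuple 'I_N'.+1) H (val a :: map val t))); last first.
  by move=> a _; exact: IH.
rewrite -mulr_sumr; congr (_ * _).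
rewrite pair_bigA /= (reindex (fun t : k.+1.-tuple 'I_N'.+1 => (thead t, behead_tuple t))).
  by apply: eq_bigr => t _ /=; rewrite {3}(tuple_eta t).
exists (fun p => cons_tuple p.1 p.2) => [t _|[a t] _] /=.
  by rewrite [RHS]tuple_eta; apply: val_inj.
by congr (_, _); apply: val_inj.
Qed.

Fixpoint walk (a : nat) (b : seq nat) : seq nat :=
  if b is x :: b' then let a' := ((a + x) %% N'.+1)%N in a' :: walk a' b' else [::].

(** Translation by the current letter is a bijection of the cyclic group, so uniform letters and
    uniform increments generate the same words. *)
Lemma wavg_walk k (a : 'I_N'.+1) H : wavg k H = wavg k (fun b => H (walk a b)).
Proof.
elim: k a H => [//|k IH] a H /=.
rewrite (uavg_shift a); apply: eq_uavg => b.
rewrite (IH (a + b)); apply: eq_wavg => s.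
by [].
Qed.

(** Equally spaced values in [-1, 1], exchanged with their opposites by [b -> N' - b]; odd moments
    thus vanish exactly. *)
Definition step_value (b : nat) : R := (N'%:R - 2 * b%:R) / N'.+1%:R.

Definition step_mean : mean (R := R).
Proof.
apply: (@Mean R (fun f => uavg (fun b => f (step_value b)))).
- by move=> a f g; exact: uavg_linear.
- by move=> f g fg; apply: uavg_le => b; exact: fg.
- exact: uavg_cst.
Defined.

Lemma wavg_itE k (Phi : seq R -> R) :
  wavg k (fun s => Phi (map step_value s)) = itE (nseq k step_mean) Phi.
Proof.
elim: k Phi => [//|k IH] Phi /=.
by apply: eq_uavg => a; rewrite -IH.
Qed.

Definition stepw (a : nat -> nat) (i : nat) : R := if (a i < a i.-1)%N then -1 else 1.

Definition valw (a : nat -> nat) (k : nat) : R := \sum_(1 <= i < k.+1) stepw a i.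

(* The first summand depends only on the increment [b] modulo [N'.+1] and the last
   one telescopes: up to a bounded error, the path is a random walk. *)
Lemma step_decomp (a b : nat) : (a < N'.+1)%N -> (b < N'.+1)%N ->
  (if ((a + b) %% N'.+1 < a)%N then -1 else 1 : R) =
  step_value b + N'.+1%:R^-1 + 2 * (((a + b) %% N'.+1)%:R - a%:R) / N'.+1%:R.
Proof.
move=> aN bN; have N0 : N'.+1%:R != 0 :> R by rewrite pnatr_eq0.
have N1 : N'.+1%:R = N'%:R + 1 :> R by rewrite natr1.
(* A descent is exactly a wrap-around: without it [a + b] is at least [a]; with it a full turn is
   lost, and [b < N'.+1] puts the result below [a]. *)
rewrite /step_value; have [abN|Nab] := ltnP (a + b) N'.+1.
  rewrite modn_small// ltnNge leq_addr /= natrD N1; field; by rewrite -N1.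
have -> : ((a + b) %% N'.+1 = a + b - N'.+1)%N.
  by rewrite -{1}(subnK Nab) modnDr modn_small//; lia.
have -> : (a + b - N'.+1 < a)%N by lia.
by rewrite natrB// natrD N1; field; rewrite -N1.
Qed.

Lemma walk_lt a b : all (fun x => x < N'.+1)%N (walk a b).
Proof. by elim: b a => [//|x b IH] a /=; rewrite ltn_mod IH. Qed.

Lemma size_walk a b : size (walk a b) = size b.
Proof. by elim: b a => [//|x b IH] a /=; rewrite IH. Qed.

Lemma walk_valw (a : nat) b k : (a < N'.+1)%N -> all (fun x => x < N'.+1)%N b ->
  (k <= size b)%N ->
  valw (nth 0%N (a :: walk a b)) k = \sum_(x <- take k (map step_value b)) x
    + k%:R / N'.+1%:R + 2 * ((nth 0%N (a :: walk a b) k)%:R - a%:R) / N'.+1%:R.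
Proof.
elim: b a k => [|x b IH] a [|k] aN bN kb //.
- by rewrite /valw big_geq// big_nil !mul0r subrr mulr0 mul0r !addr0.
- by rewrite /valw big_geq// big_nil !mul0r subrr mulr0 mul0r !addr0.
move: bN => /= /andP[xN bN]; set a' := ((a + x) %% N'.+1)%N.
have aN' : (a' < N'.+1)%N by rewrite ltn_mod.
have -> : valw (nth 0%N [:: a, a' & walk a' b]) k.+1 =
    stepw (nth 0%N [:: a, a' & walk a' b]) 1 + valw (nth 0%N (a' :: walk a' b)) k.
  rewrite /valw big_ltn// big_add1 /=; congr (_ + _).
  by rewrite big_nat_cond [RHS]big_nat_cond; apply: eq_bigr => -[|i].
rewrite (IH a' k aN' bN kb) big_cons {1}/stepw /= step_decomp// -/a'.
rewrite -natr1; set c := (nth _ _ _)%:R; field.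
by rewrite natr1 pnatr_eq0.
Qed.

(** The drift [k / N'.+1] is at most 1 since the word is no longer than the alphabet, and the
    telescoped term is at most 2. *)
Lemma walk_valw_dist (a : nat) b k : (a < N'.+1)%N -> all (fun x => x < N'.+1)%N b ->
  (k <= size b)%N -> (size b <= N'.+1)%N ->
  `|valw (nth 0%N (a :: walk a b)) k - \sum_(x <- take k (map step_value b)) x| <= 3.
Proof.
move=> aN bN kb bN'; rewrite walk_valw//.
set y := nth _ _ _; set S := \sum_(x <- _) x.
have yN : (y < N'.+1)%N.
  rewrite /y; case: (k) kb => [|k']//= kb.
  by apply: (allP (walk_lt a b)); rewrite mem_nth// size_walk.
have N0 : 0 < N'.+1%:R :> R by rewrite ltr0n.
have -> : S + k%:R / N'.+1%:R + 2 * (y%:R - a%:R) / N'.+1%:R - S =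
   (k%:R + 2 * (y%:R - a%:R)) / N'.+1%:R by ring.
rewrite normrM [X in _ * X]ger0_norm ?invr_ge0// ler_pdivrMr//.
have h1 : y%:R <= N'.+1%:R :> R by rewrite ler_nat ltnW.
have h2 : a%:R <= N'.+1%:R :> R by rewrite ler_nat ltnW.
have h3 : k%:R <= N'.+1%:R :> R by rewrite ler_nat (leq_trans kb).
have h4 : 0 <= y%:R :> R by []. have h5 : 0 <= a%:R :> R by [].
have h6 : 0 <= k%:R :> R by [].
by rewrite ler_norml; apply/andP; split; lra.
Qed.

Lemma valw_le_compare (a a' : nat -> nat) n k : (k <= n)%N ->
  (forall i j, (i <= n)%N -> (j <= n)%N -> (a i < a j)%N = (a' i < a' j)%N) ->
  valw a k = valw a' k.
Proof.
move=> kn aa; rewrite /valw big_nat_cond [RHS]big_nat_cond.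
apply: eq_bigr => i /andP[/andP[i1 ik] _].
by rewrite /stepw aa//; lia.
Qed.

(** * Standardisation of repetition-free words *)

Section Standardisation.
Variables (n : nat) (G : (nat -> nat) -> R) (M : R).
Hypothesis Gext : forall a a' : nat -> nat,
  (forall i j, (i <= n)%N -> (j <= n)%N -> (a i < a j)%N = (a' i < a' j)%N) -> G a = G a'.
Hypothesis GM : forall a, `|G a| <= M.

Let word (w : n.+1.-tuple 'I_N'.+1) (i : nat) : nat := tnth w (inord i).
Let pword (s : 'S_n.+1) (i : nat) : nat := s (inord i).
Let act (s : 'S_n.+1) (w : n.+1.-tuple 'I_N'.+1) := [tuple tnth w (s i) | i < n.+1].

Let pavg := (#|{perm 'I_n.+1}|%:R)^-1 * \sum_(s : 'S_n.+1) G (pword s).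

(** Each position is sent to the number of letters smaller than its own; this is injective when no
    letter is repeated. *)
Let rank_perm (w : n.+1.-tuple 'I_N'.+1) : uniq w ->
  exists p : 'S_n.+1, forall i j, (p i < p j)%N = (tnth w i < tnth w j)%N.
Proof.
move=> uw; pose S i : {set 'I_n.+1} := [set j | (tnth w j < tnth w i)%N]%SET.
have Slt i : (#|S i| < n.+1)%N.
  rewrite -[X in (_ < X)%N](card_ord n.+1) -cardsT; apply: proper_card.
  apply/properP; split; first exact: finset.subsetT.
  by exists i; rewrite !inE ?ltnn.
have Smono i j : (tnth w i < tnth w j)%N -> (#|S i| < #|S j|)%N.
  move=> ij; apply: proper_card; apply/properP; split.
    by apply/fintype.subsetP => k; rewrite !inE => /ltn_trans; apply.
  by exists i; rewrite !inE ?ltnn.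
have inj_t : injective (tnth w) by apply/tuple_uniqP.
pose f i := Ordinal (Slt i).
have finj : injective f.
  move=> i j /(congr1 val) /= e; apply: inj_t; apply: val_inj.
  by case: (ltngtP (tnth w i) (tnth w j)) => // /Smono; rewrite e ltnn.
exists (perm finj) => i j; rewrite !permE /=.
case: (ltngtP (tnth w i) (tnth w j)) => [/Smono//|/Smono|/val_inj/inj_t ->].
  by move=> /ltnW; rewrite leqNgt => /negbTE.
by rewrite ltnn.
Qed.

(** Rearranging [w] by [s] gives a word ordered like the permutation [s * p], where [p] is the rank
    permutation of [w], and [s -> s * p] is a bijection. *)
Let inner (w : n.+1.-tuple 'I_N'.+1) : uniq w ->
  \sum_(s : 'S_n.+1) G (word (act s w)) = \sum_(s : 'S_n.+1) G (pword s).
Proof.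
move=> /rank_perm[p pP].
rewrite [RHS](reindex_inj (mulIg p)) /=; apply: eq_bigr => s _.
by apply: Gext => i j _ _; rewrite /word /pword !tnth_mktuple !permM pP.
Qed.

(** The birthday bound: a letter added to [k] distinct ones repeats one of them with probability at
    most [k / N'.+1], and these probabilities are summed. *)
Let nonuniq_frac : `|1 - (N'.+1 ^_ n.+1)%:R / (N'.+1 ^ n.+1)%:R| <= n.+1%:R ^+ 2 / N'.+1%:R :> R.
Proof.
have N0 : 0 < N'.+1%:R :> R by rewrite ltr0n.
have H k : 0 <= 1 - (N'.+1 ^_ k)%:R / (N'.+1 ^ k)%:R :> R /\
   1 - (N'.+1 ^_ k)%:R / (N'.+1 ^ k)%:R <= k%:R ^+ 2 / N'.+1%:R :> R.
  elim: k => [|k [IH1 IH2]].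
    by rewrite ffactn0 expn0 divr1 subrr expr0n mul0r.
  set r := _ / _ in IH1 IH2.
  have r0 : 0 <= r by rewrite divr_ge0.
  have -> : (N'.+1 ^_ k.+1)%:R / (N'.+1 ^ k.+1)%:R = r * ((N'.+1 - k)%N%:R / N'.+1%:R) :> R.
    by rewrite ffactnSr expnSr !natrM /r mulf_div.
  have u0 : 0 <= (N'.+1 - k)%N%:R / N'.+1%:R :> R by rewrite divr_ge0.
  have u1 : (N'.+1 - k)%N%:R / N'.+1%:R <= 1 :> R.
    by rewrite ler_pdivrMr// mul1r ler_nat leq_subr.
  have u2 : 1 - k%:R / N'.+1%:R <= (N'.+1 - k)%N%:R / N'.+1%:R :> R.
    rewrite ler_pdivlMr// mulrBl mul1r divfK ?gt_eqF//.
    by rewrite lerBlDr -natrD ler_nat; lia.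
  have kN : 0 <= k%:R / N'.+1%:R :> R by rewrite divr_ge0.
  have NN : 0 <= N'.+1%:R^-1 :> R by rewrite invr_ge0.
  set u := _ / _ in u0 u1 u2 *.
  have -> : 1 - r * u = (1 - r) + r * (1 - u) by ring.
  have q1 : 0 <= r * (1 - u) by rewrite mulr_ge0// subr_ge0.
  have q2 : r * (1 - u) <= 1 - u by rewrite ler_piMl// ?subr_ge0// -subr_ge0.
  split; first by rewrite addr_ge0.
  have -> : k.+1%:R ^+ 2 / N'.+1%:R = k%:R ^+ 2 / N'.+1%:R + 2 * (k%:R / N'.+1%:R) + N'.+1%:R^-1 :> R.
    have -> : k.+1%:R = k%:R + 1 :> R by rewrite natr1.
    by ring.
  rewrite -[X in _ <= X]addrA; apply: lerD => //; apply: le_trans q2 _.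
  apply: (@le_trans _ _ (k%:R / N'.+1%:R)); first by rewrite lerBlDr addrC -lerBlDr.
  by rewrite mulr2n mulrDl mul1r -addrA lerDl addr_ge0.
by have [h1 h2] := H n.+1; rewrite ger0_norm.
Qed.

(* Permuting the letters of a repetition-free word permutes its standardisation, so
   averaging over all rearrangements reduces the word to a uniform permutation. *)
Lemma perm_word_dist : `|wavg n.+1 (fun s => G (nth 0%N s)) - pavg| <=
  2 * M * (n.+1%:R ^+ 2 / N'.+1%:R).
Proof.
have M0 : 0 <= M by exact: le_trans (normr_ge0 _) (GM id).
pose p0 : R := #|{perm 'I_n.+1}|%:R.
have p00 : 0 < p0 :> R by rewrite ltr0n; apply/card_gt0P; exists 1%g.
have pavgM : `|pavg| <= M.
  rewrite /pavg -/p0 normrM ger0_norm ?invr_ge0 ?(ltW p00)// ler_pdivrMl//.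
  rewrite (le_trans (ler_norm_sum _ _ _))// (le_trans (ler_sum _ (fun s _ => GM (pword s))))//.
  by rewrite sumr_const -mulr_natl.
have NN : 0 < N'.+1%:R ^+ n.+1 :> R by rewrite exprn_gt0// ltr0n.
have e1 : wavg n.+1 (fun s => G (nth 0%N s)) =
    (N'.+1%:R ^+ n.+1)^-1 * \sum_(w : n.+1.-tuple 'I_N'.+1) G (word w).
  rewrite wavg_tuple; congr (_ * _); apply: eq_bigr => w _.
  apply: Gext => i j ni nj.
  by rewrite !(nth_map ord0) ?size_tuple// /word !(tnth_nth ord0) !inordK.
(* Each rearrangement is a bijection of the set of words, so averaging over all of them leaves the
   total unchanged. *)
have e2 : \sum_(w : n.+1.-tuple 'I_N'.+1) G (word w) =
    \sum_(w : n.+1.-tuple 'I_N'.+1) (p0^-1 * \sum_(s : 'S_n.+1) G (word (act s w))).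
  rewrite -mulr_sumr exchange_big /=.
  rewrite [X in _ = p0^-1 * X](eq_bigr (fun=> \sum_(w : n.+1.-tuple 'I_N'.+1) G (word w))).
    by rewrite sumr_const -mulr_natl mulKf// gt_eqF.
  move=> s _; rewrite [RHS](reindex (act s))//.
  exists (act s^-1%g) => w _; apply: eq_from_tnth => i; rewrite !tnth_mktuple.
    by rewrite permKV.
  by rewrite permK.
rewrite e1 e2.
have -> : pavg = (N'.+1%:R ^+ n.+1)^-1 * \sum_(w : n.+1.-tuple 'I_N'.+1) pavg.
  by rewrite sumr_const card_tuple card_ord -[pavg *+ _]mulr_natl natrX mulKf// gt_eqF.
(* A repetition-free word contributes exactly [pavg]; only words with a repetition remain, each with
   an error of at most [2 * M]. *)
rewrite -mulrBr -sumrB (bigID (fun w : n.+1.-tuple 'I_N'.+1 => uniq w)) /= big1 ?add0r; last first.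
  by move=> w uw; rewrite inner// /pavg -/p0 subrr.
rewrite normrM ger0_norm ?invr_ge0 ?(ltW NN)// ler_pdivrMl//.
apply: le_trans (ler_norm_sum _ _ _) _.
apply: (@le_trans _ _ (\sum_(w : n.+1.-tuple 'I_N'.+1 | ~~ uniq w) (2 * M))).
  apply: ler_sum => w _; apply: le_trans (ler_normB _ _) _.
  rewrite mulr2n mulrDl mul1r lerD//.
  rewrite normrM ger0_norm ?invr_ge0 ?(ltW p00)// ler_pdivrMl//.
  rewrite (le_trans (ler_norm_sum _ _ _))// (le_trans (ler_sum _ (fun s _ => GM (word (act s w)))))//.
  by rewrite sumr_const -mulr_natl.
rewrite sumr_const -[_ *+ _]mulr_natr [leRHS]mulrCA; apply: ler_wpM2l; first by rewrite mulr_ge0.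
have -> : #|[pred w : n.+1.-tuple 'I_N'.+1 | ~~ uniq w]|%:R =
   N'.+1%:R ^+ n.+1 * (1 - (N'.+1 ^_ n.+1)%:R / (N'.+1 ^ n.+1)%:R) :> R.
  have := cardC [pred w : n.+1.-tuple 'I_N'.+1 | uniq w].
  have := card_uniq_tuples n.+1 [pred x : 'I_N'.+1 | true].
  rewrite card_ord card_tuple card_ord => e3 e4.
  rewrite natrX mulrBr mulr1 mulrCA divff ?mulr1 ?gt_eqF// -natrX -e4 natrD.
  have -> : #|[pred w : n.+1.-tuple 'I_N'.+1 | uniq w]| = (N'.+1 ^_ n.+1)%N.
    rewrite -e3; apply: eq_card => w; rewrite !inE.
    by rewrite (eq_all (a2 := predT)) ?all_predT.
  by rewrite addrAC subrr add0r; congr (_%:R); apply: eq_card => w.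
rewrite ler_wpM2l ?(ltW NN)//.
by apply: le_trans (ler_norm _) nonuniq_frac.
Qed.
End Standardisation.
End CyclicWords.

(** * Moments of the discrete uniform steps *)

Section StepMoments.
Context {R : realType} (N' : nat).
Let E := step_mean (R := R) N'.

Let step_rev (b : 'I_N'.+1) : step_value N' (rev_ord b) = - step_value N' b :> R.
Proof.
rewrite /step_value /= subSS natrB; last by rewrite -ltnS.
by ring.
Qed.

Let step_sym f : E f = E (fun x => f (- x)).
Proof.
rewrite /E /= /uavg (reindex_inj rev_ord_inj) /=; congr (_ * _).
by apply: eq_bigr => b _; rewrite -step_rev.
Qed.

Lemma step_mean_odd f : (forall x, f (- x) = - f x) -> step_mean (R := R) N' f = 0.
Proof.
move=> fN; have := step_sym f; rewrite [X in _ = X](eq_mean E (g := fun x => -1 * f x)); last first.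
  by move=> x; rewrite fN mulN1r.
by rewrite meanZ -/E => h; lra.
Qed.

Lemma step_value_le1 (b : 'I_N'.+1) : `|step_value N' b : R| <= 1.
Proof.
rewrite /step_value normrM [X in _ * X]ger0_norm ?invr_ge0// ler_pdivrMr ?ltr0n// mul1r.
have h1 : (b : nat)%:R <= N'%:R :> R by rewrite ler_nat -ltnS.
have h2 : 0 <= (b : nat)%:R :> R by [].
have -> : N'.+1%:R = N'%:R + 1 :> R by rewrite natr1.
by rewrite ler_norml; apply/andP; split; lra.
Qed.

Lemma step_mean_le f g : (forall x, `|x| <= 1 -> f x <= g x) ->
  step_mean (R := R) N' f <= step_mean (R := R) N' g.
Proof. by move=> fg; apply: uavg_le => b; apply: fg; exact: step_value_le1. Qed.

Lemma step_mean_sqr : step_mean (R := R) N' (fun x => x ^+ 2) =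
  3^-1 - (3 * N'.+1%:R ^+ 2)^-1.
Proof.
(* The centre [c] is kept separate from the number of terms, so that induction on [n] leaves it
   fixed. *)
have H n (c : R) : \sum_(b < n) (c - 2 * (b : nat)%:R) ^+ 2 =
   n%:R * c ^+ 2 - 2 * c * n%:R * (n%:R - 1) + 2 / 3 * (n%:R * (n%:R - 1) * (2 * n%:R - 1)).
  elim: n => [|n IH]; first by rewrite big_ord0; ring.
  rewrite big_ord_recr /= IH.
  have -> : n.+1%:R = n%:R + 1 :> R by rewrite natr1.
  by field.
rewrite /= /uavg.
have N0 : N'.+1%:R != 0 :> R by rewrite pnatr_eq0.
have N1 : N'.+1%:R = N'%:R + 1 :> R by rewrite natr1.
transitivity (N'.+1%:R^-1 * ((N'.+1%:R ^+ 2)^-1 * \sum_(b < N'.+1) (N'%:R - 2 * (b : nat)%:R : R) ^+ 2)).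
  congr (_ * _); rewrite mulr_sumr; apply: eq_bigr => b _.
  by rewrite /step_value expr_div_n mulrC.
by rewrite H N1; field; rewrite -N1.
Qed.

Lemma step_mean_abs3 : 0 <= step_mean (R := R) N' (fun x => `|x| ^+ 3) <= 1.
Proof.
apply/andP; split.
  by rewrite -(mean_cst E 0); apply: mean_le => x; rewrite exprn_ge0.
rewrite -[X in _ <= X](mean_cst E 1); apply: step_mean_le => x x1.
by rewrite exprn_ile1.
Qed.
End StepMoments.

(** * Piecewise linear paths *)

Section PiecewiseLinear.
Context {R : realType}.

Definition clamp (x : R) : R := Num.max 0 (Num.min 1 x).

(* Interpolates the values [y k] at [k / m]; the sum of clamps makes continuity immediate. *)
Definition PL (m : nat) (y : nat -> R) (t : R) : R :=
  y 0%N + \sum_(i < m) (y i.+1 - y i) * clamp (m%:R * t - i%:R).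

Lemma clamp_continuous : continuous clamp.
Proof.
move=> x.
have c1 : {for x, continuous ((fun=> 1 : R) \min (@id R))}.
  by apply: continuous_min; [exact: cvg_cst|exact: cvg_id].
have c0 : {for x, continuous (fun=> 0 : R)} by exact: cvg_cst.
exact: (continuous_max c0 c1).
Qed.

Lemma PL_continuous m y : continuous (PL m y).
Proof.
have H k : continuous (fun t : R => \sum_(i < k) (y i.+1 - y i) * clamp (m%:R * t - i%:R)).
  elim: k => [|k IH] t.
    by under eq_fun do rewrite big_ord0; exact: cvg_cst.
  under eq_fun do rewrite big_ord_recr /=.
  apply: cvgD; first exact: IH.
  apply: cvgM; first exact: cvg_cst.
  apply: continuous_cvg; first exact: clamp_continuous.
  apply: cvgB; last exact: cvg_cst.
  by apply: cvgM; [exact: cvg_cst|exact: cvg_id].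
by move=> t; apply: cvgD; [exact: cvg_cst|exact: H].
Qed.

Lemma PL_within m y : {within `[0, 1], continuous (PL m y)}.
Proof. exact/continuous_subspaceT/PL_continuous. Qed.

(** Before [k] all clamps are saturated at 1 and the increments telescope; after [k] they are 0.
    Cells are closed, so a knot may be read from either side. *)
Lemma PLE m y (t : R) (k : nat) : (k < m)%N -> k%:R <= m%:R * t <= k.+1%:R ->
  PL m y t = y k + (m%:R * t - k%:R) * (y k.+1 - y k).
Proof.
move=> km /andP[kt tk]; rewrite /PL.
have k1 : k.+1%:R = k%:R + 1 :> R by rewrite natr1.
rewrite -(big_mkord xpredT (fun i => (y i.+1 - y i) * clamp (m%:R * t - i%:R))).
rewrite (@big_cat_nat _ _ _ k) //=; last exact: ltnW.
rewrite [X in _ + (_ + X)]big_ltn//.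
rewrite (eq_big_nat _ _ (F2 := fun i => y i.+1 - y i)); last first.
  move=> i /andP[_ ik]; have ik' : i.+1%:R <= k%:R :> R by rewrite ler_nat.
  have i1 : i.+1%:R = i%:R + 1 :> R by rewrite natr1.
  by rewrite /clamp min_l ?max_r ?mulr1//; lra.
rewrite telescope_sumr// [X in _ + (_ + (_ + X))]big_nat_cond big1 => [|i].
  by rewrite /clamp min_r ?max_r; [ring|lra|lra].
move=> /andP[/andP[ki _] _]; have ki' : k.+1%:R <= i%:R :> R by rewrite ler_nat.
rewrite /clamp max_l ?mulr0// ge_min; apply/orP; right; lra.
Qed.

Lemma PL_cell m (t : R) : (0 < m)%N -> 0 <= t <= 1 ->
  exists2 k, (k < m)%N & k%:R <= m%:R * t <= k.+1%:R.
Proof.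
move=> m0 /andP[t0 t1]; pose j := Num.truncn (m%:R * t).
have m0' : 0 < m%:R :> R by rewrite ltr0n.
have mt0 : 0 <= m%:R * t by rewrite mulr_ge0.
have /andP[j1 j2] := truncn_itv mt0.
have [jm|mj] := ltnP j m; first by exists j => //; rewrite j1 ltW.
(* Only [t = 1] has its integer part outside the range; it belongs to the last closed cell. *)
exists m.-1; first by rewrite prednK.
have tE : t = 1.
  by apply/eqP; rewrite eq_le t1 /= -(ler_pM2l m0') mulr1 (le_trans _ j1)// ler_nat.
by rewrite tE mulr1 prednK// !ler_nat leqnn leq_pred.
Qed.

Lemma convex_dist (a b c x e : R) : 0 <= x <= 1 -> `|a - c| <= e -> `|b - c| <= e ->
  `|a + x * (b - a) - c| <= e.
Proof.
move=> /andP[x0 x1] ac bc.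
have -> : a + x * (b - a) - c = (1 - x) * (a - c) + x * (b - c) by ring.
apply: le_trans (ler_normD _ _) _; rewrite !normrM (ger0_norm x0) ger0_norm ?subr_ge0//.
have -> : e = (1 - x) * e + x * e by ring.
by apply: lerD; apply: ler_wpM2l => //; rewrite subr_ge0.
Qed.

Lemma PL_dist m y z (t e : R) : (0 < m)%N -> 0 <= t <= 1 ->
  (forall k, (k <= m)%N -> `|y k - z k| <= e) -> `|PL m y t - PL m z t| <= e.
Proof.
move=> m0 t01 yz; have [k km kt] := PL_cell m0 t01; rewrite !(PLE _ km kt).
have x01 : 0 <= m%:R * t - k%:R <= 1.
  by move: kt => /andP[? ?]; rewrite subr_ge0 lerBlDl natr1; apply/andP.
have -> : y k + (m%:R * t - k%:R) * (y k.+1 - y k) - (z k + (m%:R * t - k%:R) * (z k.+1 - z k))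
  = (y k - z k) + (m%:R * t - k%:R) * ((y k.+1 - z k.+1) - (y k - z k)) - 0 by ring.
by apply: convex_dist => //; rewrite subr0; apply: yz => //; exact: ltnW.
Qed.

(** Both interpolations are compared with [y] at the left end of the coarse block. As coarse knots
    are rounded down to fine ones, the fine cell of [t] can stick out of the block by one index,
    which costs one increment [eta]. *)
Lemma PL_coarse n m y (t e eta : R) : (0 < m)%N -> (0 < n)%N -> 0 <= t <= 1 ->
  (forall k j, (k < m)%N -> ((n * k) %/ m <= j <= (n * k.+1) %/ m)%N ->
     `|y j - y ((n * k) %/ m)%N| <= e) ->
  (forall j, (j < n)%N -> `|y j.+1 - y j| <= eta) ->
  `|PL n y t - PL m (fun k => y ((n * k) %/ m)%N) t| <= 2 * e + eta.
Proof.
move=> m0 n0 t01 yosc ystep.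
have [k km kt] := PL_cell m0 t01; have [j jn jt] := PL_cell n0 t01.
rewrite (PLE _ km kt) (PLE _ jn jt).
set a := ((n * k) %/ m)%N; set a' := ((n * k.+1) %/ m)%N.
have unit_itv (i : nat) (x : R) : i%:R <= x <= i.+1%:R -> 0 <= x - i%:R <= 1.
  by move=> /andP[? ?]; rewrite subr_ge0 lerBlDl natr1; apply/andP.
have m0' : 0 < m%:R :> R by rewrite ltr0n.
have n0' : 0 < n%:R :> R by rewrite ltr0n.
have aa' : (a <= a')%N by rewrite leq_div2r// leq_mul.
have e0 : 0 <= e by apply: le_trans (yosc k a km _) => //; rewrite leqnn.
have aj : (a <= j.+1)%N.
  rewrite -(ler_nat R) -(ler_pM2r m0') -!natrM.
  apply: (@le_trans _ _ (n * k)%:R); first by rewrite ler_nat leq_divM.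
  case/andP: kt jt => kt _ /andP[_ jt]; rewrite !natrM.
  apply: (@le_trans _ _ (n%:R * (m%:R * t))); first by rewrite ler_pM2l.
  by rewrite mulrCA [leRHS]mulrC ler_pM2l.
have ja : (j <= a')%N.
  rewrite leq_divRL// -(ler_nat R) !natrM.
  case/andP: kt jt => _ kt /andP[jt _].
  apply: (@le_trans _ _ (n%:R * t * m%:R)); first by rewrite ler_pM2r.
  by rewrite -mulrA [t * _]mulrC ler_pM2l.
have eta0 : 0 <= eta by exact: le_trans (normr_ge0 _) (ystep _ jn).
have yj : `|y j - y a| <= e + eta.
  have [ja2|] := leqP a j; first by rewrite (le_trans (yosc k j km _)) ?lerDl// ja2.
  move=> ja2; have -> : a = j.+1 by apply/eqP; rewrite eqn_leq aj.
  by rewrite distrC (le_trans (ystep _ jn))// lerDr.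
have yj1 : `|y j.+1 - y a| <= e + eta.
  move: ja; rewrite leq_eqVlt => /predU1P[je|ja2]; last first.
    by rewrite (le_trans (yosc k j.+1 km _)) ?lerDl// aj.
  rewrite -(subrK (y j) (y j.+1)) -addrA addrC (le_trans (ler_normD _ _))// lerD//.
    by apply: yosc => //; rewrite je leqnn andbT.
  exact: ystep.
have h1 := convex_dist (unit_itv _ _ jt) yj yj1.
have h2 : `|y a + (m%:R * t - k%:R) * (y a' - y a) - y a| <= e.
  apply: convex_dist; [exact: unit_itv|by rewrite subrr normr0|].
  by apply: yosc => //; rewrite leqnn andbT.
have -> : 2 * e + eta = (e + eta) + e by ring.
apply: le_trans (lerD h1 h2); rewrite [X in _ <= _ + X]distrC.
exact: ler_distD.
Qed.

Lemma uniform_continuity01 (g : R -> R) (e : R) : {within `[0, 1], continuous g} -> 0 < e ->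
  \forall m \near \oo, forall t t' : R, 0 <= t <= 1 -> 0 <= t' <= 1 ->
    m%:R * `|t - t'| <= 1 -> `|g t - g t'| <= e.
Proof.
move=> /subspace_continuousP cg e0.
have /compact_near_coveringP := @segment_compact R 0 1.
move=> /(_ nat \oo (fun m t => 0 <= t <= 1 -> forall t', 0 <= t' <= 1 ->
  m%:R * `|t - t'| <= 1 -> `|g t - g t'| <= e)).
move=> /(_ _) H; have {}H := H _.
have : \forall m \near \oo, `[0, 1] `<=` (fun t => 0 <= t <= 1 -> forall t', 0 <= t' <= 1 ->
  m%:R * `|t - t'| <= 1 -> `|g t - g t'| <= e).
  apply: H => x x01.
  have x01' : `[0, 1]%classic x by [].
  have := cg x x01'; move=> /cvgrPdist_le /(_ (e / 2)); rewrite divr_gt0// => /(_ isT).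
  rewrite near_withinE /= => -[r /= r0 Hr].
  have r2 : 0 < r / 2 by rewrite divr_gt0.
  have near_x : \forall t \near x, `|x - t| < r / 2 by exists (r / 2).
  have near_m : \forall m \near \oo, 2 / r < m%:R by exact: nbhs_infty_gtr.
  exists ([set t | `|x - t| < r / 2], [set m : nat | 2 / r < m%:R]) => //.
  move=> [t m] /= [xt rm] t01 t' t'01 mtt.
  have tt' : `|t - t'| < r / 2.
    have m0 : 0 < m%:R :> R by apply: lt_trans rm; rewrite divr_gt0.
    apply: (@le_lt_trans _ _ (m%:R^-1)); first by rewrite -(ler_pM2l m0) divff ?gt_eqF.
    by rewrite -[r / 2]invrK ltf_pV2 ?posrE ?invr_gt0// invf_div.
  have gt : `|g x - g t| <= e / 2.
    apply: (Hr t); last by rewrite /= in_itv.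
    by apply: lt_trans xt _; rewrite ltr_pdivrMr// ltr_pMr// ltr1n.
  have gt' : `|g x - g t'| <= e / 2.
    apply: (Hr t'); last by rewrite /= in_itv.
    rewrite /ball_ /= -(subrK t x) -addrA (le_lt_trans (ler_normD _ _))//.
    by rewrite (splitr r) ltrD.
  rewrite -(subrK (g x) (g t)) -addrA (le_trans (ler_normD _ _))// (splitr e) lerD//.
  by rewrite distrC.
by apply: filterS => m Hm t t' t01; apply: (Hm t).
Qed.

Lemma PL_uniform (g : R -> R) (e : R) : {within `[0, 1], continuous g} -> 0 < e ->
  \forall m \near \oo, forall t : R, 0 <= t <= 1 ->
    `|g t - PL m (fun k => g (k%:R / m%:R)) t| <= e.
Proof.
move=> cg e0; near=> m => t t01.
have m0 : (0 < m)%N by near: m; exact: nbhs_infty_gt.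
have m0' : 0 < m%:R :> R by rewrite ltr0n.
have mN0 : m%:R != 0 :> R by rewrite gt_eqF.
have [k km kt] := PL_cell m0 t01; rewrite (PLE _ km kt) distrC.
have H : forall t t' : R, 0 <= t <= 1 -> 0 <= t' <= 1 -> m%:R * `|t - t'| <= 1 -> `|g t - g t'| <= e.
  by near: m; exact: uniform_continuity01.
have itv (i : nat) : (i <= m)%N -> 0 <= (i%:R / m%:R : R) <= 1.
  by move=> im; rewrite divr_ge0//= ler_pdivrMr// mul1r ler_nat.
have dist (i : nat) : m%:R * `|i%:R / m%:R - t| = `|i%:R - m%:R * t|.
  rewrite -{1}(ger0_norm (ltW m0')) -normrM mulrBr mulrCA divff// mulr1//.
move: (kt) => /andP[k1 k2].
have k3 : k.+1%:R = k%:R + 1 :> R by rewrite natr1.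
apply: convex_dist.
- by apply/andP; split; lra.
- apply: H => //; first by apply: itv; exact: ltnW.
  by rewrite dist ler_norml; apply/andP; split; lra.
- apply: H => //; first exact: itv.
  by rewrite dist ler_norml; apply/andP; split; lra.
Unshelve. all: by end_near. Qed.

End PiecewiseLinear.

(** * Lipschitz functionals of permutation paths and of random walks *)

Section LipschitzFunctional.
Context {R : realType}.
Implicit Types (F : (R -> R) -> R) (g : R -> R).

Definition bounded_functional F (M : R) :=
  forall g, {within `[0, 1], continuous g} -> `|F g| <= M.

(** The uniform distance enters through its upper bounds [e], which avoids a supremum. *)
Definition lipschitz_functional F (L : R) :=
  forall g g' (e : R), {within `[0, 1], continuous g} -> {within `[0, 1], continuous g'} ->
    0 <= e -> (forall t, 0 <= t <= 1 -> `|g t - g' t| <= e) -> `|F g - F g'| <= L * e.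

Lemma eq_PL m (y z : nat -> R) : (forall k, (k <= m)%N -> y k = z k) -> PL m y = PL m z.
Proof.
move=> yz; apply/funext => t; rewrite /PL yz//; congr (_ + _).
by apply: eq_bigr => i _; rewrite !yz// ltnW.
Qed.

Definition word_path (n : nat) (a : nat -> nat) : R -> R :=
  PL n (fun k => valw a k * (Num.sqrt n%:R)^-1).

Lemma rescaled_path_PL n (s : 'S_n.+1) (t : R) : (0 < n)%N -> 0 <= t <= 1 ->
  rescaled_path s t = word_path n (fun i => s (inord i)) t.
Proof.
move=> n0 t01; have n0' : 0 < n%:R :> R by rewrite ltr0n.
pose a (i : nat) : nat := s (inord i).
rewrite /rescaled_path /word_path -/a; set r := (Num.sqrt _)^-1.
have vE k : fval s k = valw a k :> R by [].
rewrite /fsigma; case: ifP => [nt|nt].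
  have tE : t = 0.
    by apply/eqP; rewrite eq_le; case/andP: t01 => -> _; rewrite andbT -(ler_pM2l n0') mulr0.
  have k01 : 0%:R <= n%:R * t <= 1%:R by rewrite tE mulr0 lexx ler01.
  by rewrite (PLE _ n0 k01) tE /valw big_geq//; ring.
case: ifP => [nt1|nt1].
  have tE : t = 1.
    by apply/eqP; rewrite eq_le; case/andP: t01 => _ ->; rewrite -(ler_pM2l n0') mulr1.
  have kn : (n.-1 < n)%N by rewrite prednK.
  have k01 : n.-1%:R <= n%:R * t <= n.-1.+1%:R by rewrite tE mulr1 prednK// lexx ler_nat leq_pred.
  rewrite (PLE _ kn k01) tE mulr1 prednK// vE.
  have -> : n%:R - n.-1%:R = 1 :> R by rewrite -natrB ?leq_pred// -subn1 subKn.
  by ring.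
set x := n%:R * t in nt nt1 *; set k := absz _.
have x0 : 0 < x by rewrite ltNge nt.
have kE : k%:R = (Num.floor x)%:~R :> R.
  by rewrite /k pmulrn gez0_abs// floor_ge0 ltW.
have /andP[h1] := floor_itv x; rewrite intrD -kE => h2.
have kn : (k < n)%N by rewrite -(ltr_nat R) (le_lt_trans _ (_ : x < _)) ?kE ?floor_le// ltNge nt1.
have k01 : k%:R <= n%:R * t <= k.+1%:R.
  by rewrite -/x -natr1 (ltW h2) andbT kE floor_le.
rewrite (PLE _ kn k01) vE -/x.
have -> : valw a k.+1 = valw a k + fstep s k.+1 :> R.
  by rewrite /valw [LHS]big_nat_recr.
by ring.
Qed.

Lemma rescaled_path_continuous n (s : 'S_n.+1) : (0 < n)%N ->
  {within `[0, 1], continuous (rescaled_path s : R -> R)}.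
Proof.
move=> n0; apply: (@subspace_eq_continuous _ _ _ (word_path n (fun i => s (inord i)))).
  by move=> t; rewrite inE /= in_itv /= => t01; exact/esym/rescaled_path_PL.
exact: PL_within.
Qed.

Section Walk.
Variables (F : (R -> R) -> R) (L M : R).
Hypotheses (FM : bounded_functional F M) (FL : lipschitz_functional F L).
Hypotheses (L0 : 0 <= L) (M0 : 0 <= M).

Let F_ext g g' : {within `[0, 1], continuous g} -> {within `[0, 1], continuous g'} ->
  (forall t, 0 <= t <= 1 -> g t = g' t) -> F g = F g'.
Proof.
move=> cg cg' gg'; apply/eqP; rewrite -subr_eq0 -normr_le0 -(mulr0 L).
by apply: FL => // t t01; rewrite gg'// subrr normr0.
Qed.

(** The argument [s] lists increments and [r] is their scale: [1 / sqrt n] for single steps, 1 for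
    block sums that are already scaled. *)
Definition path_functional m (r : R) (s : seq R) : R :=
  F (PL m (fun k => (\sum_(x <- take k s) x) * r)).

Lemma perm_walk_dist n N' : (0 < n)%N -> (n <= N'.+1)%N ->
  `|uniform_perm_expect n F -
    itE (nseq n (step_mean N')) (path_functional n (Num.sqrt n%:R)^-1)| <=
  2 * M * (n.+1%:R ^+ 2 / N'.+1%:R) + 3 * L * (Num.sqrt n%:R)^-1.
Proof.
move=> n0 nN; set r := (Num.sqrt n%:R)^-1.
have r0 : 0 <= r by rewrite invr_ge0 sqrtr_ge0.
pose G a := F (word_path n a).
have GM a : `|G a| <= M by apply: FM; exact: PL_within.
have Gext (a a' : nat -> nat) :
    (forall i j, (i <= n)%N -> (j <= n)%N -> (a i < a j)%N = (a' i < a' j)%N) -> G a = G a'.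
  move=> aa; congr F; apply: eq_PL => k kn; congr (_ * _).
  exact: valw_le_compare kn aa.
have := perm_word_dist N' Gext GM.
have -> : uniform_perm_expect n F = #|{perm 'I_n.+1}|%:R^-1 *
    \sum_(s : 'S_n.+1) G (fun i => s (inord i)).
  rewrite /uniform_perm_expect; congr (_ * _); apply: eq_bigr => s _.
  apply: F_ext; [exact: rescaled_path_continuous|exact: PL_within|].
  by move=> t t01; exact: rescaled_path_PL.
set p := _ * _; set W := wavg _ _ _ => h1.
set I := itE _ _.
have -> : p - I = (W - I) - (W - p) by ring.
apply: le_trans (ler_normB _ _) _; rewrite addrC; apply: lerD => //.
(* The first letter is held fixed and the other [n] letters are generated by increments from it; the
   walk does not depend on its value. *)
rewrite /W /I /= -[X in _ - X](uavg_cst N'); apply: uavg_dist => a.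
rewrite (wavg_walk n a) -wavg_itE; apply: wavg_dist => b bn bN.
rewrite -mulrA mulrCA; apply: FL; [exact: PL_within|exact: PL_within|by rewrite mulr_ge0|].
move=> t t01; apply: PL_dist => // k kn.
rewrite -mulrBl normrM (ger0_norm r0) ler_wpM2r//.
by apply: walk_valw_dist; rewrite ?ltn_ord ?bn.
Qed.

Lemma path_functional_bound m r s : `|path_functional m r s| <= M.
Proof. by apply: FM; exact: PL_within. Qed.

(** Changing one increment shifts all later values of the path by the same amount and leaves the
    earlier ones in place. *)
Lemma path_functional_lipschitz m s u (x y : R) : (0 < m)%N ->
  `|path_functional m 1 (s ++ x :: u) - path_functional m 1 (s ++ y :: u)| <= L * `|x - y|.
Proof.
move=> m0; apply: FL; [exact: PL_within|exact: PL_within|by []|].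
move=> t t01; apply: PL_dist => // k _; rewrite !mulr1.
have [ks|sk] := leqP k (size s).
  by rewrite !takel_cat// subrr normr0.
rewrite !take_cat ltnNge (ltnW sk) /= !big_cat /= opprD addrACA subrr add0r.
rewrite -(subnSK sk) /= !big_cons opprD addrACA subrr addr0 lexx //.
Qed.

Lemma itE_le_supp (E : mean (R := R)) n Phi Psi :
  (forall f g : R -> R, (forall x, `|x| <= 1 -> f x <= g x) -> E f <= E g) ->
  (forall s, size s = n -> all (fun x => `|x| <= 1) s -> Phi s <= Psi s) ->
  itE (nseq n E) Phi <= itE (nseq n E) Psi.
Proof.
move=> Eb; elim: n Phi Psi => [|n IH] Phi Psi PP /=; first exact: PP.
apply: Eb => x x1; apply: IH => s sn s1; apply: PP; first by rewrite /= sn.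
by rewrite /= x1.
Qed.

Lemma itE_dist_supp (E : mean (R := R)) n Phi Psi G :
  (forall f g : R -> R, (forall x, `|x| <= 1 -> f x <= g x) -> E f <= E g) ->
  (forall s, size s = n -> all (fun x => `|x| <= 1) s -> `|Phi s - Psi s| <= G s) ->
  `|itE (nseq n E) Phi - itE (nseq n E) Psi| <= itE (nseq n E) G.
Proof.
move=> Eb PP; rewrite -itEB ler_norml -mulN1r -itEZ.
by apply/andP; split; apply: itE_le_supp => // s sn s1; have := PP s sn s1;
  rewrite ler_norml ?mulN1r => /andP[].
Qed.

Lemma itE_nseq_block (E : mean (R := R)) n a K (H : seq R -> R) : (a + K <= n)%N ->
  itE (nseq n E) (fun s => H (take K (drop a s))) = itE (nseq K E) H.
Proof.
move=> aKn; have -> : n = (a + (K + (n - (a + K))))%N by lia.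
rewrite !nseqD !itE_cat -[RHS](itE_cst (nseq a E)); apply: eq_itE => s1.
rewrite size_nseq => s1a; rewrite itE_cat; apply: eq_itE => s2; rewrite size_nseq => s2K.
rewrite -[RHS](itE_cst (nseq (n - (a + K)) E)); apply: eq_itE => s3 _.
by rewrite drop_size_cat// take_size_cat.
Qed.

Definition scale_mean (E : mean (R := R)) (r : R) : mean (R := R).
Proof.
apply: (@Mean R (fun f => E (fun x => f (x * r)))).
- by move=> a f g; exact: mean_linear.
- by move=> f g fg; apply: mean_le => x; exact: fg.
- exact: mean1.
Defined.

Lemma itE_scale (E : mean (R := R)) K r Psi :
  itE (nseq K (scale_mean E r)) Psi = itE (nseq K E) (fun s => Psi [seq x * r | x <- s]).
Proof.
elim: K Psi => [//|K IH] Psi /=; apply: eq_mean => x; exact: IH.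
Qed.

Lemma itE_reshape (E : mean (R := R)) (Ks : seq nat) r Phi :
  itE (nseq (sumn Ks) E) (fun s => Phi [seq (\sum_(x <- b) x) * r | b <- reshape Ks s]) =
  itE [seq sum_mean (nseq K (scale_mean E r)) | K <- Ks] Phi.
Proof.
elim: Ks Phi => [//|K Ks IH] Phi.
rewrite [sumn _]/= nseqD itE_cat /= itE_scale; apply: eq_itE => s; rewrite size_nseq => sK.
rewrite -IH; apply: eq_itE => u _.
by rewrite take_size_cat// drop_size_cat//= big_map mulr_suml.
Qed.

Lemma take_reshape_sum (Ks : seq nat) k (s : seq R) r :
  \sum_(x <- take k [seq (\sum_(x <- b) x) * r | b <- reshape Ks s]) x =
  (\sum_(x <- take (sumn (take k Ks)) s) x) * r.
Proof.
elim: Ks k s => [|K Ks IH] [|k] s /=; rewrite ?take0 ?big_nil ?mul0r//.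
by rewrite big_cons IH takeD big_cat /= mulrDl.
Qed.

(** * Division of the walk into blocks *)

Variables (n m : nat).
(** With at least two steps per block on average, rounding leaves every block nonempty and its
    length within a factor 2 of [n / m]. *)
Hypotheses (m0 : (0 < m)%N) (mn : (2 * m <= n)%N).
Let n0 : (0 < n)%N. Proof. by move: m0 mn; lia. Qed.
Let r : R := (Num.sqrt n%:R)^-1.
Let n0' : 0 < n%:R :> R. Proof. by rewrite ltr0n. Qed.
Let r0 : 0 < r. Proof. by rewrite invr_gt0 sqrtr_gt0. Qed.
Let r2 : r ^+ 2 = n%:R^-1. Proof. by rewrite exprVn sqr_sqrtr ?ltW. Qed.
Let r1 : r <= 1.
Proof. by rewrite /r invf_le1 ?sqrtr_gt0// -[leLHS]sqrtr1 ler_wsqrtr// ler1n. Qed.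

Let cut k := ((n * k) %/ m)%N.
Definition blocks := [seq (cut k.+1 - cut k)%N | k <- iota 0 m].

Let cut_le k : (cut k <= cut k.+1)%N. Proof. by rewrite leq_div2r// leq_mul. Qed.

Let cut_block k : [/\ (cut k * m <= n * k)%N, (n * k < (cut k).+1 * m)%N,
   (cut k.+1 * m <= n * k + n)%N & (n * k + n < (cut k.+1).+1 * m)%N].
Proof.
have H j : (cut j * m <= n * j < (cut j).+1 * m)%N.
  rewrite leq_divM /=; have := ltn_pmod (n * j) m0; have := divn_eq (n * j) m.
  by rewrite /cut mulSn; lia.
have := H k; have := H k.+1; rewrite mulnS addnC => /andP[-> ->] /andP[-> ->].
by split; rewrite // addnC.
Qed.

Let block_size k : (k < m)%N -> [/\ (0 < cut k.+1 - cut k)%N, (cut k.+1 - cut k <= n)%N,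
   ((cut k.+1 - cut k) * m <= n + m)%N & (n <= (cut k.+1 - cut k) * m + m)%N].
Proof.
move=> km; have [h1 h2 h3 h4] := cut_block k; have h5 := cut_le k.
have e : ((cut k.+1 - cut k) * m = cut k.+1 * m - cut k * m)%N by rewrite mulnBl.
rewrite !mulSn in h2 h4.
have cn : (cut k.+1 <= n)%N.
  by rewrite -(mulnK n m0) leq_div2r// leq_mul.
have h6 : (n <= (cut k.+1 - cut k) * m + m)%N by rewrite e; lia.
split => //; last by rewrite e; lia.
  by rewrite lt0n; apply: contraTneq h6 => ->; move: m0 mn; lia.
by rewrite (leq_trans (leq_subr _ _)).
Qed.

Let sumn_blocks k : (k <= m)%N -> sumn (take k blocks) = cut k.
Proof.
move=> km; rewrite /blocks -map_take take_iota (minn_idPl km).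
elim: k {km} => [|k IH]; first by rewrite /cut muln0 div0n.
rewrite -addn1 iotaD map_cat sumn_cat IH /= add0n addn0 addn1.
by rewrite subnKC// cut_le.
Qed.

Let sumn_blocksT : sumn blocks = n.
Proof.
have := sumn_blocks (leqnn m); rewrite take_oversize ?size_map ?size_iota// => ->.
by rewrite /cut mulnK.
Qed.

(** Unless some block moves away from its start by [e] after scaling, [PL_coarse] applies. One block
    does so with probability of order [1 / (m^2 e^4)], so the [m] blocks together cost order
    [1 / (m e^4)]. Second moments would give [1 / (m e^2)] per block, which does not vanish after
    summation. *)
Lemma coarse_dist (E : mean (R := R)) (e : R) : 0 < e ->
  E id = 0 -> E (fun x => x ^+ 3) = 0 ->
  (forall f g : R -> R, (forall x, `|x| <= 1 -> f x <= g x) -> E f <= E g) ->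
  `|itE (nseq n E) (path_functional n r) -
    itE [seq sum_mean (nseq K (scale_mean E r)) | K <- blocks] (path_functional m 1)| <=
  L * (2 * e + r) + 24 * M / (m%:R * e ^+ 4).
Proof.
move=> e0 E1 E3 Eb; set lam := e / r.
have lam0 : 0 < lam by rewrite divr_gt0.
have m0' : 0 < m%:R :> R by rewrite ltr0n.
rewrite -itE_reshape sumn_blocksT.
pose reach k (s : seq R) := reaches lam 0 (take (cut k.+1 - cut k) (drop (cut k) s)).
(* The number of bad blocks dominates the indicator that one exists, and its expectation splits over
   the blocks. *)
pose bad s : R := \sum_(k <- iota 0 m) (reach k s)%:R.
have bad0 s : 0 <= bad s by apply: sumr_ge0.
have pathE s : path_functional m 1 [seq (\sum_(x <- b) x) * r | b <- reshape blocks s] =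
    F (PL m (fun k => (\sum_(x <- take (cut k) s) x) * r)).
  congr F; apply: eq_PL => k km.
  by rewrite mulr1 take_reshape_sum sumn_blocks.
have dist s : size s = n -> all (fun x => `|x| <= 1) s ->
    `|path_functional n r s -
      path_functional m 1 [seq (\sum_(x <- b) x) * r | b <- reshape blocks s]| <=
    L * (2 * e + r) + 2 * M * bad s.
  move=> sn s1; rewrite pathE.
  have [|/hasPn noreach] := boolP (has (reach^~ s) (iota 0 m)).
    move=> /hasP[k kin kr].
    apply: (@le_trans _ _ (2 * M)).
      apply: le_trans (ler_normB _ _) _; rewrite mulr2n mulrDl mul1r lerD//.
        exact: path_functional_bound.
      by apply: FM; exact: PL_within.
    apply: ler_wpDl; first by rewrite mulr_ge0// addr_ge0 ?mulr_ge0 ?ltW.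
    rewrite ler_peMr ?mulr_ge0//.
    rewrite /bad (bigD1_seq k) ?iota_uniq//= kr lerDl; exact: sumr_ge0.
  apply: (@le_trans _ _ (L * (2 * e + r))); last by rewrite lerDl mulr_ge0 ?mulr_ge0.
  apply: FL; [exact: PL_within|exact: PL_within|by rewrite addr_ge0 ?mulr_ge0 ?ltW|].
  move=> t t01; apply: (@PL_coarse _ n m (fun k => (\sum_(x <- take k s) x) * r)) => //.
    move=> k j km /andP[kj jk]; have := noreach k; rewrite mem_iota km => /(_ isT).
    move=> /reachesPn /(_ (j - cut k)%N).
    have cn : (cut k.+1 <= n)%N by rewrite -(mulnK n m0) leq_div2r// leq_mul.
    rewrite size_takel ?size_drop ?sn; last by rewrite leq_sub2r.
    rewrite take_takel; last by rewrite leq_sub2r.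
    move=> /(_ (leq_sub2r _ jk)) H.
    rewrite -mulrBl normrM (gtr0_norm r0) -ler_pdivlMr//; apply: ltW; apply: le_lt_trans H.
    by rewrite -{1}(subnKC kj) takeD big_cat /= addrAC subrr !add0r.
  move=> j jn; rewrite -mulrBl normrM (gtr0_norm r0) ler_piMl ?(ltW r0)//.
  rewrite (take_nth 0) ?sn// -cats1 big_cat big_seq1 /= addrAC subrr add0r.
  by apply: (allP s1); rewrite mem_nth ?sn.
apply: le_trans (itE_dist_supp Eb dist) _.
have -> : itE (nseq n E) (fun s => L * (2 * e + r) + 2 * M * bad s) =
    L * (2 * e + r) + 2 * M * itE (nseq n E) bad.
  by rewrite itED itE_cst itEZ.
rewrite lerD2l.
have -> : 24 * M / (m%:R * e ^+ 4) = 2 * M * (12 / (m%:R * e ^+ 4)) by ring.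
rewrite ler_wpM2l ?mulr_ge0// itE_sum.
apply: (@le_trans _ _ (\sum_(k <- iota 0 m) (12 / (m%:R ^+ 2 * e ^+ 4)))).
  rewrite big_seq [leRHS]big_seq; apply: ler_sum => k; rewrite mem_iota => /andP[_ km].
  have [K0 Kn Km _] := block_size km.
  have cn : (cut k.+1 <= n)%N by rewrite -(mulnK n m0) leq_div2r// leq_mul.
  rewrite (@itE_nseq_block E n (cut k) _ (fun u => (reaches lam 0 u)%:R)); last first.
    by rewrite subnKC// cut_le.
  apply: le_trans (reaches_prob E1 E3 Eb _ lam0) _.
  set K := (_ - _)%N in K0 Kn Km *.
  (* With [lam = e / r] this bounds [3 * K^2 / lam^4] by [3 * 2^2 / (m^2 e^4)]: the origin of 12,
     and of 24 after the factor [2 * M]. *)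
  have Km' : K%:R * m%:R <= 2 * n%:R :> R by rewrite -!natrM ler_nat; lia.
  have -> : 3 * K%:R ^+ 2 / lam ^+ 4 = 3 * (K%:R * m%:R * n%:R^-1) ^+ 2 / (m%:R ^+ 2 * e ^+ 4) :> R.
    rewrite -r2 /lam; field.
    by rewrite !gt_eqF.
  rewrite ler_pM2r ?invr_gt0 ?mulr_gt0 ?exprn_gt0//.
  have q0 : 0 <= K%:R * m%:R * n%:R^-1 :> R by rewrite !mulr_ge0 ?invr_ge0.
  have q2 : K%:R * m%:R * n%:R^-1 <= 2 :> R by rewrite ler_pdivrMr.
  by nra.
rewrite big_const_seq count_predT size_iota iter_addr_0 -[_ *+ m]mulr_natl.
rewrite le_eqVlt; apply/orP; left; apply/eqP; field.
by rewrite !gt_eqF.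
Qed.

Section Brownian.
Context d (T : measurableType d) (P : probability T R) (B : R -> T -> R).
Hypothesis hB : standard_brownian_motion P B.
Let c : R := (Num.sqrt 3)^-1.

Let c2 : c ^+ 2 = 3^-1. Proof. by rewrite exprVn sqr_sqrtr. Qed.
Let c0 : 0 <= c. Proof. by rewrite invr_ge0. Qed.
Let c1 : c <= 1.
Proof. by rewrite /c invf_le1 ?sqrtr_gt0// -[leLHS]sqrtr1 ler_wsqrtr// ler1n. Qed.

(** For each block, the variance mismatch and the third moments are all of order [r]. So for fixed
    [m] and [h] the second term vanishes as [n] grows, and [h] then controls the first. *)
Lemma block_walk_dist N' (h : R) : 0 < h -> (n <= N'.+1)%N ->
  `|itE [seq sum_mean (nseq K (scale_mean (step_mean N') r)) | K <- blocks]
      (path_functional m 1) -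
    (\int[P]_w F (PL m (fun k => c * B (k%:R / m%:R) w)))%R| <=
  m%:R * (4 * L * h + r * (4 * M + 20 * L) / h ^+ 2).
Proof.
move=> h0 nN; set E := scale_mean _ _.
have m0' : 0 < m%:R :> R by rewrite ltr0n.
have h2 : 0 < h ^+ 2 by rewrite exprn_gt0.
have E1 : E id = 0.
  change (step_mean N' (fun x => x * r) = 0).
  by apply: step_mean_odd => x; rewrite mulNr.
pose v := r ^+ 2 * (3^-1 - (3 * N'.+1%:R ^+ 2)^-1).
have E2 : E (fun x => x ^+ 2) = v.
  rewrite /v -step_mean_sqr -meanZ /=; apply: eq_uavg => b.
  by rewrite exprMn mulrC.
pose t := r ^+ 3 * step_mean N' (fun x => `|x| ^+ 3).
have E3 : E (fun x => `|x| ^+ 3) = t.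
  rewrite /t -meanZ /=; apply: eq_uavg => b.
  by rewrite normrM exprMn (gtr0_norm r0) mulrC.
have sK : size blocks = m by rewrite size_map size_iota.
have blockP K : K \in blocks -> [/\ (0 < K)%N, (K <= n)%N, (K * m <= n + m)%N & (n <= K * m + m)%N].
  by move=> /mapP[k]; rewrite mem_iota => /andP[_ km] ->; exact: block_size.
have := brownian_block_dist hB c h0 L0 M0 m0 E1 E2 E3 sK
  (fun K KK => let: And4 K0 _ _ _ := blockP K KK in K0)
  (fun s => path_functional_bound m 1 s)
  (fun s u x y => path_functional_lipschitz s u x y m0).
have -> : (\int[P]_w path_functional m 1
    [seq c * increment B (fun i => i%:R / m%:R) i w | i <- iota 0 m])%R =
    (\int[P]_w F (PL m (fun k => c * B (k%:R / m%:R) w)))%R.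
  apply: eq_Rintegral => w _; congr F; apply: eq_PL => k km.
  rewrite mulr1 -map_take take_iota (minn_idPl km) big_map -mulr_sumr; congr (_ * _).
  have := @telescope_sumr _ 0 k (fun i => B (i%:R / m%:R) w) (leq0n k).
  rewrite /index_iota subn0 => ->; rewrite mul0r.
  by case: hB => -> _ _ _; rewrite subr0.
move=> /le_trans; apply.
apply: (@le_trans _ _ (\sum_(K <- blocks) (4 * L * h + r * (4 * M + 20 * L) / h ^+ 2))); last first.
  by rewrite big_const_seq count_predT sK iter_addr_0 -[_ *+ m]mulr_natl.
rewrite big_seq [leRHS]big_seq; apply: ler_sum => K /blockP[K0 Kn Km nK].
rewrite lerD2l.
have K0' : 0 < K%:R :> R by rewrite ltr0n.
(* The standard deviation of a Brownian increment over a fine cell, comparable to the step scale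
   [r]. *)
set sg := Num.sqrt _.
have sg0 : 0 <= sg by rewrite sqrtr_ge0.
have sg2 : sg ^+ 2 = (m%:R * K%:R)^-1 by rewrite sqr_sqrtr ?invr_ge0// natrM.
have rn : r ^+ 2 * n%:R = 1 by rewrite r2 mulVf// gt_eqF.
have r2r : r ^+ 2 <= r by rewrite expr2 ler_piMl// ltW.
have Kr : K%:R * r ^+ 2 <= 1 by rewrite r2 ler_pdivrMr// mul1r ler_nat.
have sgr : sg <= 2 * r.
  rewrite -(ler_pXn2r (n := 2))// ?nnegrE ?mulr_ge0 ?(ltW r0)// sg2 exprMn r2.
  rewrite -[X in _ <= X * _]invrK -invfM lef_pV2 ?posrE ?mulr_gt0 ?invr_gt0//.
  rewrite ler_pdivrMl//.
  have nK' : n%:R <= K%:R * m%:R + m%:R :> R by rewrite -natrM -natrD ler_nat.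
  have mn' : 2 * m%:R <= n%:R :> R by rewrite -natrM ler_nat.
  by nra.
have Ksg : K%:R * sg ^+ 3 <= 2 * r.
  have -> : K%:R * sg ^+ 3 = m%:R^-1 * sg.
    by rewrite exprS sg2; field; rewrite !gt_eqF.
  by apply: le_trans sgr; rewrite ler_piMl// invf_le1// ler1n.
have c3 : `|c| ^+ 3 <= 1 by rewrite ger0_norm// exprn_ile1.
have c30 : 0 <= `|c| ^+ 3 by rewrite exprn_ge0.
(* Two sources, each at most [r]: [K * m] differs from [n] by at most [m], and the discrete uniform
   law has variance [1/3] minus [1 / (3 N^2)]. *)
have vb : `|K%:R * v - c ^+ 2 / m%:R| <= 2 * r.
  have NK : (3 * N'.+1%:R ^+ 2)^-1 <= r ^+ 2 :> R.
    rewrite r2 lef_pV2 ?posrE ?mulr_gt0 ?exprn_gt0 ?ltr0n//.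
    have : n%:R <= N'.+1%:R :> R by rewrite ler_nat.
    have : 1 <= N'.+1%:R :> R by rewrite ler1n.
    by nra.
  have NK0 : 0 <= (3 * N'.+1%:R ^+ 2)^-1 :> R by rewrite invr_ge0 mulr_ge0// exprn_ge0.
  have -> : K%:R * v - c ^+ 2 / m%:R =
      (K%:R * m%:R - n%:R) * (r ^+ 2 / m%:R) / 3 - K%:R * r ^+ 2 * (3 * N'.+1%:R ^+ 2)^-1.
    rewrite c2 /v; have := rn; move: (r ^+ 2) ((3 * _)^-1) => q z qn.
    have -> : (K%:R * m%:R - n%:R) * (q / m%:R) / 3 = K%:R * q / 3 - (q * n%:R) / m%:R / 3.
      by field; rewrite gt_eqF.
    by rewrite qn; field; rewrite gt_eqF.
  have -> : 2 * r = r + r by ring.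
  apply: le_trans (ler_normB _ _) _; apply: lerD.
    have q0 : 0 <= r ^+ 2 / m%:R by rewrite divr_ge0// sqr_ge0.
    rewrite normrM [`|3^-1|]ger0_norm// normrM (ger0_norm q0).
    have d1 : `|K%:R * m%:R - n%:R| <= m%:R :> R.
      have a1 : K%:R * m%:R <= n%:R + m%:R :> R by rewrite -natrM -natrD ler_nat.
      have a2 : n%:R <= K%:R * m%:R + m%:R :> R by rewrite -natrM -natrD ler_nat.
      by rewrite ler_norml; apply/andP; split; lra.
    apply: (@le_trans _ _ (m%:R * (r ^+ 2 / m%:R) / 3)).
      by rewrite ler_wpM2r ?invr_ge0// ler_wpM2r.
    rewrite mulrCA divff ?gt_eqF// mulr1; have := sqr_ge0 r; lra.
  rewrite ger0_norm; last by rewrite mulr_ge0// mulr_ge0// sqr_ge0.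
  apply: (@le_trans _ _ (1 * r ^+ 2)); last by rewrite mul1r.
  by apply: ler_pM => //; rewrite mulr_ge0// sqr_ge0.
have tb : K%:R * t <= r.
  have /andP[s0 s1] := step_mean_abs3 (R := R) N'.
  rewrite /t; have -> : K%:R * (r ^+ 3 * step_mean N' (fun x => `|x| ^+ 3)) =
    (K%:R * r ^+ 2) * (step_mean N' (fun x => `|x| ^+ 3) * r) by ring.
  rewrite -[leRHS]mul1r; apply: ler_pM => //.
  - by rewrite mulr_ge0// sqr_ge0.
  - by rewrite mulr_ge0// ltW.
  - by rewrite ler_piMl// ltW.
(* The parts are the variance mismatch [2 * r], the third moment [r] of the steps and the third
   moment [4 * r] of the normal increments. *)
have -> : r * (4 * M + 20 * L) / h ^+ 2 = 2 * M / h ^+ 2 * (2 * r) + 4 * L / h ^+ 2 * (r + 4 * r) by ring.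
have A0 : 0 <= 2 * M / h ^+ 2 by rewrite divr_ge0 ?mulr_ge0// ltW.
have B0 : 0 <= 4 * L / h ^+ 2 by rewrite divr_ge0 ?mulr_ge0// ltW.
apply: lerD; first exact: ler_wpM2l.
apply: ler_wpM2l => //; apply: lerD => //.
have -> : 2 * `|c| ^+ 3 * K%:R * sg ^+ 3 = `|c| ^+ 3 * (2 * (K%:R * sg ^+ 3)) by ring.
have -> : 4 * r = 1 * (2 * (2 * r)) by ring.
apply: ler_pM => //; first by rewrite !mulr_ge0// exprn_ge0.
by rewrite ler_pM2l.
Qed.
End Brownian.
End Walk.
End LipschitzFunctional.

(** * From Lipschitz to continuous functionals *)

Section Functionals.
Context {R : realType}.
Implicit Types (F : (R -> R) -> R) (g : R -> R).

Definition continuous_functional F :=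
  forall g : R -> R, {within `[0, 1], continuous g} ->
     forall e : R, 0 < e -> exists2 d : R, 0 < d &
       forall h : R -> R, {within `[0, 1], continuous h} ->
         (forall t, t \in `[0, 1] -> `|g t - h t| <= d) ->
         `|F g - F h| < e.

Lemma mem_itv01 (t : R) : (t \in `[0, 1]%classic) = (0 <= t <= 1).
Proof. by apply/idP/idP; rewrite inE /= in_itv. Qed.

Lemma functional_cvg F g (h : nat -> R -> R) : continuous_functional F ->
  {within `[0, 1], continuous g} -> (forall j, {within `[0, 1], continuous (h j)}) ->
  (forall d : R, 0 < d -> \forall j \near \oo, forall t, 0 <= t <= 1 -> `|g t - h j t| <= d) ->
  F (h j) @[j --> \oo] --> F g.
Proof.
move=> cF cg ch gh; apply/cvgrPdist_le => /= e e0.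
have [d d0 Fd] := cF g cg e e0.
apply: filterS (gh d d0) => j hj; apply: ltW; apply: Fd => // t.
by rewrite mem_itv01; exact: hj.
Qed.

Lemma lipschitz_functional_continuous F L : 0 <= L -> lipschitz_functional F L ->
  continuous_functional F.
Proof.
move=> L0 FL g cg e e0; have L1 : 0 < L + 1 by rewrite ltr_wpDl.
(* [L + 1] covers the case [L = 0], and the factor 2 makes the final inequality strict. *)
exists (e / (L + 1) / 2); first by rewrite !divr_gt0.
move=> h ch gh; apply: (@le_lt_trans _ _ (L * (e / (L + 1) / 2))).
  apply: FL => //; first by rewrite !divr_ge0 ?ltW.
  by move=> t t01; apply: gh; rewrite mem_itv01.
apply: (@le_lt_trans _ _ ((L + 1) * (e / (L + 1) / 2))).
  by rewrite ler_wpM2r ?lerDl ?divr_ge0 ?ltW.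
have -> : (L + 1) * (e / (L + 1) / 2) = e / 2 by field; rewrite gt_eqF.
by rewrite ltr_pdivrMr// ltr_pMr// ltr1n.
Qed.

(* The largest [j]-Lipschitz minorant of [F] for the uniform distance. *)
Definition infconv F (j : nat) g : R := inf [set x : R | exists (h : R -> R) (d : R),
  [/\ {within `[0, 1], continuous h}, 0 <= d,
      forall t, 0 <= t <= 1 -> `|g t - h t| <= d & x = F h + j%:R * d]].

Section Infconv.
Variables (F : (R -> R) -> R) (M : R).
Hypothesis FM : bounded_functional F M.

Let S j g := [set x : R | exists (h : R -> R) (d : R),
  [/\ {within `[0, 1], continuous h}, 0 <= d,
      forall t, 0 <= t <= 1 -> `|g t - h t| <= d & x = F h + j%:R * d]].

Let S_lb j g x : S j g x -> - M <= x.
Proof.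
move=> [h [d [ch d0 _ ->]]]; have := FM ch; rewrite ler_norml => /andP[Fh _].
by rewrite -[- M]addr0 lerD// mulr_ge0.
Qed.

Let S_self j g : {within `[0, 1], continuous g} -> S j g (F g).
Proof.
move=> cg; exists g, 0; split => //; last by rewrite mulr0 addr0.
by move=> t _; rewrite subrr normr0.
Qed.

Lemma infconv_le j g : {within `[0, 1], continuous g} -> infconv F j g <= F g.
Proof.
move=> cg; apply: ge_inf; last exact: S_self.
by exists (- M) => x; exact: S_lb.
Qed.

Lemma infconv_bounded j : bounded_functional (infconv F j) M.
Proof.
move=> g cg; rewrite ler_norml; apply/andP; split.
  by apply: lb_le_inf; [exists (F g); exact: S_self|move=> x; exact: S_lb].
apply: le_trans (infconv_le j cg) _; apply: le_trans (ler_norm _) (FM cg).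
Qed.

(** A competitor for [g'] at distance [d] is a competitor for [g] at distance [d + e], at the extra
    price [j%:R * e]. *)
Let infconv_lip1 j g g' (e : R) : {within `[0, 1], continuous g} ->
  {within `[0, 1], continuous g'} -> 0 <= e ->
  (forall t, 0 <= t <= 1 -> `|g t - g' t| <= e) ->
  infconv F j g <= infconv F j g' + j%:R * e.
Proof.
move=> cg cg' e0 gg'; rewrite -lerBlDr; apply: lb_le_inf; first by exists (F g'); exact: S_self.
move=> _ [h [d [ch d0 gh ->]]]; rewrite lerBlDr -addrA -mulrDr; apply: ge_inf.
  by exists (- M) => x; exact: S_lb.
exists h, (d + e); split => //; first exact: addr_ge0.
move=> t t01; rewrite (le_trans (ler_distD (g' t) _ _))// addrC lerD//; first exact: gh.
exact: gg'.
Qed.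

Lemma infconv_lipschitz j : lipschitz_functional (infconv F j) j%:R.
Proof.
move=> g g' e cg cg' e0 gg'.
have h1 := infconv_lip1 j cg cg' e0 gg'.
have gg'2 t : 0 <= t <= 1 -> `|g' t - g t| <= e by move=> t01; rewrite distrC; exact: gg'.
have h2 := infconv_lip1 j cg' cg e0 gg'2.
by rewrite ler_norml; apply/andP; split; lra.
Qed.

(** Continuity at [g] handles competitors within the radius [d]. Those farther away pay more than
    [j%:R * d], which exceeds the whole oscillation [2 * M] of [F] once [j] is large. *)
Lemma infconv_cvg g : continuous_functional F -> {within `[0, 1], continuous g} ->
  infconv F j g @[j --> \oo] --> F g.
Proof.
move=> cF cg; apply/cvgrPdist_le => /= e e0.
have [d d0 Fd] := cF g cg e e0.
near=> j; have : 2 * M / d <= j%:R by near: j; exact: nbhs_infty_ger.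
rewrite ler_pdivrMr// => jd.
rewrite ger0_norm ?subr_ge0 ?infconv_le// lerBlDr -lerBlDl.
apply: lb_le_inf; first by exists (F g); exact: S_self.
move=> _ [h [d' [ch d'0 gh ->]]].
have [dd|dd] := leP d' d.
  have : `|F g - F h| < e.
    by apply: Fd => // t; rewrite mem_itv01 => t01; exact: le_trans (gh t t01) dd.
  rewrite ltr_norml => /andP[_ Fgh].
  by have : 0 <= j%:R * d' by [rewrite mulr_ge0]; lra.
have Fg := FM cg; have Fh := FM ch; rewrite !ler_norml in Fg Fh.
have : j%:R * d <= j%:R * d' by rewrite ler_wpM2l// ltW.
by move: Fg Fh => /andP[? ?] /andP[? ?]; lra.
Unshelve. all: by end_near. Qed.
End Infconv.
End Functionals.

(** * Passage to the limit *)

Section Convergence.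
Context {R : realType} d (T : measurableType d) (P : probability T R) (B : R -> T -> R).
Hypothesis hB : standard_brownian_motion P B.
Let c : R := (Num.sqrt 3)^-1.
Implicit Types F : (R -> R) -> R.

Let cB w : {within `[0, 1], continuous (fun t => c * B t w)}.
Proof.
case: hB => _ cont _ _; have := cont w => cw t.
by apply: cvgM; [exact: cvg_cst|exact: cw].
Qed.

Let PLB m w : R -> R := PL m (fun k => c * B (k%:R / m%:R) w).

Let PLB_cvg F w : continuous_functional F ->
  F (PLB m.+1 w) @[m --> \oo] --> F (fun t => c * B t w).
Proof.
move=> cF; rewrite (cvg_shiftS (fun m => F (PLB m w))).
apply: functional_cvg; [exact: cF|exact: cB|by move=> m; exact: PL_within|].
move=> e e0; have H := @PL_uniform R (fun t => c * B t w) e (@cB w) e0.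
by apply: filterS H => m H t t01; exact: H.
Qed.

(** Rounding the increments gives a finite-valued measurable function whatever [F] is; continuity of
    [F] makes these functions converge as the mesh vanishes. *)
Let PLB_measurable F m : continuous_functional F -> (0 < m)%N ->
  measurable_fun setT (fun w => F (PLB m w)).
Proof.
move=> cF m0; pose u i : R := i%:R / m%:R.
have m0' : 0 < m%:R :> R by rewrite ltr0n.
have gu : grid m u.
  split; first by rewrite /u mul0r.
    by move=> i _; rewrite /u ltr_pM2r ?invr_gt0// ltr_nat.
  by rewrite /u divff// gt_eqF.
have mX i : (i < m)%N -> measurable_fun setT (increment B u i).
  exact: (increment_measurable hB gu).
have iota_lt : {in iota 0 m, forall i, (i < m)%N} by move=> i; rewrite mem_iota.
pose Phi s := F (PL m (fun k => \sum_(x <- take k s) x)).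
apply: (@measurable_fun_cvg _ _ _ setT
  (fun j w => Phi [seq quantc c j (increment B u i w) | i <- iota 0 m])).
  by move=> j; exact: (quant_seq_measurable mX _ _ iota_lt).1.
move=> w _; rewrite /Phi.
apply: functional_cvg; [exact: cF|exact: PL_within|by move=> j; exact: PL_within|].
have PLBE : PLB m w = PL m (fun k => \sum_(i <- iota 0 k) c * increment B u i w).
  apply: eq_PL => k km; rewrite -mulr_sumr; congr (_ * _).
  have := @telescope_sumr _ 0 k (fun i => B (u i) w) (leq0n k).
  rewrite /index_iota subn0 => ->; rewrite /u mul0r.
  by case: hB => -> _ _ _; rewrite subr0.
move=> e e0.
have : \sum_(i <- iota 0 m) `|c * increment B u i w - quantc c j (increment B u i w)|
    @[j --> \oo] --> (0 : R).
  rewrite [X in _ --> X](_ : 0 = \sum_(i <- iota 0 m) `|c * increment B u i w - c * increment B u i w|).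
    apply: cvg_sumr => i _.
    by apply: cvg_norm; apply: cvgB; [exact: cvg_cst|exact: quantc_cvg].
  by rewrite big1// => i _; rewrite subrr normr0.
move=> /cvgrPdist_le /(_ e e0); apply: filterS => j; rewrite sub0r normrN => hj t t01.
rewrite PLBE; apply: PL_dist => // k km; apply: le_trans hj; apply: le_trans (ler_norm _).
rewrite -map_take take_iota (minn_idPl km) big_map -sumrB.
apply: le_trans (ler_norm_sum _ _ _) _.
by rewrite -{1}(subnKC km) iotaD big_cat /= lerDl sumr_ge0.
Qed.

Lemma functional_measurable F : continuous_functional F ->
  measurable_fun setT (fun w => F (fun t => c * B t w)).
Proof.
move=> cF; apply: (@measurable_fun_cvg _ _ _ setT (fun m w => F (PLB m.+1 w))).
  by move=> m; exact: PLB_measurable.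
by move=> w _; exact: PLB_cvg.
Qed.

Let PLB_expectation_cvg F M : bounded_functional F M -> continuous_functional F ->
  (\int[P]_w F (PLB m w))%R @[m --> \oo] --> (\int[P]_w F (fun t => c * B t w))%R.
Proof.
move=> FM cF; rewrite -(cvg_shiftS (fun m => (\int[P]_w F (PLB m w))%R)).
have [||||//] := @Rdominated_convergence _ _ _ P (fun m w => F (PLB m.+1 w))
  (fun w => F (fun t => c * B t w)) (fun=> M).
- by move=> m; exact: PLB_measurable.
- by move=> w; exact: PLB_cvg.
- apply: (bounded_integrable P measurableT (M := `|M|)) => //= w; exact: lexx.
- by move=> m w; apply: FM; exact: PL_within.
Qed.

(** Five errors of size [e / 5]: oscillation [eps] within blocks, interpolation of the Brownian
    path, probability of a bad block, smoothing, and all terms of order [r]. They are met by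
    choosing [eps], then [m], then [h] depending on [m], then [n]. *)
Lemma lipschitz_convergence F L M : 0 <= L -> 0 <= M ->
  bounded_functional F M -> lipschitz_functional F L ->
  uniform_perm_expect n F @[n --> \oo] --> (\int[P]_w F (fun t => c * B t w))%R.
Proof.
move=> L0 M0 FM FL.
have cF := lipschitz_functional_continuous L0 FL.
apply/cvgrPdist_le => /= e e0.
have e5 : 0 < e / 5 by rewrite divr_gt0.
have L1 : 0 < L + 1 by rewrite ltr_wpDl.
pose eps := e / (10 * (L + 1)).
have eps0 : 0 < eps by rewrite divr_gt0// mulr_gt0.
have eps4 : 0 < eps ^+ 4 by rewrite exprn_gt0.
have Leps : 2 * L * eps <= e / 5.
  apply: (@le_trans _ _ (2 * (L + 1) * eps)).
    by rewrite ler_pM2r// ler_pM2l// lerDl.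
  by rewrite le_eqVlt; apply/orP; left; apply/eqP; rewrite /eps; field; rewrite gt_eqF.
near \oo => m.
have m0 : (0 < m)%N by near: m; exact: nbhs_infty_gt.
have m0' : 0 < m%:R :> R by rewrite ltr0n.
have mB : `|(\int[P]_w F (fun t => c * B t w))%R - (\int[P]_w F (PLB m w))%R| <= e / 5.
  by near: m; have /cvgrPdist_le := PLB_expectation_cvg FM cF; exact.
have mM : 24 * M / (m%:R * eps ^+ 4) <= e / 5.
  rewrite ler_pdivrMr; last by rewrite mulr_gt0.
  rewrite [X in _ <= X]mulrCA -ler_pdivrMr; last by rewrite mulr_gt0.
  by near: m; exact: nbhs_infty_ger.
pose h := e / (20 * m%:R * (L + 1)).
have h0 : 0 < h by rewrite divr_gt0// !mulr_gt0.
have mh : m%:R * (4 * L * h) <= e / 5.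
  apply: (@le_trans _ _ (m%:R * (4 * (L + 1) * h))).
    by rewrite ler_pM2l// ler_pM2r// ler_pM2l// lerDl.
  by rewrite le_eqVlt; apply/orP; left; apply/eqP; rewrite /h; field; rewrite !gt_eqF.
(* The total coefficient of [r]; it does not depend on [n]. The part [4 * L] adds [3 * L] from the
   walk approximation and [L] from the coarse path. *)
pose A := 2 * M + 4 * L + m%:R * ((4 * M + 20 * L) / h ^+ 2).
near=> n.
have mn : (2 * m <= n)%N by near: n; exact: nbhs_infty_ge.
have n0 : (0 < n)%N by apply: leq_trans mn; rewrite muln_gt0.
set r := (Num.sqrt n%:R)^-1 : R.
have sn0 : 0 < Num.sqrt n%:R :> R by rewrite sqrtr_gt0 ltr0n.
have r0 : 0 < r by rewrite invr_gt0.
have r2 : r ^+ 2 = n%:R^-1 by rewrite exprVn sqr_sqrtr.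
have r1 : r <= 1 by rewrite /r invf_le1// -[leLHS]sqrtr1 ler_wsqrtr// ler1n.
have rA : r * A <= e / 5.
  rewrite /r ler_pdivrMl// -ler_pdivrMr//.
  apply: le_trans (ler_norm _) _; rewrite -sqrtr_sqr ler_wsqrtr//.
  by near: n; exact: nbhs_infty_ger.
(* The collision bound becomes [1 / (n + 1)], which is below [r ^+ 2] and so is absorbed in the
   terms of order [r]. *)
pose N' := (n.+1 ^ 3).-1.
have NE : N'.+1 = (n.+1 ^ 3)%N by rewrite prednK// expn_gt0.
have nN : (n <= N'.+1)%N.
  by rewrite NE (leq_trans (leqnSn n))// -{1}[n.+1]expn1 leq_exp2l.
have NNr : n.+1%:R ^+ 2 / N'.+1%:R <= r.
  rewrite NE natrX.
  have -> : n.+1%:R ^+ 2 / n.+1%:R ^+ 3 = n.+1%:R^-1 :> R.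
    have : n.+1%:R != 0 :> R by rewrite pnatr_eq0.
    by move: n.+1%:R => z z0; field.
  apply: (@le_trans _ _ (r ^+ 2)); last by rewrite expr2 ler_piMl// ltW.
  by rewrite r2 lef_pV2 ?posrE ?ltr0n// ler_nat.
have d1 := perm_walk_dist FM FL n0 nN.
have E1 : step_mean (R := R) N' id = 0 by apply: step_mean_odd.
have E3 : step_mean (R := R) N' (fun x => x ^+ 3) = 0.
  by apply: step_mean_odd => x; rewrite exprNn; ring.
have d2 := coarse_dist FM FL L0 M0 m0 mn eps0 E1 E3 (@step_mean_le R N').
have d3 := block_walk_dist FM FL L0 M0 m0 mn hB h0 nN.
move: d1 d2 d3; rewrite -/r -/c.
set p := uniform_perm_expect n F; set I1 := itE _ _; set I2 := itE _ _.
set I3 := (\int[P]_w F (PL _ _))%R => d1 d2 d3.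
rewrite distrC; have -> : p - (\int[P]_w F (fun t => c * B t w))%R = (p - I1) + ((I1 - I2) + ((I2 - I3) -
   ((\int[P]_w F (fun t => c * B t w))%R - I3))) by ring.
apply: le_trans (ler_normD _ _) _.
apply: le_trans (lerD d1 (ler_normD _ _)) _.
apply: le_trans (lerD (lexx _) (lerD d2 (ler_normB _ _))) _.
apply: le_trans (lerD (lexx _) (lerD (lexx _) (lerD d3 mB))) _.
have b1 : 2 * M * (n.+1%:R ^+ 2 / N'.+1%:R) <= 2 * M * r by rewrite ler_wpM2l// mulr_ge0.
have rAE : r * A = 2 * M * r + 4 * L * r + m%:R * (r * (4 * M + 20 * L) / h ^+ 2) by rewrite /A; ring.
rewrite rAE in rA.
have -> : L * (2 * eps + r) = 2 * L * eps + L * r by ring.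
have l3 : 3 * L * r = 3 * (L * r) by ring.
have l4 : 4 * L * r = 4 * (L * r) by ring.
rewrite (mulrDr m%:R) l3; rewrite l4 in rA.
move: b1 mM mh Leps rA; clear.
move: (2 * M * (n.+1%:R ^+ 2 / N'.+1%:R)) (24 * M / (m%:R * eps ^+ 4)) (m%:R * (4 * L * h))
  (2 * L * eps) (m%:R * (r * (4 * M + 20 * L) / h ^+ 2)) (L * r) (2 * M * r).
by move=> x1 x2 x3 x4 x5 x6 x7; lra.
Unshelve. all: by end_near. Qed.

Let upe_le F (G : (R -> R) -> R) n : (0 < n)%N ->
  (forall g : R -> R, {within `[0, 1], continuous g} -> F g <= G g) ->
  uniform_perm_expect n F <= uniform_perm_expect n G.
Proof.
move=> n0 FG; rewrite /uniform_perm_expect ler_wpM2l ?invr_ge0//.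
by apply: ler_sum => s _; apply: FG; exact: rescaled_path_continuous.
Qed.

(** By dominated convergence some minorant [infconv F j] has a Brownian expectation within [e / 2]
    of that of [F]. With this [j] fixed, the Lipschitz case applies to the minorant, whose average
    over permutations is at most that of [F]. *)
Let lower_bound F M : 0 <= M -> bounded_functional F M -> continuous_functional F ->
  forall e : R, 0 < e -> \forall n \near \oo,
    (\int[P]_w F (fun t => c * B t w))%R - e <= uniform_perm_expect n F.
Proof.
move=> M0 FM cF e e0.
have e2 : 0 < e / 2 by rewrite divr_gt0.
have cj : (\int[P]_w infconv F j (fun t => c * B t w))%R @[j --> \oo] -->
    (\int[P]_w F (fun t => c * B t w))%R.
  have [||||//] := @Rdominated_convergence _ _ _ P (fun j w => infconv F j (fun t => c * B t w))
    (fun w => F (fun t => c * B t w)) (fun=> M).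
  - move=> j; apply: functional_measurable.
    by apply: (lipschitz_functional_continuous (L := j%:R)) => //; exact: infconv_lipschitz FM j.
  - by move=> w; exact: (infconv_cvg FM).
  - by apply: (bounded_integrable P measurableT (M := `|M|)) => //= w; exact: lexx.
  - by move=> j w; apply: (infconv_bounded FM).
near \oo => j.
have hj : `|(\int[P]_w F (fun t => c * B t w))%R - (\int[P]_w infconv F j (fun t => c * B t w))%R| <= e / 2.
  by near: j; have /cvgrPdist_le := cj; exact.
have := @lipschitz_convergence (infconv F j) j%:R M (ler0n _ _) M0 (infconv_bounded FM j)
   (infconv_lipschitz FM j).
move=> /cvgrPdist_le /(_ _ e2) H; near=> n.
have hn : `|(\int[P]_w infconv F j (fun t => c * B t w))%R - uniform_perm_expect n (infconv F j)| <= e / 2.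
  by near: n.
have n0 : (0 < n)%N by near: n; exact: nbhs_infty_gt.
have := upe_le n0 (fun g cg => infconv_le FM j cg).
move: hj hn; rewrite !ler_norml => /andP[_ ?] /andP[_ ?] ?; lra.
Unshelve. all: by end_near. Qed.

(** Minorants only give a lower bound; the upper one is the lower bound for [- F]. *)
Lemma functional_convergence F M : 0 <= M -> bounded_functional F M -> continuous_functional F ->
  uniform_perm_expect n F @[n --> \oo] --> (\int[P]_w F (fun t => c * B t w))%R.
Proof.
move=> M0 FM cF; apply/cvgrPdist_le => /= e e0.
have NM : bounded_functional (fun g => - F g) M by move=> g cg; rewrite normrN; exact: FM.
have cN : continuous_functional (fun g => - F g).
  move=> g cg e' e'0; have [d' d'0 H] := cF g cg e' e'0; exists d' => // h ch gh.
  by rewrite -opprD normrN; exact: H.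
near=> n.
have h1 : (\int[P]_w F (fun t => c * B t w))%R - e <= uniform_perm_expect n F.
  by near: n; exact: lower_bound FM cF e e0.
have h2 : (\int[P]_w - F (fun t => c * B t w))%R - e <= uniform_perm_expect n (fun g => - F g).
  by near: n; exact: lower_bound NM cN e e0.
have uN : uniform_perm_expect n (fun g => - F g) = - uniform_perm_expect n F.
  by rewrite /uniform_perm_expect sumrN mulrN.
have IN : (\int[P]_w - F (fun t => c * B t w))%R = - (\int[P]_w F (fun t => c * B t w))%R.
  have iF : P.-integrable setT (EFin \o (fun w => F (fun t => c * B t w))).
    apply: (bounded_integrable P measurableT (functional_measurable cF) (M := M)) => w.
    exact: (FM _ (@cB w)).
  rewrite -mulN1r -RintegralZl//.
  by apply: eq_Rintegral => w _; rewrite mulN1r.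
rewrite uN IN in h2.
by rewrite ler_norml; apply/andP; split; lra.
Unshelve. all: by end_near. Qed.
End Convergence.

Theorem theorem33 (R : realType) (d : measure_display) (T : measurableType d)
    (P : probability T R) (B : R -> T -> R) :
  standard_brownian_motion P B ->
  forall F : (R -> R) -> R, bounded_continuous_functional F ->
  ((fun n : nat => (uniform_perm_expect n F)%:E) @ \oo -->
     (\int[P]_w (F (fun t => B t w / Num.sqrt 3))%:E)%E).
Proof.
move=> hB F [[M FM] cF].
have cF' : continuous_functional F by exact: cF.
have M0 : 0 <= M.
  by apply: le_trans (normr_ge0 (F (fun=> 0))) (FM _ _) => x; exact: cvg_cst.
have cE w : (fun t => B t w / Num.sqrt 3) = (fun t => (Num.sqrt 3)^-1 * B t w).
  by apply/funext => t; rewrite mulrC.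
have iF : P.-integrable setT (EFin \o (fun w => F (fun t => (Num.sqrt 3)^-1 * B t w))).
  apply: (bounded_integrable P measurableT (functional_measurable hB cF') (M := M)) => w.
  rewrite -cE; apply: FM; case: hB => _ cont _ _; have := cont w => cw t.
  by apply: cvgM; [exact: cw|exact: cvg_cst].
rewrite (_ : (\int[P]_w _)%E = ((\int[P]_w F (fun t => (Num.sqrt 3)^-1 * B t w))%R)%:E).
  apply: cvg_EFin; first exact: nearW.
  exact: (functional_convergence hB M0 FM cF').
rewrite /Rintegral fineK; last exact: integrable_fin_num.
by apply: eq_integral => w _; rewrite cE.
Qed.
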